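(* Let $(p:A\to M,[\cdot,\cdot],\rho)$ be a Lie algebroid with prolongation $\mathscr{A}$, and let $\Omega\in\Gamma(\wedge^2\mathscr{A}^* )$ be a symplectic section vanishing on the vertical subbundle. Then $J(\Omega)=0$ if and only if $$\Omega=\Theta+\omega_L$$ for some horizontal $\mathrm{d}_{\mathscr{A}}$-closed section $\Theta\in\Gamma(\wedge^2\mathscr{A}^* )$ and the Cartan 2-section $\omega_L$ of some regular Lagrangian $L\in C^\infty(A)$.
   Context: The prolongation of the Lie algebroid $(p:A\to M,[\cdot,\cdot],\rho)$ is the vector bundle $p_A:\mathscr{A}\to A$ with $$\mathscr{A}=\{(a,b,v)\in A\times A\times TA\mid v\in T_aA,\ p(a)=p(b),\ \rho(b)=T_ap(v)\},\qquad p_A(a,b,v)=a.$$ It is a Lie algebroid over $A$ with anchor $\hat\rho(a,b,v)=v$ and bracket determined, via the Leibniz rule, by its values on projectable sections, i.e. sections $Z(a)=(a,\sigma(p(a)),X(a))$ with $\sigma\in\Gamma(A)$ and $X\in\mathfrak{X}(A)$ $p$-related to $\rho(\sigma)$: for two such sections, $[Z_1,Z_2](a)=(a,[\sigma_1,\sigma_2](p(a)),[X_1,X_2](a))$. Let $\mathrm{d}_{\mathscr{A}}$ be its Lie algebroid de Rham differential on $\Gamma(\wedge^\bullet\mathscr{A}^* )$. The vertical subbundle is $\mathrm{Vert}(\mathscr{A})=\{(a,b,v)\in\mathscr{A}\mid b=0\}$. A section $\omega\in\Gamma(\wedge^k\mathscr{A}^* )$ is horizontal if $\mathrm{i}_Z\omega=0$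 for every section $Z$ of $\mathrm{Vert}(\mathscr{A})$. A symplectic section $\Omega\in\Gamma(\wedge^2\mathscr{A}^* )$ is one that is $\mathrm{d}_{\mathscr{A}}$-closed and non-degenerate; it vanishes on the vertical subbundle if $\Omega|_{\mathrm{Vert}(\mathscr{A})\times\mathrm{Vert}(\mathscr{A})}=0$. The vertical endomorphism is $J:\mathscr{A}\to\mathscr{A}$, $J(a,b,v)=(a,0,b_a^\vee)$, where $b_a^\vee\in T_aA$ is the vertical lift, $b_a^\vee F=\frac{d}{dt}\big|_{t=0}F(a+tb)$. The same letter $J$ denotes the derivation of $\Gamma(\wedge^\bullet\mathscr{A}^* )$ with $J(F)=0$ for $F\in C^\infty(A)$ and $J(\sigma)=-\sigma\circ J$ for $\sigma\in\Gamma(\mathscr{A}^* )$; thus for $\omega\in\Gamma(\wedge^2\mathscr{A}^* )$, $J\omega(Z_1,Z_2)=-\omega(JZ_1,Z_2)-\omega(Z_1,JZ_2)$. For $L\in C^\infty(A)$, the Cartan 1-section is $\theta_L:=-J(\mathrm{d}_{\mathscr{A}}L)=(\mathrm{d}_{\mathscr{A}}L)\circ J$ and the Cartan 2-section is $\omega_L:=\mathrm{d}_{\mathscr{A}}\theta_L$. A Lagrangian $L\in C^\infty(A)$ is regular if the fiberwise Hessian matrix $\left(\frac{\partial^2L}{\partial y^i\partial y^j}\right)$, in linear fiber coordinates $y^i$ of $A$, is non-singular at every point of $A$. *)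

(* Defs.v *)
From HB Require Import structures.
From mathcomp Require Import all_boot all_order all_algebra.
From mathcomp Require Import all_classical all_reals all_analysis.
Set Implicit Arguments.
Unset Strict Implicit.
Unset Printing Implicit Defensive.
Import Order.TTheory GRing.Theory Num.Theory.
Import numFieldNormedType.Exports.
Local Open Scope classical_set_scope.
Local Open Scope ring_scope.

Fixpoint Ck_on (R : realType) (n k : nat) (U : set 'rV[R]_n)
    (f : 'rV[R]_n -> R) : Prop :=
  match k with
  | 0%N => forall x, U x -> {for x, continuous f}
  | k'.+1 => forall i : 'I_n,
      (forall x, U x -> derivable f x (delta_mx 0 i)) /\
      Ck_on k' U ('D_(delta_mx 0 i) f)
  end.

(* Meant for U open. *)
Definition smooth_on (R : realType) (n : nat) (U : set 'rV[R]_n)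
  (f : 'rV[R]_n -> R) : Prop := forall k, Ck_on k U f.

(* cpsi is the inverse of cphi from cphi @` cdom to cdom; both maps are
   irrelevant elsewhere. *)
Record chart (R : realType) (B : Type) (n : nat) := Chart {
  cdom : set B;
  cphi : B -> 'rV[R]_n;
  cpsi : 'rV[R]_n -> B }.

Definition smooth_in (R : realType) (B : Type) (n : nat)
    (atlas : set (chart R B n)) (W : set B) (f : B -> R) : Prop :=
  forall c, atlas c -> smooth_on (cphi c @` (cdom c `&` W)) (f \o cpsi c).

Definition is_chart (R : realType) (T : topologicalType) (n : nat)
    (c : chart R T n) : Prop :=
  [/\ open (cdom c), open (cphi c @` cdom c),
      (forall x, cdom c x -> cpsi c (cphi c x) = x),
      (forall x, cdom c x -> {for x, continuous (cphi c)}) &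
      (forall z, (cphi c @` cdom c) z -> {for z, continuous (cpsi c)})].

Record manifold (R : realType) (m : nat) := Manifold {
  mcarrier :> topologicalType;
  matlas : set (chart R mcarrier m);
  manifold_hausdorff : hausdorff_space mcarrier;
  manifold_second_countable : @second_countable mcarrier;
  manifold_chart : forall c, matlas c -> is_chart c;
  manifold_cover : forall x, exists2 c, matlas c & cdom c x;
  manifold_compat : forall c, matlas c -> forall j,
    smooth_in matlas (cdom c) (fun x => cphi c x 0 j) }.
Arguments matlas {R m} M _ : rename.

Definition smooth (R : realType) (B : Type) (n : nat)
    (atlas : set (chart R B n)) : set (B -> R) :=
  [set f | smooth_in atlas setT f].

(* Tangent vectors at b are derivations at b of the algebra C of smooth
   functions.  They are encoded as functionals on all functions, set to 0 off C
   so that they are equal as soon as they agree on C. *)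
Definition tangent (R : realType) (B : Type) (C : set (B -> R)) (b : B) :
    set ((B -> R) -> R) :=
  [set v | [/\ forall f, ~ C f -> v f = 0,
     forall k f g, C f -> C g -> v (fun x => k * f x + g x) = k * v f + v g &
     forall f g, C f -> C g ->
       v (fun x => f x * g x) = v f * g b + f b * v g]].

Definition vf_bracket (R : realType) (B : Type)
    (X Y : B -> (B -> R) -> R) : B -> (B -> R) -> R :=
  fun b f => X b (fun b' => Y b' f) - Y b (fun b' => X b' f).

(* A linear trivialization over tdom: tcoord : E x -> R^r with inverse
   tvec x; both are irrelevant when x is not in tdom. *)
Record trivialization (R : realType) (M : Type) (E : M -> lmodType R)
    (r : nat) := Trivialization {
  tdom : set M;
  tcoord : forall x, E x -> 'rV[R]_r;
  tvec : forall x, 'rV[R]_r -> E x }.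

Definition is_trivialization (R : realType) (M : topologicalType)
    (E : M -> lmodType R) (r : nat) (t : trivialization E r) : Prop :=
  open (tdom t) /\
  forall x, tdom t x ->
    [/\ forall k (u v : E x),
          tcoord t (k *: u + v) = k *: tcoord t u + tcoord t v,
        forall u : E x, tvec t x (tcoord t u) = u &
        forall y, tcoord t (tvec t x y) = y].

Record vectorBundle (R : realType) (m : nat) (M : manifold R m) (r : nat) :=
  VectorBundle {
  fiber :> M -> lmodType R;
  btriv : set (trivialization fiber r);
  bundle_triv : forall t, btriv t -> is_trivialization t;
  bundle_cover : forall x, exists2 t, btriv t & tdom t x;
  bundle_compat : forall t t', btriv t -> btriv t' -> forall i j,
    smooth_in (matlas M) (tdom t `&` tdom t')
      (fun x => tcoord t' (tvec t x (delta_mx 0 i)) 0 j) }.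

Section Bundle.
Variables (R : realType) (m r : nat) (M : manifold R m).
Variable E : vectorBundle M r.

Definition total_space : Type := {x : M & E x}.

Definition bproj (a : total_space) : M := projT1 a.

(* The charts (x, y) on the total space: x is a chart of M and y are the fiber
   coordinates of a trivialization.  No topology on the total space is recorded:
   it is the one these charts induce. *)
Definition total_chart (c : chart R M m) (t : trivialization E r) :
    chart R total_space (m + r) :=
  {| cdom := [set a | cdom c (bproj a) /\ tdom t (bproj a)];
     cphi := fun a => row_mx (cphi c (bproj a)) (tcoord t (projT2 a));
     cpsi := fun z => existT (fun x => E x : Type) (cpsi c (lsubmx z))
                        (tvec t (cpsi c (lsubmx z)) (rsubmx z)) |}.

Definition total_atlas : set (chart R total_space (m + r)) :=
  [set d | exists c t, [/\ matlas M c, btriv t & d = total_chart c t]].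

Definition smooth_section (s : forall x, E x) : Prop :=
  forall t, btriv t -> forall i,
    smooth_in (matlas M) (tdom t) (fun x => tcoord t (s x) 0 i).

(* F |-> d/dt F(a + t b) at t = 0 *)
Definition vlift (a : total_space) (b : E (bproj a)) :
    (total_space -> R) -> R :=
  fun F => if `[< smooth total_atlas F >] then
    derive1 (fun t : R =>
      F (existT (fun x => E x : Type) (bproj a) (projT2 a + t *: b))) 0
  else 0.

Definition fiber_hessian (L : total_space -> R) (x : M) (t : trivialization E r)
    (y : 'rV[R]_r) : 'M[R]_r :=
  \matrix_(i, j)
    'D_(delta_mx 0 i) ('D_(delta_mx 0 j) (fun z : 'rV[R]_r =>
        L (existT (fun x => E x : Type) x (tvec t x z)))) y.

Definition regular_lagrangian (L : total_space -> R) : Prop :=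
  forall t, btriv t -> forall x, tdom t x ->
    forall y, fiber_hessian L x t y \in unitmx.

End Bundle.
Arguments total_atlas {R m r M} E _.

(* Relative to the algebra C of smooth functions and to the C-module S of smooth
   sections.  That the anchor is a bracket morphism is a consequence. *)
Record is_lie_bracket (R : realType) (B : Type) (V : B -> lmodType R)
    (C : set (B -> R)) (S : set (forall b, V b))
    (anchor : forall b, V b -> (B -> R) -> R)
    (br : (forall b, V b) -> (forall b, V b) -> forall b, V b) : Prop :=
  IsLieBracket {
  lie_closed : forall s t, S s -> S t -> S (br s t);
  lie_linear : forall k s t u, S s -> S t -> S u -> forall b,
    br (fun b => k *: s b + t b) u b = k *: br s u b + br t u b;
  lie_anti : forall s t, S s -> S t -> forall b, br s t b = - br t s b;
  lie_jacobi : forall s t u, S s -> S t -> S u -> forall b,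
    br s (br t u) b + br t (br u s) b + br u (br s t) b = 0;
  lie_leibniz : forall s t f, S s -> S t -> C f -> forall b,
    br s (fun b => f b *: t b) b = f b *: br s t b + anchor b (s b) f *: t b }.

Record lieAlgebroid (R : realType) (m : nat) (M : manifold R m) (r : nat) :=
  LieAlgebroid {
  lbundle :> vectorBundle M r;
  lanchor : forall x, lbundle x -> (M -> R) -> R;
  lbracket : (forall x, lbundle x) -> (forall x, lbundle x) ->
    forall x, lbundle x;
  anchor_tangent : forall x b, tangent (smooth (matlas M)) x (@lanchor x b);
  anchor_linear : forall x k b b' f,
    @lanchor x (k *: b + b') f = k * lanchor b f + lanchor b' f;
  anchor_smooth : forall s f, smooth_section s -> smooth (matlas M) f ->
    smooth (matlas M) (fun x => lanchor (s x) f);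
  lie_bracket : is_lie_bracket (smooth (matlas M)) (@smooth_section _ _ _ _ _)
    lanchor lbracket }.

Section Differential.
Variables (R : realType) (B : Type) (V : B -> lmodType R).
Variable anchor : forall b, V b -> (B -> R) -> R.
Variable br : (forall b, V b) -> (forall b, V b) -> forall b, V b.

Definition liealg_d0 (F : B -> R) : forall b, V b -> R := fun b w => anchor w F.

Definition liealg_d1 (th : forall b, V b -> R) (Z1 Z2 : forall b, V b) :
    B -> R :=
  fun b =>
    anchor (Z1 b) (fun b => th b (Z2 b)) - anchor (Z2 b) (fun b => th b (Z1 b))
    - th b (br Z1 Z2 b).

Definition liealg_d2 (om : forall b, V b -> V b -> R)
    (Z1 Z2 Z3 : forall b, V b) : B -> R :=
  fun b =>
    anchor (Z1 b) (fun b => om b (Z2 b) (Z3 b))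
    - anchor (Z2 b) (fun b => om b (Z1 b) (Z3 b))
    + anchor (Z3 b) (fun b => om b (Z1 b) (Z2 b))
    - om b (br Z1 Z2 b) (Z3 b) + om b (br Z1 Z3 b) (Z2 b)
    - om b (br Z2 Z3 b) (Z1 b).

End Differential.

Section Prolongation.
Variables (R : realType) (m r : nat) (M : manifold R m).
Variable A : lieAlgebroid M r.

Local Notation CA := (smooth (total_atlas A)).

(* The triple (a, b, v) is represented by (b, v) : ambient a; the condition
   p(a) = p(b) is enforced by typing. *)
Definition ambient (a : total_space A) : lmodType R :=
  (A (bproj a) * ((total_space A -> R) -> R))%type.

Definition prolong (a : total_space A) : set (ambient a) :=
  [set w | tangent CA a w.2 /\
     forall f, smooth (matlas M) f ->
       lanchor w.1 f = w.2 (fun a' => f (bproj a'))].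

Definition panchor (a : total_space A) (w : ambient a) :
  (total_space A -> R) -> R := w.2.

Definition psection (Z : forall a, ambient a) : Prop :=
  [/\ forall a, prolong (Z a),
      forall t, btriv t -> forall i,
        smooth_in (total_atlas A) [set a | tdom t (bproj a)]
          (fun a => tcoord t (Z a).1 0 i) &
      forall F, CA F -> CA (fun a => (Z a).2 F)].

(* Smooth sections are locally combinations of projectable ones, so these
   conditions determine br on smooth sections. *)
Definition is_prolongation_bracket
    (br : (forall a, ambient a) -> (forall a, ambient a) ->
       forall a, ambient a) : Prop :=
  is_lie_bracket CA psection panchor br /\
  forall Z1 Z2 (s1 s2 : forall x, A x),
    psection Z1 -> psection Z2 -> smooth_section s1 -> smooth_section s2 ->
    (forall a, (Z1 a).1 = s1 (bproj a)) ->
    (forall a, (Z2 a).1 = s2 (bproj a)) ->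
    forall a, br Z1 Z2 a =
      (lbracket s1 s2 (bproj a),
       vf_bracket (fun a => (Z1 a).2) (fun a => (Z2 a).2) a).

Definition vert (a : total_space A) : set (ambient a) :=
  [set w | prolong w /\ w.1 = 0].

Definition vert_endo (a : total_space A) (w : ambient a) : ambient a :=
  (0, vlift w.1).

(* Sections of the second exterior power of the dual; the values of om outside
   prolong are irrelevant. *)
Definition form2 (om : forall a, ambient a -> ambient a -> R) : Prop :=
  [/\ forall a k u v w, @prolong a u -> prolong v -> prolong w ->
        om a (k *: u + v) w = k * om a u w + om a v w,
      forall a u v, @prolong a u -> prolong v -> om a u v = - om a v u &
      forall Z1 Z2, psection Z1 -> psection Z2 ->
        CA (fun a => om a (Z1 a) (Z2 a))].

(* The action of vert_endo on sections of the dual and of its second exterior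
   power as a derivation vanishing on functions. *)
Definition vert_endo_form1 (th : forall a, ambient a -> R) :
    forall a, ambient a -> R :=
  fun a w => - th a (vert_endo w).

Definition vert_endo_form2 (om : forall a, ambient a -> ambient a -> R) :
    forall a, ambient a -> ambient a -> R :=
  fun a w1 w2 => - om a (vert_endo w1) w2 - om a w1 (vert_endo w2).

Definition form2_eq (om om' : forall a, ambient a -> ambient a -> R) : Prop :=
  forall a w1 w2, @prolong a w1 -> prolong w2 -> om a w1 w2 = om' a w1 w2.

Definition horizontal (om : forall a, ambient a -> ambient a -> R) : Prop :=
  forall Z, psection Z -> (forall a, vert (Z a)) ->
    forall a w, prolong w -> om a (Z a) w = 0.

Definition nondegenerate (om : forall a, ambient a -> ambient a -> R) : Prop :=
  forall a w, @prolong a w -> (forall w', prolong w' -> om a w w' = 0) -> w = 0.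

Definition vanishes_on_vert (om : forall a, ambient a -> ambient a -> R) :
    Prop :=
  forall a w1 w2, @vert a w1 -> vert w2 -> om a w1 w2 = 0.

Section Bracket.
Variable br : (forall a, ambient a) -> (forall a, ambient a) ->
  forall a, ambient a.

Definition closed_form2 (om : forall a, ambient a -> ambient a -> R) : Prop :=
  forall Z1 Z2 Z3, psection Z1 -> psection Z2 -> psection Z3 ->
    forall a, liealg_d2 panchor br om Z1 Z2 Z3 a = 0.

Definition symplectic (om : forall a, ambient a -> ambient a -> R) : Prop :=
  [/\ form2 om, closed_form2 om & nondegenerate om].

(* om is the differential of th: the right-hand side is C-bilinear in Z1, Z2, so
   it determines om on prolong. *)
Definition is_d1 (th : forall a, ambient a -> R)
    (om : forall a, ambient a -> ambient a -> R) : Prop :=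
  form2 om /\
  forall Z1 Z2, psection Z1 -> psection Z2 ->
    forall a, om a (Z1 a) (Z2 a) = liealg_d1 panchor br th Z1 Z2 a.

Definition cartan1 (L : total_space A -> R) : forall a, ambient a -> R :=
  fun a w => - vert_endo_form1 (liealg_d0 panchor L) w.

Definition is_cartan2 (L : total_space A -> R)
  (om : forall a, ambient a -> ambient a -> R) : Prop := is_d1 (cartan1 L) om.

End Bracket.
End Prolongation.

(* Main.v *)
From HB Require Import structures.
Require Import Defs.
From mathcomp Require Import all_boot all_order all_algebra.
From mathcomp Require Import all_classical all_reals all_analysis.
From mathcomp Require Import ring lra.
Set Implicit Arguments.
Unset Strict Implicit.
Unset Printing Implicit Defensive.
Import Order.TTheory GRing.Theory Num.Theory.
Import numFieldNormedType.Exports.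
Local Open Scope classical_set_scope.
Local Open Scope ring_scope.

(* Write J for vert_endo.  For projectable sections Z1, Z2 over s1, s2 the
   section J Z1 is projectable over 0, so [J Z1, Z2] is vertical and theta_L kills
   it: omega_L(J w1, w2) is the fiberwise Hessian of L on (w1.1, w2.1).  A
   horizontal Theta vanishes as soon as one argument is in the image of J, so
   J Omega = 0 follows from the symmetry of the Hessian.

   Conversely Omega(J w1, w2) depends only on w1.1 and w2.1, since Omega vanishes
   on vertical pairs: it is a fiberwise bilinear form g, symmetric because
   J Omega = 0, whose coefficients satisfy d_i g_kl = d_k g_il along the fibers
   because d Omega = 0.  As the fibers are vector spaces, integrating twice along
   rays from the origin gives a smooth L with fiberwise Hessian g, and L is regular
   because Omega is non-degenerate.  Then Theta = Omega - omega_L is closed and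
   horizontal.

   Sections are extended from a point by cutoffs, derivations are expanded in
   coordinates by Hadamard's lemma, and d (d theta) = 0 rests on the fact that the
   anchor preserves brackets, a consequence of the other axioms. *)

(** * Smooth functions on R^n *)

(** Three encodings shape the development. A tangent vector is a derivation of the algebra of
    globally smooth functions, so nothing about it is local by definition: coordinates and frames
    are cut off to global objects, and the expansion of a section in a frame carries a cutoff
    factor. A form is a function of vectors at a point, whereas brackets and differentials act on
    sections, so passing between the two requires tensoriality. The total space has charts but no
    topology, so openness there is read in the charts. The Lagrangian is global without any gluing.
    With g the fiberwise form, it is L(a) = the integral over s, s' in [0, 1] of s g(a, a) taken at
    the point s s' a, which involves only the linear structure of the fibers. Trivializations enter
    only to prove that L is smooth and to differentiate it; a chart of the total space contains
    every fiber that it meets, so rays never leave it. *)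

Section Calculus.
Variable R : realType.

(** The derivatives and the continuity in [Ck_on] refer to the ambient space and not to [U], so
    smoothness is a conjunction of conditions at single points. All localization arguments go
    through this. *)
Lemma Ck_on_pointwise n k (U : set 'rV[R]_n) f :
  Ck_on k U f <-> forall x, U x -> Ck_on k [set x] f.
Proof.
elim: k f => [|k IHk] f /=.
  by split=> H x Ux; [move=> _ ->; exact: H|exact: (H x Ux x)].
split=> [H x Ux i|H i].
  by have [H1 /IHk H2] := H i; split; [move=> _ ->; exact: H1|exact: H2].
split=> [x Ux|]; first by have [+ _] := H x Ux i; exact.
by apply/IHk => x Ux; have [_] := H x Ux i.
Qed.

Lemma Ck_onS n k (U V : set 'rV[R]_n) f :
  U `<=` V -> Ck_on k V f -> Ck_on k U f.
Proof.
by move=> UV /Ck_on_pointwise H; apply/Ck_on_pointwise => x /UV /H.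
Qed.

Lemma Ck_on_eq n k (U : set 'rV[R]_n) f g : open U ->
  (forall x, U x -> f x = g x) -> Ck_on k U f -> Ck_on k U g.
Proof.
move=> oU; elim: k f g => [|k IHk] f g fg /=.
  move=> cf x Ux; rewrite /prop_for /continuous_at -(fg x Ux).
  have nfg : {near x, f =1 g}.
    by near=> y; apply: fg; near: y; exact: open_nbhs_nbhs.
  exact: cvg_trans (near_eq_cvg nfg) (cf x Ux).
move=> H i; have [H1 H2] := H i; split=> [x Ux|].
  apply: near_eq_derivable (H1 x Ux).
  by near=> y; apply: fg; near: y; exact: open_nbhs_nbhs.
apply: IHk H2 => x Ux; apply: near_eq_derive.
by near=> y; apply: fg; near: y; exact: open_nbhs_nbhs.
Unshelve. all: by end_near. Qed.

Lemma smooth_onS n (U V : set 'rV[R]_n) f :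
  U `<=` V -> smooth_on V f -> smooth_on U f.
Proof. by move=> UV H k; exact: Ck_onS (H k). Qed.

Lemma smooth_on_eq n (U : set 'rV[R]_n) f g : open U ->
  (forall x, U x -> f x = g x) -> smooth_on U f -> smooth_on U g.
Proof. by move=> oU fg H k; exact: Ck_on_eq (H k). Qed.

Lemma smooth_on_pointwise n (U : set 'rV[R]_n) f :
  smooth_on U f <-> forall x, U x -> smooth_on [set x] f.
Proof.
split=> [H x Ux|H k]; first by apply: smooth_onS H => _ ->.
by apply/Ck_on_pointwise => x /H.
Qed.

Lemma smooth_on_derive n (U : set 'rV[R]_n) f i :
  smooth_on U f -> smooth_on U ('D_(delta_mx 0 i) f).
Proof. by move=> H k; have [] := H k.+1 i. Qed.

Lemma smooth_on_derivable n (U : set 'rV[R]_n) f i x :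
  smooth_on U f -> U x -> derivable f x (delta_mx 0 i).
Proof. by move=> H; have [+ _] := H 1 i; exact. Qed.

Lemma smooth_on_continuous n (U : set 'rV[R]_n) f x :
  smooth_on U f -> U x -> {for x, continuous f}.
Proof. by move=> H; exact: (H 0). Qed.

Lemma Ck_on_cst n k (U : set 'rV[R]_n) (a : R) : Ck_on k U (cst a).
Proof.
elim: k a => [|k IHk] a /=; first by move=> x _; exact: cst_continuous.
move=> i; split; first by move=> x _; exact: derivable_cst.
rewrite (_ : 'D__ _ = cst 0) //.
by apply/funext => x; rewrite derive_cst.
Qed.

Lemma smooth_on_cst n (U : set 'rV[R]_n) (a : R) : smooth_on U (cst a).
Proof. by move=> k; exact: Ck_on_cst. Qed.

Lemma derivable_coordP n (j : 'I_n) (x v : 'rV[R]_n) :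
  is_derive x v (fun z : 'rV[R]_n => z 0 j) (v 0 j).
Proof.
pose F h := h^-1 *: ((h *: v + x) 0 j - x 0 j).
have FE : {near 0^', cst (v 0 j) =1 F}.
  near=> h; rewrite /F !mxE addrK /GRing.scale /= mulrA mulVf ?mul1r//.
  by near: h; exact: nbhs_dnbhs_neq.
have Fl : F h @[h --> 0^'] --> v 0 j.
  exact: cvg_trans (near_eq_cvg FE) (cvg_cst (v 0 j)).
by split; [apply/cvg_ex; exists (v 0 j)|exact: cvg_lim].
Unshelve. all: by end_near. Qed.

Lemma smooth_on_coord n (U : set 'rV[R]_n) (j : 'I_n) :
  smooth_on U (fun z : 'rV[R]_n => z 0 j).
Proof.
case=> [|k] /=; first by move=> x _; exact: coord_continuous.
move=> i; split=> [x _|]; first by case: (derivable_coordP j x (delta_mx 0 i)).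
rewrite (_ : 'D__ _ = cst ((delta_mx 0 i : 'rV[R]_n) 0 j)); last first.
  by apply/funext => x; rewrite (@derive_val _ _ _ _ _ _ _ (derivable_coordP _ _ _)).
exact: Ck_on_cst.
Qed.

Lemma is_derive_line n (f : 'rV[R]_n -> R) x v (t : R) :
  derivable f (x + t *: v) v ->
  is_derive t 1 (fun s : R => f (x + s *: v)) ('D_v f (x + t *: v)).
Proof.
move=> df.
have E : (fun h : R => h^-1 *: (((fun s : R => f (x + s *: v)) \o shift t) (h *: 1) -
    f (x + t *: v))) =
  (fun h : R => h^-1 *: ((f \o shift (x + t *: v)) (h *: v) - f (x + t *: v))).
  apply/funext => h /=; congr (_ *: (f _ - _)).
  by rewrite [h *: 1]mulr1 scalerDl addrCA.
split; first by rewrite /derivable E.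
by rewrite /derive E.
Qed.

(** The segment is parametrized by [t * s] with [t] in the unit interval, which treats both signs of
    [s] at once. *)
Lemma MVT_line n (f : 'rV[R]_n -> R) (x v : 'rV[R]_n) (s : R) :
  (forall t : R, 0 <= t <= 1 -> derivable f (x + (t * s) *: v) v) ->
  exists2 t : R, 0 <= t <= 1 &
    f (x + s *: v) - f x = s * 'D_v f (x + (t * s) *: v).
Proof.
move=> df.
pose g (t : R) := f (x + (t * s) *: v).
have dg (t : R) : 0 <= t <= 1 -> is_derive t 1 g (s * 'D_v f (x + (t * s) *: v)).
  move=> t01; have H := is_derive_line (df t t01).
  have /= dm : is_derive t 1 ( *%R^~ s : R -> R) s.
    have := @is_deriveM _ _ id (cst s) t 1 _ _ _ _.
    by move=> H1; apply: is_derive_eq; rewrite scaler0 add0r [_ *: _]mulr1.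
  rewrite mulrC.
  exact: (@is_derive1_comp _ (fun r => f (x + r *: v)) ( *%R^~ s) t _ _ H dm).
have [||t t01] := @MVT_segment _ g (fun t => s * 'D_v f (x + (t * s) *: v)) 0 1 ler01.
- by move=> t; rewrite in_itv/= => /andP[t0 t1]; apply: dg; rewrite !ltW.
- apply: derivable_within_continuous => t; rewrite in_itv/= => t01.
  by have [] := dg t t01.
rewrite /g mul0r mul1r scale0r addr0 subr0 mulr1 => E.
by exists t => //; rewrite in_itv in t01.
Qed.

Lemma normr_rV_le n (v : 'rV[R]_n) i : `|v 0 i| <= `|v|.
Proof.
rewrite [leRHS]/Num.norm/= mx_normrE.
exact: (le_bigmax _ (fun ij : 'I_1 * 'I_n => `|v ij.1 ij.2|) (0, i)).
Qed.

Lemma norm_delta_le n (i : 'I_n) : `|delta_mx 0 i : 'rV[R]_n| <= 1.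
Proof.
rewrite [leLHS]/Num.norm/= mx_normrE; apply: bigmax_le => // -[a b] _ /=.
by rewrite mxE; case: andb; rewrite ?normr1 ?normr0.
Qed.

Lemma norm_sum_delta_le n (s : seq 'I_n) (v : 'rV[R]_n) :
  `|\sum_(i <- s) v 0 i *: delta_mx 0 i : 'rV[R]_n| <= (size s)%:R * `|v|.
Proof.
elim: s => [|i s IHs]; first by rewrite big_nil normr0 mul0r.
rewrite big_cons /= -natr1 mulrDl mul1r addrC.
apply: le_trans (ler_normD _ _) _; apply: lerD => //.
rewrite normrZ -[leRHS]mulr1.
by apply: ler_pM => //; [exact: normr_rV_le|exact: norm_delta_le].
Qed.

(** The increment is made one coordinate at a time. By the mean value theorem each move contributes
    a partial derivative at a nearby point, within [e] of its value at [x]. *)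
Lemma C1_sum_bound n (f : 'rV[R]_n -> R) (x : 'rV[R]_n) (e d : R) (s : seq 'I_n) (v : 'rV[R]_n) :
  0 <= e ->
  (forall y i, `|y - x| < d -> derivable f y 'e_i /\ `|'D_'e_i f y - 'D_'e_i f x| <= e) ->
  (size s)%:R * `|v| < d ->
  `|f (x + \sum_(i <- s) v 0 i *: 'e_i) - f x - \sum_(i <- s) v 0 i * 'D_'e_i f x|
    <= (size s)%:R * (e * `|v|).
Proof.
move=> e0 H; elim: s => [|i s IHs] /= sd.
  by rewrite !big_nil addr0 !subrr normr0 mul0r.
have sd' : (size s)%:R * `|v| < d.
  by apply: le_lt_trans sd; apply: ler_wpM2r => //; rewrite ler_nat.
rewrite !big_cons; pose y : 'rV[R]_n := x + \sum_(j <- s) v 0 j *: 'e_j.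
rewrite -/y in IHs.
have -> : x + (v 0 i *: 'e_i + \sum_(j <- s) v 0 j *: 'e_j) = y + v 0 i *: 'e_i.
  by rewrite /y addrAC addrA.
have yt (t : R) : 0 <= t <= 1 -> `|y + (t * v 0 i) *: 'e_i - x| < d.
  move=> /andP[t0 t1]; apply: le_lt_trans sd.
  rewrite /y addrAC [x + _]addrC addrK -natr1 mulrDl mul1r.
  apply: le_trans (ler_normD _ _) _; apply: lerD; first exact: norm_sum_delta_le.
  rewrite normrZ -[leRHS]mulr1; apply: ler_pM => //; last exact: norm_delta_le.
  rewrite normrM -[leRHS]mul1r; apply: ler_pM => //; last exact: normr_rV_le.
  by rewrite ger0_norm.
have [|t t01 E] := @MVT_line n f y 'e_i (v 0 i).
  by move=> t t01; have [] := H _ i (yt t t01).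
have [_ D] := H _ i (yt t t01).
rewrite -natr1 mulrDl mul1r.
set S := \sum_(j <- s) _ * _; set a := v 0 i * _.
rewrite (_ : f _ - f x - (a + S) = (f y - f x - S) + (f (y + v 0 i *: 'e_i) - f y - a)); last by ring.
apply: le_trans (ler_normD _ _) _; apply: lerD; first exact: IHs.
rewrite E /a -mulrBr normrM mulrC; apply: ler_pM => //.
exact: normr_rV_le.
Qed.

Lemma C1_differentiable n (U : set 'rV[R]_n) f x : open U -> Ck_on 1 U f -> U x ->
  differentiable f x.
Proof.
move=> oU C1 Ux.
pose g (v : 'rV[R]_n) := \sum_i v 0 i * 'D_'e_i f x.
have glin : linear g.
  move=> a u v; rewrite /g scaler_sumr -big_split /=; apply: eq_bigr => i _.
  by rewrite !mxE mulrDl -mulrA.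
pose gL := GRing.isLinear.Build _ _ _ _ _ glin.
have [G HG] : exists G : {linear 'rV[R]_n -> R^o}, forall v, G v = g v.
  by exists (HB.pack g gL : {linear 'rV[R]_n -> R^o}).
have Gc : continuous G.
  rewrite (_ : (G : 'rV[R]_n -> R) = g); last exact/funext.
  apply: continuous_big => [|i _]; first exact: add_continuous.
  move=> v; have cv := @coord_continuous R 1 n 0 i v.
  exact: cvgMr_tmp cv.
suff E : f \o shift x = cst (f x) + (G : 'rV[R]_n -> R^o)
    +o_ (nbhs (0 : 'rV[R]_n)) (@idfun 'rV[R]_n).
  by apply/diff_locallyP; rewrite (diff_unique Gc E).
apply/eqaddoP => _/posnumP[e].
(* The [n] coordinate moves add up to an error of [n] times this bound, hence at most [e]; the
   successor keeps the denominator nonzero when [n] is 0. *)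
have [d d0 Hd] : exists2 d : R, 0 < d & forall (y : 'rV[R]_n) i, `|y - x| < d ->
    derivable f y 'e_i /\ `|'D_'e_i f y - 'D_'e_i f x| <= e%:num / n.+1%:R.
  have : \forall y \near nbhs x, forall i, derivable f y 'e_i /\
     `|'D_'e_i f y - 'D_'e_i f x| <= e%:num / n.+1%:R.
    have F (i : 'I_n) : \forall y \near nbhs x, derivable f y 'e_i /\
        `|'D_'e_i f y - 'D_'e_i f x| <= e%:num / n.+1%:R.
      have [C1a C1b] := C1 i.
      near=> y; split; first by apply: C1a; near: y; exact: open_nbhs_nbhs.
      near: y; have /cvgr_distC_le := C1b x Ux; apply.
      by rewrite divr_gt0.
    exact: filter_forall F.
  move=> /nbhs_ballP[d d0 Hd]; exists d => // y i yx.
  by apply: Hd; rewrite -ball_normE /ball_ /= distrC.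
have e0 : 0 <= e%:num / n.+1%:R by rewrite divr_ge0.
have V0 : \forall v \near nbhs (0 : 'rV[R]_n), `|v| < d / n.+1%:R.
  apply/nbhs_ballP; exists (d / n.+1%:R); first by rewrite /= divr_gt0.
  by move=> v; rewrite -ball_normE /ball_ /= sub0r normrN.
near=> v.
have vd : n%:R * `|v| < d.
  have : `|v| < d / n.+1%:R by near: v; exact: V0.
  rewrite ltr_pdivlMr// mulrC; apply: le_lt_trans.
  by apply: ler_wpM2r => //; rewrite ler_nat.
have := @C1_sum_bound n f x _ d (index_enum 'I_n) v e0 Hd.
rewrite (_ : size _ = n); last by rewrite -[RHS]card_ord cardT enumT.
rewrite -row_sum_delta => /(_ vd) H.
rewrite /= !fctE HG /g opprD addrA [v + x]addrC; apply: (le_trans H).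
rewrite mulrA ler_wpM2r// mulrCA ler_piMr//.
by rewrite ler_pdivrMr// mul1r ler_nat.
Unshelve. all: by end_near. Qed.

(** [Ck_on k.+1] speaks of partial derivatives only; the continuity of [f] itself has to come from
    differentiability. *)
Lemma Ck_on_pred n k (U : set 'rV[R]_n) f : open U -> Ck_on k.+1 U f -> Ck_on k U f.
Proof.
move=> oU; elim: k f => [|k IHk] f H.
  by move=> x Ux; exact/differentiable_continuous/(C1_differentiable oU H).
by move=> i; have [H1 H2] := H i; split => //; exact: IHk.
Qed.

Lemma smooth_on_differentiable n (U : set 'rV[R]_n) f x : open U ->
  smooth_on U f -> U x -> differentiable f x.
Proof. by move=> oU H; exact: C1_differentiable oU (H 1). Qed.

Lemma derive_sum_coord n (f : 'rV[R]_n -> R) x v : differentiable f x ->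
  'D_v f x = \sum_i v 0 i * 'D_'e_i f x.
Proof.
move=> df; rewrite deriveE// [in LHS](row_sum_delta v) linear_sum.
by apply: eq_bigr => i _; rewrite linearZ /= deriveE.
Qed.

Lemma Ck_on_add n k (U : set 'rV[R]_n) f g : open U ->
  Ck_on k U f -> Ck_on k U g -> Ck_on k U (fun x => f x + g x).
Proof.
move=> oU; elim: k f g => [|k IHk] f g /= Hf Hg.
  by move=> x Ux; exact: cvgD (Hf x Ux) (Hg x Ux).
move=> i; have [f1 f2] := Hf i; have [g1 g2] := Hg i; split.
  by move=> x Ux; apply: derivableD; [exact: f1|exact: g1].
apply: Ck_on_eq (IHk _ _ f2 g2) => // x Ux.
by rewrite deriveD//; [exact: f1|exact: g1].
Qed.

Lemma Ck_on_mul n k (U : set 'rV[R]_n) f g : open U ->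
  Ck_on k U f -> Ck_on k U g -> Ck_on k U (fun x => f x * g x).
Proof.
move=> oU; elim: k f g => [|k IHk] f g Hf Hg.
  by move=> x Ux; exact: cvgM (Hf x Ux) (Hg x Ux).
move=> i; have [f1 f2] := Hf i; have [g1 g2] := Hg i; split.
  by move=> x Ux; apply: derivableM; [exact: f1|exact: g1].
have := Ck_on_add oU (IHk _ _ (Ck_on_pred oU Hf) g2) (IHk _ _ (Ck_on_pred oU Hg) f2).
apply: Ck_on_eq => // x Ux.
by rewrite deriveM//; [exact: f1|exact: g1].
Qed.

Lemma Ck_on_sum n k (U : set 'rV[R]_n) (I : Type) (s : seq I)
    (f : I -> 'rV[R]_n -> R) : open U ->
  (forall i, Ck_on k U (f i)) -> Ck_on k U (fun x => \sum_(i <- s) f i x).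
Proof.
move=> oU H; elim: s => [|i s IHs].
  rewrite (_ : (fun _ => _) = cst 0); first exact: Ck_on_cst.
  by apply/funext => x; rewrite big_nil.
rewrite (_ : (fun _ => _) = fun x => f i x + \sum_(j <- s) f j x).
  exact: Ck_on_add.
by apply/funext => x; rewrite big_cons.
Qed.

Lemma smooth_on_add n (U : set 'rV[R]_n) f g : open U ->
  smooth_on U f -> smooth_on U g -> smooth_on U (fun x => f x + g x).
Proof. by move=> oU Hf Hg k; exact: Ck_on_add. Qed.

Lemma smooth_on_mul n (U : set 'rV[R]_n) f g : open U ->
  smooth_on U f -> smooth_on U g -> smooth_on U (fun x => f x * g x).
Proof. by move=> oU Hf Hg k; exact: Ck_on_mul. Qed.

Lemma smooth_on_sum n (U : set 'rV[R]_n) (I : Type) (s : seq I)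
    (f : I -> 'rV[R]_n -> R) : open U ->
  (forall i, smooth_on U (f i)) -> smooth_on U (fun x => \sum_(i <- s) f i x).
Proof. by move=> oU H k; apply: Ck_on_sum => // i; exact: H. Qed.

Lemma smooth_on_inv n (U : set 'rV[R]_n) f : open U ->
  (forall x, U x -> f x != 0) -> smooth_on U f -> smooth_on U (fun x => (f x)^-1).
Proof.
move=> oU f0 Hf; elim=> [|k IHk].
  by move=> x Ux; exact: cvgV (f0 x Ux) (smooth_on_continuous Hf Ux).
move=> i; split.
  by move=> x Ux; apply: derivableV; [exact: f0|exact: smooth_on_derivable Hf Ux].
have := Ck_on_mul oU (Ck_on_mul oU (Ck_on_cst _ _ (-1)) (Ck_on_mul oU IHk IHk))
  (smooth_on_derive i Hf k).
apply: Ck_on_eq => // x Ux.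
rewrite deriveV; [|exact: f0|exact: smooth_on_derivable Hf Ux].
by rewrite /cst mulN1r -expr2 exprVn.
Qed.

(** * The chain rule in several variables *)

Section Composition.
Variables (n p : nat) (U : set 'rV[R]_n) (V : set 'rV[R]_p) (G : 'rV[R]_n -> 'rV[R]_p).
Hypotheses (oU : open U) (oV : open V) (UV : forall x, U x -> V (G x)).
Hypothesis smG : forall j, smooth_on U (fun x => G x 0 j).

Lemma smooth_row_derivable (x : 'rV[R]_n) (i : 'I_n) : U x -> derivable G x 'e_i.
Proof.
move=> Ux; apply/derivable_mxP => a j; rewrite (ord1 a).
exact: smooth_on_derivable (smG j) Ux.
Qed.

Lemma smooth_row_continuous x : U x -> {for x, continuous G}.
Proof.
move=> Ux; apply: (cvgrPdist_lt (F := nbhs x) G (G x)).2 => e e0.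
have F (j : 'I_p) : \forall y \near nbhs x, `|G x 0 j - G y 0 j| < e.
  have := smooth_on_continuous (smG j) Ux.
  by move/cvgrPdist_lt; exact.
have FF : \forall y \near nbhs x, forall j, `|G x 0 j - G y 0 j| < e.
  exact: filter_forall F.
near=> y; rewrite [ltLHS]/Num.norm/= mx_normrE.
rewrite (bigmax_lt _ e0)//= => -[a j] _ /=.
by rewrite (ord1 a) !mxE; move: j; near: y.
Unshelve. all: by end_near. Qed.

(** Restrict [G] to the line through [x] along the i-th axis. For a curve derivability is
    differentiability, so the chain rule for differentials applies to [F] and this curve. *)
Lemma is_derive_chain F (x : 'rV[R]_n) (i : 'I_n) : smooth_on V F -> U x ->
  is_derive x 'e_i (F \o G)
    (\sum_j 'D_'e_i (fun z => G z 0 j) x * 'D_'e_j F (G x)).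
Proof.
move=> smF Ux; have dG := @smooth_row_derivable x i Ux.
have dF := smooth_on_differentiable oV smF (UV Ux).
pose l (t : R) : 'rV[R]_p := G (x + t *: 'e_i).
have gE : (fun h : R => h^-1 *: ((l \o shift 0) (h *: 1) - l 0)) =
    (fun h : R => h^-1 *: ((G \o shift x) (h *: 'e_i) - G x)).
  apply/funext => h; rewrite /l /= addr0 scale0r addr0.
  by rewrite [h *: 1]mulr1 [x + _]addrC.
have dl : derivable l 0 1 by rewrite /derivable gE.
have Dl : 'D_1 l 0 = 'D_'e_i G x by rewrite /derive gE.
have l0 : l 0 = G x by rewrite /l scale0r addr0.
have dl' : differentiable l 0 by exact/derivable1_diffP.
have dF' : differentiable F (l 0) by rewrite l0.
have dc : differentiable (F \o l) 0 by exact: differentiable_comp.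
have E : (fun h : R => h^-1 *: ((F \o G \o shift x) (h *: 'e_i) - (F \o G) x)) =
    (fun h : R => h^-1 *: ((F \o l \o shift 0) (h *: 1) - (F \o l) 0)).
  apply/funext => h; rewrite /l /= addr0 scale0r addr0.
  by rewrite [h *: 1]mulr1 [x + _]addrC.
have dd : derivable (F \o l) 0 1 by exact: diff_derivable.
split; first by rewrite /derivable E.
have -> : 'D_'e_i (F \o G) x = 'D_1 (F \o l) 0 by rewrite /derive E.
have dmx j : ('D_'e_i G x) 0 j = 'D_'e_i (fun z => G z 0 j) x.
  by have := derive_mx dG => ->; rewrite mxE.
have -> : 'D_1 (F \o l) 0 = 'D_('D_'e_i G x) F (G x).
  rewrite (deriveE _ dc) (diff_comp dl' dF') /=.
  by rewrite -(deriveE (1 : R) dl') Dl -(deriveE _ dF') l0.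
rewrite (derive_sum_coord _ dF).
by apply: eq_bigr => j _; rewrite dmx.
Qed.

Lemma smooth_on_comp F : smooth_on V F -> smooth_on U (F \o G).
Proof.
move=> + k; elim: k F => [|k IHk] F smF.
  move=> x Ux; apply: continuous_comp; first exact: smooth_row_continuous.
  exact: smooth_on_continuous smF (UV Ux).
move=> i; split=> [x Ux|]; first by case: (is_derive_chain i smF Ux).
have : Ck_on k U (fun x => \sum_j 'D_'e_i (fun z => G z 0 j) x * 'D_'e_j F (G x)).
  apply: Ck_on_sum => // j; apply: Ck_on_mul => //.
    exact: smooth_on_derive.
  exact: IHk (smooth_on_derive _ smF).
apply: Ck_on_eq => // x Ux.
by rewrite (@derive_val _ _ _ _ _ _ _ (is_derive_chain i smF Ux)).
Qed.
End Composition.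

Lemma is_derive_translate n (f : 'rV[R]_n -> R) (c y v : 'rV[R]_n) :
  derivable f (y + c) v ->
  is_derive y v (fun z => f (z + c)) ('D_v f (y + c)).
Proof.
move=> df.
have E : (fun h : R => h^-1 *: (((fun z => f (z + c)) \o shift y) (h *: v) - f (y + c))) =
    (fun h : R => h^-1 *: ((f \o shift (y + c)) (h *: v) - f (y + c))).
  by apply/funext => h /=; rewrite addrA.
split; first by rewrite /derivable E.
by rewrite /derive E.
Qed.

(** Two mean value theorems, first along the j-th axis for the increment of [f] in direction i, then
    along the i-th axis for the j-th partial derivative. The left-hand side is symmetric in [i] and
    [j], which yields the symmetry of second derivatives. *)
Lemma second_difference n (f : 'rV[R]_n -> R) (x : 'rV[R]_n) (i j : 'I_n) (h d : R) :
  (forall y, `|y - x| < d -> derivable f y 'e_j /\ derivable ('D_'e_j f) y 'e_i) ->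
  `|h| + `|h| < d ->
  exists2 y, `|y - x| <= `|h| + `|h| &
    f (x + h *: 'e_j + h *: 'e_i) - f (x + h *: 'e_j) - (f (x + h *: 'e_i) - f x) =
    h * (h * 'D_'e_i ('D_'e_j f) y).
Proof.
move=> H hd.
have nth (k : 'I_n) (t : R) : 0 <= t <= 1 -> `|(t * h) *: 'e_k : 'rV[R]_n| <= `|h|.
  move=> /andP[t0 t1]; rewrite normrZ -[leRHS]mulr1.
  apply: ler_pM => //; last exact: norm_delta_le.
  by rewrite normrM ger0_norm// -[leRHS]mul1r ler_wpM2r.
have near_x (t s : R) : 0 <= t <= 1 -> 0 <= s <= 1 ->
    `|x + (t * h) *: 'e_j + (s * h) *: 'e_i - x| <= `|h| + `|h|.
  move=> t01 s01.
  rewrite (_ : _ - x = (t * h) *: 'e_j + (s * h) *: 'e_i); last first.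
    by rewrite addrAC [x + _]addrC addrK.
  by apply: le_trans (ler_normD _ _) _; apply: lerD; exact: nth.
have near_xd (t s : R) : 0 <= t <= 1 -> 0 <= s <= 1 ->
    `|x + (t * h) *: 'e_j + (s * h) *: 'e_i - x| < d.
  by move=> t01 s01; apply: le_lt_trans hd; exact: near_x.
have t0 : 0 <= (0 : R) <= 1 by rewrite lexx ler01.
have t1 : 0 <= (1 : R) <= 1 by rewrite lexx ler01.
pose phi (y : 'rV[R]_n) := f (y + h *: 'e_i) - f y.
have dphi (t : R) : 0 <= t <= 1 -> is_derive (x + (t * h) *: 'e_j) 'e_j phi
    ('D_'e_j f (x + (t * h) *: 'e_j + h *: 'e_i) - 'D_'e_j f (x + (t * h) *: 'e_j)).
  move=> t01.
  have D1 : derivable f (x + (t * h) *: 'e_j + h *: 'e_i) 'e_j.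
    apply: (H _ _).1.
    by have := near_xd t 1 t01 t1; rewrite mul1r.
  have d1 := is_derive_translate D1.
  have d2 : derivable f (x + (t * h) *: 'e_j) 'e_j.
    apply: (H _ _).1.
    by have := near_xd t 0 t01 t0; rewrite mul0r scale0r addr0.
  by apply: is_deriveB => //; exact: derivableP.
have [t /dphi Dt|t t01] := @MVT_line n phi x 'e_j h; first by case: Dt.
rewrite (@derive_val _ _ _ _ _ _ _ (dphi t t01)) {1 2}/phi => E1.
have [s s01|s s01 E2] := @MVT_line n ('D_'e_j f) (x + (t * h) *: 'e_j) 'e_i h.
  by apply: (H _ _).2; exact: near_xd.
exists (x + (t * h) *: 'e_j + (s * h) *: 'e_i); first exact: near_x.
by rewrite -E2 -E1.
Qed.

(** The mean value theorem locates the two mixed derivatives at different points near [x];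
    continuity brings both back to [x]. *)
Lemma eq_of_close_values n (A B : 'rV[R]_n -> R) (x : 'rV[R]_n) :
  {for x, continuous A} -> {for x, continuous B} ->
  (forall d : R, 0 < d -> exists y z, [/\ `|y - x| < d, `|z - x| < d & A y = B z]) ->
  A x = B x.
Proof.
move=> cA cB H; apply/eqP; rewrite -subr_eq0 -normr_le0; apply/ler_addgt0Pr => e e0.
rewrite add0r.
have e2 : 0 < e / 2 by rewrite divr_gt0.
have : \forall y \near nbhs x, `|A x - A y| <= e / 2 /\ `|B x - B y| <= e / 2.
  have CA : \forall y \near nbhs x, `|A x - A y| <= e / 2.
    by move/cvgrPdist_le : cA; exact.
  have CB : \forall y \near nbhs x, `|B x - B y| <= e / 2.
    by move/cvgrPdist_le : cB; exact.
  by move: CA CB; apply: filterS2.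
move=> /nbhs_ballP[d d0 Hd].
have [y [z [yx zx E]]] := H d d0.
have [|Ay _] := Hd y; first by rewrite -ball_normE /ball_ /= distrC.
have [|_ Bz] := Hd z; first by rewrite -ball_normE /ball_ /= distrC.
move: Ay Bz; rewrite E !ler_norml => /andP[H1 H2] /andP[H3 H4].
by apply/andP; split; lra.
Qed.

Lemma derive_comm n (U : set 'rV[R]_n) f x (i j : 'I_n) : open U -> smooth_on U f -> U x ->
  'D_'e_i ('D_'e_j f) x = 'D_'e_j ('D_'e_i f) x.
Proof.
move=> oU smf Ux.
have cD (k l : 'I_n) : {for x, continuous ('D_'e_k ('D_'e_l f))}.
  exact: smooth_on_continuous (smooth_on_derive k (smooth_on_derive l smf)) Ux.
apply: (eq_of_close_values (cD i j) (cD j i)) => e e0.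
have [d d0 [de Hd]] : exists2 d : R, 0 < d & d <= e /\ forall y : 'rV[R]_n, `|y - x| < d -> U y.
  have /nbhs_ballP[d d0 Hd] : nbhs x U by exact: open_nbhs_nbhs.
  exists (Num.min d e); first by rewrite lt_min d0 e0.
  split=> [|y]; first by rewrite ge_min lexx orbT.
  rewrite lt_min => /andP[yx _].
  by apply: Hd; rewrite -ball_normE /ball_ /= distrC.
(* Two moves of length [d / 3] stay strictly within distance [d] of [x]. *)
pose h := d / 3.
have h0 : 0 < h by rewrite divr_gt0.
have hd : `|h| + `|h| < d by rewrite gtr0_norm// /h; lra.
have der (k l : 'I_n) (y : 'rV[R]_n) : `|y - x| < d ->
    derivable f y 'e_l /\ derivable ('D_'e_l f) y 'e_k.
  move=> /Hd Uy; split; first exact: smooth_on_derivable smf Uy.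
  exact: smooth_on_derivable (smooth_on_derive l smf) Uy.
have [y yx Ey] := second_difference (@der i j) hd.
have [z zx Ez] := second_difference (@der j i) hd.
exists y, z; split.
- by apply: (le_lt_trans yx); exact: lt_le_trans de.
- by apply: (le_lt_trans zx); exact: lt_le_trans de.
- apply: (mulfI (lt0r_neq0 h0)); apply: (mulfI (lt0r_neq0 h0)).
rewrite -[LHS]Ey -[RHS]Ez (addrAC x (h *: 'e_i)).
move: (f _) (f _) (f _) (f _) => a b c l; ring.
Qed.

End Calculus.

(** * The Poincare lemma in some of the variables *)

Section UnitIntegral.
Variable R : realType.
Local Notation mu := (@lebesgue_measure R).
Implicit Types f g H h : R -> R.

Definition integral01 f : R := (\int[mu]_(t in `[0%R, 1%R]) f t)%R.

Definition continuous01 f := forall t : R, 0 <= t <= 1 -> {for t, continuous f}.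

Lemma continuous01_within f : continuous01 f -> {within `[0, 1], continuous f}.
Proof.
move=> cf; apply: continuous_in_subspaceT => t; rewrite inE /= in_itv /=.
exact: cf.
Qed.

Lemma continuous01_integrable f : continuous01 f ->
  mu.-integrable `[0%R, 1%R] (EFin \o f).
Proof.
move=> /continuous01_within cf.
by apply: continuous_compact_integrable => //; exact: segment_compact.
Qed.

Lemma continuous01D f g : continuous01 f -> continuous01 g ->
  continuous01 (fun t => f t + g t).
Proof. by move=> cf cg t t01; exact: cvgD (cf t t01) (cg t t01). Qed.

Lemma continuous01M f g : continuous01 f -> continuous01 g ->
  continuous01 (fun t => f t * g t).
Proof. by move=> cf cg t t01; exact: cvgM (cf t t01) (cg t t01). Qed.

Lemma continuous01_cst (a : R) : continuous01 (fun=> a).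
Proof. by move=> t _; exact: cst_continuous. Qed.

Lemma continuous01_expr p : continuous01 (fun t => t ^+ p).
Proof. by move=> t _; exact: exprn_continuous. Qed.

Lemma continuous01_norm f : continuous01 f -> continuous01 (fun t => `|f t|).
Proof. by move=> cf t t01; exact: cvg_norm (cf t t01). Qed.

Lemma continuous01_sum (I : Type) (s : seq I) (f : I -> R -> R) :
  (forall i, continuous01 (f i)) -> continuous01 (fun t => \sum_(i <- s) f i t).
Proof.
move=> cf; elim: s => [|i s IHs].
  rewrite (_ : (fun _ => _) = fun=> 0); first exact: continuous01_cst.
  by apply/funext => t; rewrite big_nil.
rewrite (_ : (fun _ => _) = fun t => f i t + \sum_(j <- s) f j t).
  exact: continuous01D.
by apply/funext => t; rewrite big_cons.
Qed.

Lemma eq_integral01 f g : (forall t : R, 0 <= t <= 1 -> f t = g t) ->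
  integral01 f = integral01 g.
Proof.
by move=> fg; apply: eq_Rintegral => t; rewrite inE /= in_itv /= => /fg.
Qed.

Lemma integral01D f g : continuous01 f -> continuous01 g ->
  integral01 (fun t => f t + g t) = integral01 f + integral01 g.
Proof.
by move=> cf cg; apply: RintegralD => //; exact: continuous01_integrable.
Qed.

Lemma integral01Zl (a : R) f : continuous01 f ->
  integral01 (fun t => a * f t) = a * integral01 f.
Proof. by move=> cf; apply: RintegralZl => //; exact: continuous01_integrable. Qed.

Lemma integral01_sum (I : Type) (s : seq I) (f : I -> R -> R) :
  (forall i, continuous01 (f i)) ->
  integral01 (fun t => \sum_(i <- s) f i t) = \sum_(i <- s) integral01 (f i).
Proof.
move=> cf; elim: s => [|i s IHs].
  rewrite big_nil (_ : (fun _ => _) = fun t => 0 * 0).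
    by rewrite integral01Zl ?mul0r//; exact: continuous01_cst.
  by apply/funext => t; rewrite big_nil mul0r.
rewrite big_cons -IHs -integral01D//; last exact: continuous01_sum.
by apply: eq_integral01 => t _; rewrite big_cons.
Qed.

Lemma integral01_cst (e : R) : integral01 (fun=> e) = e.
Proof.
rewrite /integral01 Rintegral_cst//= lebesgue_measure_itv/= lte_fin ltr01.
by rewrite -EFinD subr0 /= mulr1.
Qed.

Lemma integral01_dist_le f g (e : R) : continuous01 f -> continuous01 g ->
  (forall t : R, 0 <= t <= 1 -> `|f t - g t| <= e) ->
  `|integral01 f - integral01 g| <= e.
Proof.
move=> cf cg fg.
have cfg : continuous01 (fun t => f t - g t).
  by move=> t t01; exact: cvgB (cf t t01) (cg t t01).
have -> : integral01 f - integral01 g = integral01 (fun t => f t - g t).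
  by rewrite /integral01 RintegralB//; exact: continuous01_integrable.
apply: le_trans (le_normr_Rintegral _ (continuous01_integrable cfg)) _ => //.
rewrite -[e]integral01_cst.
apply: le_Rintegral => //.
- apply: continuous01_integrable; exact: continuous01_norm.
- apply: continuous01_integrable; exact: continuous01_cst.
Qed.

Lemma FTC01 H h : (forall t : R, 0 <= t <= 1 -> is_derive t 1 H (h t)) ->
  continuous01 h -> integral01 h = H 1 - H 0.
Proof.
move=> dH ch.
have cH (t : R) : 0 <= t <= 1 -> {for t, continuous H}.
  by move=> /dH[+ _] => /derivable1_diffP/differentiable_continuous.
rewrite /integral01 /Rintegral (@continuous_FTC2 _ h H 0 1) ?ltr01//.
- exact: continuous01_within.
- split.
  + by move=> t; rewrite in_itv/= => /andP[t0 t1]; case: (dH t); rewrite ?ltW.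
  + by apply: cvg_at_right_filter; apply: cH; rewrite lexx ler01.
  + by apply: cvg_at_left_filter; apply: cH; rewrite lexx ler01.
- move=> t; rewrite in_itv/= => /andP[t0 t1]; rewrite derive1E.
  by case: (dH t); rewrite ?ltW.
Qed.

End UnitIntegral.

(** * Integrals along the segments of a partial contraction *)

Section ParametricIntegral.
Variables (R : realType) (n : nat) (I : pred 'I_n) (z0 : 'rV[R]_n) (U : set 'rV[R]_n).
Hypothesis oU : open U.

(** The coordinates outside [I] are parameters. With [I] everything this is the contraction onto
    [z0] used in Hadamard's lemma; with [I] the fiber coordinates it contracts each fiber onto a
    point. *)
Definition stretch (t : R) (z : 'rV[R]_n) : 'rV[R]_n :=
  \row_j (if I j then z0 0 j + t * (z 0 j - z0 0 j) else z 0 j).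

Hypothesis starU : forall t z, 0 <= t <= 1 -> U z -> U (stretch t z).

Definition offset (z : 'rV[R]_n) : 'rV[R]_n :=
  \row_j (if I j then z 0 j - z0 0 j else 0).

(** Differentiating [F (stretch t z)] in a direction of [I] brings out a factor [t]. The weight
    [t ^+ p] makes the family closed under differentiation, so smoothness follows by induction. *)
Definition stretch_integral p (F : 'rV[R]_n -> R) (z : 'rV[R]_n) : R :=
  integral01 (fun t => t ^+ p * F (stretch t z)).

Local Notation G := stretch_integral.

Lemma stretchE t z : stretch t z = stretch 0 z + t *: offset z.
Proof.
apply/rowP => j; rewrite !mxE; case: (I j); last by rewrite mulr0 addr0.
by rewrite mul0r addr0.
Qed.

Lemma stretch1 z : stretch 1 z = z.
Proof.
by apply/rowP => j; rewrite !mxE mul1r; case: (I j); rewrite // addrC subrK.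
Qed.

Lemma stretch_line t z (h : R) (i : 'I_n) :
  stretch t (z + h *: 'e_i) = stretch t z + (t ^+ I i * h) *: 'e_i.
Proof.
apply/rowP => j; rewrite !mxE; have [->|ji] := eqVneq j i.
  by case: (I i); rewrite /= ?expr1 ?expr0 ?eqxx /= !mulr1; ring.
by case: (I j); rewrite /= ?(negPf ji) ?andbF ?mulr0 ?addr0.
Qed.

Lemma cvg_rV (T : Type) (F : set_system T) (FF : Filter F) p (f : T -> 'rV[R]_p) (l : 'rV[R]_p) :
  (forall j, f x 0 j @[x --> F] --> l 0 j) -> f @ F --> l.
Proof.
move=> H; apply: (cvgrPdist_lt (F := F) f l).2 => e e0.
have Fj (j : 'I_p) : \forall y \near F, `|l 0 j - f y 0 j| < e.
  by have /cvgrPdist_lt := H j; exact.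
have := filter_forall FF Fj; apply: filterS => y Hy.
rewrite [ltLHS]/Num.norm/= mx_normrE.
rewrite (bigmax_lt _ e0)//= => -[a j] _ /=.
by rewrite (ord1 a) !mxE.
Qed.

Lemma stretch_cvg (T : Type) (F : set_system T) (FF : Filter F) (t : R) (z : 'rV[R]_n)
    (f : T -> R) (g : T -> 'rV[R]_n) :
  f @ F --> t -> g @ F --> z -> stretch (f x) (g x) @[x --> F] --> stretch t z.
Proof.
move=> ft gz; apply: cvg_rV => j.
have gj : g x 0 j @[x --> F] --> z 0 j.
  exact: cvg_comp gz (@coord_continuous R 1 n 0 j z).
rewrite mxE; under eq_cvg do rewrite mxE.
case: (I j) => //.
apply: cvgD; first exact: cvg_cst.
by apply: cvgM => //; apply: cvgB => //; exact: cvg_cst.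
Qed.

Lemma continuous01_stretch (F : 'rV[R]_n -> R) (z : 'rV[R]_n) :
  (forall x, U x -> {for x, continuous F}) -> U z ->
  continuous01 (fun t => F (stretch t z)).
Proof.
move=> cF Uz t t01.
have st : stretch s z @[s --> t] --> stretch t z.
  by apply: stretch_cvg; [exact: cvg_id|exact: cvg_cst].
exact: cvg_comp st (cF _ (starU t01 Uz)).
Qed.

(** Compactness of the unit interval makes the neighbourhood of [z] independent of [t]. *)
Lemma stretch_uniform (F : 'rV[R]_n -> R) (z : 'rV[R]_n) (e : R) :
  (forall x, U x -> {for x, continuous F}) -> U z ->
  0 < e -> \forall z' \near nbhs z, forall t : R, 0 <= t <= 1 ->
    U z' /\ `|F (stretch t z') - F (stretch t z)| <= e.
Proof.
move=> cF Uz e0.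
have nU : \forall z' \near nbhs z, U z' by exact: open_nbhs_nbhs.
have e2 : 0 < e / 2 by rewrite divr_gt0.
have : \forall z' \near nbhs z, `[0%R, 1%R]%classic `<=`
    (fun t => `|F (stretch t z') - F (stretch t z)| <= e).
  have /compact_near_coveringP := @segment_compact R 0 1; apply => t.
  rewrite /= in_itv /= => t01.
  have cFt := cF _ (starU t01 Uz).
  have H : \forall p \near (nbhs (t, z) : set_system (R * 'rV[R]_n)),
      `|F (stretch t z) - F (stretch p.1 p.2)| <= e / 2.
    have st : stretch p.1 p.2 @[p --> (nbhs (t, z) : set_system (R * 'rV[R]_n))] --> stretch t z.
      by apply: stretch_cvg; [exact: cvg_fst|exact: cvg_snd].
    have c := cvg_comp _ _ st cFt.
    by move/cvgrPdist_le : c; exact.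
  have H' : \forall p \near (nbhs (t, z) : set_system (R * 'rV[R]_n)),
      `|F (stretch t z) - F (stretch p.1 z)| <= e / 2.
    have st : stretch p.1 z @[p --> (nbhs (t, z) : set_system (R * 'rV[R]_n))] --> stretch t z.
      by apply: stretch_cvg; [exact: cvg_fst|exact: cvg_cst].
    have c := cvg_comp _ _ st cFt.
    by move/cvgrPdist_le : c; exact.
  move: H H'; apply: filterS2 => -[s z'] /= H1 H2.
  move: H1 H2; rewrite !ler_norml => /andP[H1 H2] /andP[H3 H4].
  by apply/andP; split; lra.
move: nU; apply: filterS2 => z' Uz' H t t01; split => //.
by apply: H; rewrite /= in_itv.
Qed.

Lemma stretch_integral_continuous p (F : 'rV[R]_n -> R) (z : 'rV[R]_n) :
  (forall x, U x -> {for x, continuous F}) -> U z ->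
  {for z, continuous (G p F)}.
Proof.
move=> cF Uz; apply: (cvgrPdist_le (F := nbhs z) (G p F) (G p F z)).2 => e e0.
move: (stretch_uniform cF Uz e0); apply: filterS => z' H.
have Uz' : U z' by case: (H 0) => //; rewrite lexx ler01.
rewrite distrC; apply: integral01_dist_le.
- by apply: continuous01M; [exact: continuous01_expr|exact: continuous01_stretch].
- by apply: continuous01M; [exact: continuous01_expr|exact: continuous01_stretch].
- move=> t t01; have [_ Ht] := H t t01; move/andP: (t01) => [t0 t1].
  rewrite -mulrBr normrM -[e]mul1r; apply: ler_pM => //.
  by rewrite normrX ger0_norm// exprn_ile1.
Qed.

Lemma stretch_derive F z (h t : R) (i : 'I_n) : smooth_on U F -> 0 <= t <= 1 ->
  U (z + h *: 'e_i) ->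
  is_derive h 1 (fun h => F (stretch t (z + h *: 'e_i)))
    (t ^+ I i * 'D_'e_i F (stretch t (z + h *: 'e_i))).
Proof.
move=> smF t01 Uz.
have -> : (fun h => F (stretch t (z + h *: 'e_i))) =
    (fun r => F (stretch t z + r *: 'e_i)) \o (fun h => t ^+ I i * h).
  by apply/funext => s; rewrite /= stretch_line.
have dm : is_derive h 1 (fun h => t ^+ I i * h : R) (t ^+ I i).
  have H1 := @is_deriveM _ _ (cst (t ^+ I i)) id h 1 _ _ (is_derive_cst _ _ _) (is_derive_id _ _).
  by apply: is_derive_eq H1 _; rewrite scaler0 addr0 [_ *: _]mulr1.
rewrite mulrC stretch_line.
apply: is_derive1_comp.
apply: is_derive_line; rewrite -stretch_line.
by apply: smooth_on_derivable smF _; exact: starU.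
Qed.

Lemma stretch_integral_derive p F (z : 'rV[R]_n) (i : 'I_n) : smooth_on U F -> U z ->
  is_derive z 'e_i (G p F) (G (p + I i) ('D_'e_i F) z).
Proof.
move=> smF Uz.
have cF x : U x -> {for x, continuous F} by exact: smooth_on_continuous.
have smD := smooth_on_derive i smF.
have cD x : U x -> {for x, continuous ('D_'e_i F)} by exact: smooth_on_continuous.
pose f (h t : R) := t ^+ p * F (stretch t (z + h *: 'e_i)).
(* This dominates the derivative of the integrand: for [h] small, uniformly in [t], the partial
   derivative of [F] differs by at most 1 from its value at [h = 0], and the powers of [t] are at
   most 1. *)
pose K (t : R) := 1 + `|t ^+ (p + I i) * 'D_'e_i F (stretch t z)|.
have [d d0 Hd] : exists2 d : R, 0 < d & forall h t : R, `|h| < d -> 0 <= t <= 1 ->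
    U (z + h *: 'e_i) /\
    `|'D_'e_i F (stretch t (z + h *: 'e_i)) - 'D_'e_i F (stretch t z)| <= 1.
  have /nbhs_ballP[d d0 Hd] := stretch_uniform cD Uz ltr01.
  exists d => // h t hd t01; apply: Hd => //.
  rewrite -ball_normE /ball_ /= opprD addNKr normrN normrZ.
  apply: le_lt_trans hd; rewrite -[leRHS]mulr1 ler_wpM2l//.
  exact: norm_delta_le.
have itvd (h : R) : h \in `](- d), d[ -> `|h| < d.
  by rewrite in_itv /= -ltr_norml.
have df (h t : R) : `|h| < d -> 0 <= t <= 1 -> is_derive h 1 (f ^~ t)
    (t ^+ (p + I i) * 'D_'e_i F (stretch t (z + h *: 'e_i))).
  move=> hd t01; have [Uh _] := Hd h t hd t01.
  have := @is_deriveZ _ _ _ _ (t ^+ p) h 1 _ (stretch_derive smF t01 Uh).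
  by rewrite exprD -mulrA.
have mB : measurable (`[0%R, 1%R]%classic : set (measurableTypeR R)) by [].
have I0 : `](- d), d[%classic (0 : R) by rewrite /= in_itv /= oppr_lt0 d0.
have intf (h : R) : `](- d), d[%classic h ->
    lebesgue_measure.-integrable `[0%R, 1%R] (EFin \o f h).
  move=> /itvd hd; apply: continuous01_integrable.
  apply: continuous01M; first exact: continuous01_expr.
  apply: continuous01_stretch => //.
  by have [] := Hd h 0 hd; rewrite ?lexx ?ler01.
have derf (h t : R) : `](- d), d[%classic h -> `[0%R, 1%R]%classic t ->
    derivable (f ^~ t) h 1.
  by move=> /itvd hd; rewrite /= in_itv /= => t01; case: (df h t hd t01).
have K0 t : 0 <= K t by rewrite addr_ge0.
have intK : lebesgue_measure.-integrable `[0%R, 1%R] (EFin \o K).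
  apply: continuous01_integrable; apply: continuous01D; first exact: continuous01_cst.
  apply: continuous01_norm; apply: continuous01M; first exact: continuous01_expr.
  exact: (continuous01_stretch cD Uz).
have Kub (h t : R) : `](- d), d[%classic h -> `[0%R, 1%R]%classic t ->
    `|partial1of2 f h t| <= K t.
  move=> /itvd hd; rewrite /= in_itv /= => t01.
  rewrite partial1of2E (@derive_val _ _ _ _ _ _ _ (df h t hd t01)).
  have [_ H] := Hd h t hd t01; rewrite /K -lerBlDr.
  apply: le_trans (lerB_dist _ _) _; rewrite -mulrBr normrM -[1]mul1r.
  apply: ler_pM => //; move/andP: t01 => [t0 t1].
  by rewrite normrX ger0_norm// exprn_ile1.
have dG := derivable_under_integral mB I0 intf derf K0 intK Kub.
have DG := differentiation_under_integral mB I0 intf derf K0 intK Kub.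
have E : (fun h : R => h^-1 *: ((G p F \o shift z) (h *: 'e_i) - G p F z)) =
    (fun h : R => h^-1 *: (((fun h => integral01 (f h)) \o shift 0) (h *: 1) - integral01 (f 0))).
  apply/funext => h /=; rewrite addr0 [h *: 1]mulr1 /f scale0r addr0.
  by rewrite [h *: _ + z]addrC.
split; first by rewrite /derivable E.
have -> : 'D_'e_i (G p F) z = derive1 (fun h => integral01 (f h)) 0.
  by rewrite derive1E /derive E.
rewrite [LHS]DG; apply: eq_integral01 => t t01.
have h0 : `|0 : R| < d by rewrite normr0.
rewrite partial1of2E (@derive_val _ _ _ _ _ _ _ (df 0 t h0 t01)).
by rewrite scale0r addr0.
Qed.

Lemma smooth_stretch_integral p F : smooth_on U F -> smooth_on U (G p F).
Proof.
move=> + k; elim: k p F => [|k IHk] p F smF.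
  move=> z Uz; apply: stretch_integral_continuous => // x.
  exact: smooth_on_continuous.
move=> i; split=> [z Uz|]; first by case: (stretch_integral_derive p i smF Uz).
apply: Ck_on_eq (IHk (p + I i)%N _ (smooth_on_derive i smF)) => // z Uz.
by rewrite (@derive_val _ _ _ _ _ _ _ (stretch_integral_derive p i smF Uz)).
Qed.

Lemma is_derive_stretch_t F (z : 'rV[R]_n) (t : R) : smooth_on U F -> U z -> 0 <= t <= 1 ->
  is_derive t 1 (fun t => F (stretch t z))
    (\sum_i offset z 0 i * 'D_'e_i F (stretch t z)).
Proof.
move=> smF Uz t01.
have dF : differentiable F (stretch t z).
  by apply: smooth_on_differentiable smF _ => //; exact: starU.
rewrite -derive_sum_coord//.
have -> : (fun t => F (stretch t z)) = fun t => F (stretch 0 z + t *: offset z).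
  by apply/funext => s; rewrite stretchE.
rewrite [stretch t z]stretchE in dF *.
by apply: is_derive_line; exact: diff_derivable.
Qed.

Lemma continuous01_derive_stretch F (z : 'rV[R]_n) (i : 'I_n) : smooth_on U F -> U z ->
  continuous01 (fun t => 'D_'e_i F (stretch t z)).
Proof.
move=> smF Uz; apply: (continuous01_stretch (F := 'D_'e_i F)) => // x.
exact: smooth_on_continuous (smooth_on_derive i smF).
Qed.

(** Integrate the derivative of [F (stretch t z)] with respect to [t]; the factors [offset z 0 i] do
    not depend on [t] and leave the integral. *)
Lemma hadamard F z : smooth_on U F -> U z ->
  F z - F (stretch 0 z) = \sum_i offset z 0 i * G 0 ('D_'e_i F) z.
Proof.
move=> smF Uz.
have c i : continuous01 (fun t => offset z 0 i * 'D_'e_i F (stretch t z)).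
  by apply: continuous01M; [exact: continuous01_cst|exact: continuous01_derive_stretch].
have <- : integral01 (fun t => \sum_i offset z 0 i * 'D_'e_i F (stretch t z)) =
    F z - F (stretch 0 z).
  pose H (t : R) := F (stretch t z).
  have -> : F z - F (stretch 0 z) = H 1 - H 0 by rewrite /H stretch1.
  apply: FTC01 => [t t01|]; first exact: is_derive_stretch_t.
  exact: continuous01_sum.
rewrite integral01_sum//; apply: eq_bigr => i _.
rewrite integral01Zl; last exact: continuous01_derive_stretch.
by congr (_ * _); apply: eq_integral01 => t _; rewrite expr0 mul1r.
Qed.

(** The integral of the 1-form with components [u i] along the segment from [stretch 0 z] to [z], on
    which only the coordinates in [I] move. *)
Definition fiber_primitive (u : 'I_n -> 'rV[R]_n -> R) (z : 'rV[R]_n) : R :=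
  \sum_i offset z 0 i * G 0 (u i) z.

Lemma fiber_primitiveE u z : (forall i, smooth_on U (u i)) -> U z ->
  fiber_primitive u z =
  integral01 (fun t => \sum_i offset z 0 i * u i (stretch t z)).
Proof.
move=> smu Uz.
have c i : continuous01 (fun t => u i (stretch t z)).
  by apply: continuous01_stretch => // x; exact: smooth_on_continuous.
rewrite integral01_sum => [|i].
  apply: eq_bigr => i _; rewrite integral01Zl//; congr (_ * _).
  by apply: eq_integral01 => t _; rewrite expr0 mul1r.
by apply: continuous01M => //; exact: continuous01_cst.
Qed.

Lemma smooth_offset i : smooth_on U (fun z => offset z 0 i).
Proof.
case: (boolP (I i)) => Ii.
  apply: (@smooth_on_eq _ _ _ (fun z => z 0 i + cst (- z0 0 i) z)) => //.
    by move=> z _; rewrite mxE Ii.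
  by apply: smooth_on_add => //; [exact: smooth_on_coord|exact: smooth_on_cst].
apply: (@smooth_on_eq _ _ _ (cst 0)) => //; last exact: smooth_on_cst.
by move=> z _; rewrite mxE (negPf Ii).
Qed.

Lemma smooth_fiber_primitive u : (forall i, smooth_on U (u i)) ->
  smooth_on U (fiber_primitive u).
Proof.
move=> smu; apply: smooth_on_sum => // i; apply: smooth_on_mul => //.
  exact: smooth_offset.
exact: smooth_stretch_integral.
Qed.

Lemma is_derive_offset (z : 'rV[R]_n) (i l : 'I_n) : I l ->
  is_derive z 'e_l (fun z => offset z 0 i) ((i == l)%:R : R).
Proof.
move=> Il; have [Ii|Ii] := boolP (I i).
  have -> : (fun z => offset z 0 i) = (fun z : 'rV[R]_n => z 0 i) - cst (z0 0 i).
    by apply/funext => y; rewrite mxE Ii.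
  have := @is_deriveB _ _ _ _ _ _ _ _ _ (derivable_coordP i z 'e_l) (is_derive_cst (z0 0 i) z 'e_l).
  by rewrite subr0 mxE eqxx.
have -> : (fun z => offset z 0 i) = cst 0.
  by apply/funext => y; rewrite mxE (negPf Ii).
have -> : (i == l) = false by apply: contraNF Ii => /eqP ->.
exact: is_derive_cst.
Qed.

(** Since [offset z 0 i] is 0 for [i] outside [I], agreement in the directions of [I] is enough. It
    serves to exchange the two indices of the derivatives of a family closed along the fibers. *)
Lemma fiber_primitive_eq (v w : 'I_n -> 'rV[R]_n -> R) z :
  (forall i, continuous01 (fun t => w i (stretch t z))) ->
  (forall i t, I i -> 0 <= t <= 1 -> v i (stretch t z) = w i (stretch t z)) ->
  \sum_i offset z 0 i * G 1 (v i) z =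
  integral01 (fun t => \sum_i offset z 0 i * (t * w i (stretch t z))).
Proof.
move=> cw vw.
have ct i : continuous01 (fun t => t * w i (stretch t z)).
  by apply: continuous01M => // t _; exact: cvg_id.
rewrite integral01_sum => [|i]; last by apply: continuous01M => //; exact: continuous01_cst.
apply: eq_bigr => i _; rewrite integral01Zl//.
have [Ii|Ii] := boolP (I i); last by rewrite mxE (negPf Ii) !mul0r.
by congr (_ * _); apply: eq_integral01 => t t01; rewrite expr1 vw.
Qed.

(** By closedness the terms where the derivative hits the integrals become [t] times the
    [t]-derivative of [u l (stretch t z)]. Together with the term where it hits [offset], the
    integrand is the derivative of [t * u l (stretch t z)], whose values at 1 and 0 are [u l z] and
    0. *)
Lemma derive_fiber_primitive u z (l : 'I_n) : (forall i, smooth_on U (u i)) -> U z -> I l ->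
  (forall i z, I i -> U z -> 'D_'e_l (u i) z = 'D_'e_i (u l) z) ->
  'D_'e_l (fiber_primitive u) z = u l z.
Proof.
move=> smu Uz Il sym.
pose T (i : 'I_n) (z : 'rV[R]_n) := offset z 0 i * G 0 (u i) z.
have dT (i : 'I_n) : is_derive z 'e_l (T i)
    (offset z 0 i * G (0 + I l) ('D_'e_l (u i)) z + G 0 (u i) z * (i == l)%:R).
  have := @is_deriveM _ _ _ _ z 'e_l _ _ (is_derive_offset z i Il)
    (stretch_integral_derive 0 l (smu i) Uz).
  by [].
have -> : fiber_primitive u = \sum_i T i.
  by apply/funext => y; rewrite /fiber_primitive fct_sumE.
rewrite derive_sum => [|i]; last by case: (dT i).
rewrite (eq_bigr _ (fun i _ => @derive_val _ _ _ _ _ _ _ (dT i))) big_split /=.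
rewrite [X in _ + X](bigD1 l)//= eqxx mulr1 [X in _ + (_ + X)]big1 => [|i il]; last first.
  by rewrite (negPf il) mulr0.
rewrite addr0 Il add0n.
have c i : continuous01 (fun t => u i (stretch t z)).
  by apply: continuous01_stretch => // x; exact: smooth_on_continuous.
have cd (i : 'I_n) : continuous01 (fun t => 'D_'e_i (u l) (stretch t z)).
  exact: continuous01_derive_stretch.
have c1 : continuous01 (fun t : R => t).
  by move=> t _; exact: cvg_id.
have ct (i : 'I_n) : continuous01 (fun t => t * 'D_'e_i (u l) (stretch t z)).
  exact: continuous01M.
have cs : continuous01 (fun t => \sum_i offset z 0 i * (t * 'D_'e_i (u l) (stretch t z))).
  by apply: continuous01_sum => i; apply: continuous01M => //; exact: continuous01_cst.
have E := @fiber_primitive_eq (fun i => 'D_'e_l (u i)) (fun i => 'D_'e_i (u l)) z cd.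
rewrite [X in X + _]E => [|i t Ii t01]; last by rewrite sym//; exact: starU.
have -> : G 0 (u l) z = integral01 (fun t => u l (stretch t z)).
  by apply: eq_integral01 => t _; rewrite expr0 mul1r.
rewrite -integral01D//.
pose H (t : R) := t * u l (stretch t z).
have -> : u l z = H 1 - H 0 by rewrite /H mul0r subr0 mul1r stretch1.
apply: FTC01; last exact: continuous01D.
move=> t t01.
have := @is_deriveM _ _ _ _ t 1 _ _ (is_derive_id t 1) (is_derive_stretch_t (smu l) Uz t01).
rewrite scaler_sumr [u l _ *: 1]mulr1 => Hd.
apply: is_derive_eq; congr (_ + _); apply: eq_bigr => i _.
by rewrite [LHS]mulrCA.
Qed.

End ParametricIntegral.

(** * Cutoff functions *)

Section Bump.
Variable R : realType.

(* The factor x^-p makes the family stable under differentiation. *)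
Definition flat p (x : R) : R := if 0 < x then x^-1 ^+ p * expR (- x^-1) else 0.

Lemma flat_gt0 p (x : R) : 0 < x -> 0 < flat p x.
Proof. by move=> x0; rewrite /flat x0 mulr_gt0 ?expR_gt0// exprn_gt0// invr_gt0. Qed.

Lemma flat_ge0 p (x : R) : 0 <= flat p x.
Proof. by have [x0|x0] := ltP 0 x; [rewrite ltW// flat_gt0|rewrite /flat ltNge x0]. Qed.

Lemma flat_le0 p (x : R) : x <= 0 -> flat p x = 0.
Proof. by move=> x0; rewrite /flat ltNge x0. Qed.

(** The exponential series bounds exp(1/x) from below by its term of order p + 1, that is by
    x^-(p+1) / (p+1)!. *)
Lemma flat_le p (x : R) : 0 < x -> flat p x <= p.+1`!%:R * x.
Proof.
move=> x0; rewrite /flat x0 expRN.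
have xi0 : 0 < x^-1 by rewrite invr_gt0.
have H := expR_ge1Dxn p (ltW xi0).
have E0 : 0 < expR (x^-1) by exact: expR_gt0.
have F0 : 0 < p.+1`!%:R :> R by rewrite ltr0n fact_gt0.
rewrite ler_pdivrMr//.
apply: (@le_trans _ _ (p.+1`!%:R * x * (x^-1 ^+ p.+1 / p.+1`!%:R))).
  rewrite exprS; move: (x^-1 ^+ p) (p.+1`!%:R) F0 => a c F0.
  have -> // : c * x * (x^-1 * a / c) = a.
  by field; rewrite !gt_eqF.
rewrite ler_wpM2l// ?mulr_ge0// ?ltW//.
by apply: lt_le_trans H; rewrite ltrDr.
Qed.

(** The left-hand side is the difference quotient of [flat p] at 0, so the derivative there is the
    limit in [flat_cvg0] for [p.+1]. *)
Lemma flat_divr p (h : R) : h != 0 -> h^-1 * flat p h = flat p.+1 h.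
Proof.
by move=> h0; rewrite /flat; case: ifP => // _; rewrite ?mulr0// mulrA exprS.
Qed.

Lemma flat_cvg0 p : flat p h @[h --> 0^'] --> (0 : R).
Proof.
apply/cvgrPdist_le => e e0; near=> h; rewrite sub0r normrN ger0_norm ?flat_ge0//.
have [h0|h0] := ltP 0 h; last by rewrite flat_le0// ltW.
apply: le_trans (flat_le p h0) _.
have F0 : 0 < p.+1`!%:R :> R by rewrite ltr0n fact_gt0.
rewrite mulrC -ler_pdivlMr// -[h]ger0_norm ?ltW//.
near: h; apply: dnbhs0_lt; exact: divr_gt0.
Unshelve. all: by end_near. Qed.

Lemma is_derive_flat p (x : R) :
  is_derive x 1 (flat p) (- (p%:R * flat p.+1 x) + flat p.+2 x).
Proof.
case: (ltgtP 0 x) => [x0|x0|x0]; last first.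
- rewrite -x0 !flat_le0// mulr0 oppr0 addr0.
  have c : (fun h : R => h^-1 *: ((flat p \o shift 0) (h *: 1) - flat p 0)) @ 0^' --> (0 : R).
    apply: cvg_trans (flat_cvg0 p.+1); apply: near_eq_cvg; near=> h.
    rewrite /= [h *: 1]mulr1 addr0 (flat_le0 p (lexx 0)) subr0.
    rewrite -flat_divr//; near: h; exact: nbhs_dnbhs_neq.
  by split; [apply/cvg_ex; exists 0|exact: cvg_lim c].
- have n0 : \forall y \near nbhs x, cst 0 y = flat p y.
    near=> y; rewrite flat_le0// ltW//; near: y; exact: lt_nbhsl.
  apply: near_eq_is_derive n0 _.
  by rewrite !flat_le0 ?ltW// mulr0 oppr0 addr0; exact: is_derive_cst.
- pose f (y : R) := y^-1 ^+ p * expR (- y^-1).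
  have nf : \forall y \near nbhs x, f y = flat p y.
    near=> y; rewrite /flat /f; case: ifPn => //; rewrite -leNgt => y0.
    suff : 0 < y by rewrite ltNge y0.
    by near: y; exact: lt_nbhsr.
  apply: near_eq_is_derive nf _.
  have xn0 : x != 0 by rewrite gt_eqF.
  have dV : is_derive x 1 (fun y : R => y^-1) (- x ^- 2).
    split; first by apply: derivableV => //; exact: derivable_id.
    by rewrite deriveV// derive_id [LHS]mulr1.
  have dX : is_derive x 1 (fun y : R => y^-1 ^+ p) ((p%:R * x^-1 ^+ p.-1) *: (- x ^- 2)).
    have := @is_deriveX _ _ (fun y : R => y^-1) p x 1 _ dV.
    by rewrite exprfctE.
  have dE : is_derive x 1 (fun y : R => expR (- y^-1)) (expR (- x^-1) * x ^- 2).
    have dN : is_derive x 1 (fun y : R => - y^-1) (x ^- 2).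
      have := @is_deriveN _ _ _ _ x 1 _ dV.
      by rewrite opprK.
    exact: (@is_derive1_comp _ expR (fun y : R => - y^-1) x _ _ (is_derive_expR _) dN).
  have := @is_deriveM _ _ _ _ x 1 _ _ dX dE.
  move=> H; apply: is_derive_eq H _; rewrite /flat x0 -exprVn.
  rewrite /GRing.scale /=; case: p {dX f} => [|p] /=.
    by rewrite !expr0; ring.
  by rewrite !exprS; ring.
Unshelve. all: by end_near. Qed.

Lemma is_derive_coord1 (f : R -> R) (z : 'rV[R]_1) (i : 'I_1) (a : R) :
  is_derive (z 0 0) 1 f a -> is_derive z 'e_i (fun w : 'rV[R]_1 => f (w 0 0)) a.
Proof.
move=> [df <-].
have E : (fun h : R => h^-1 *: (((fun w : 'rV[R]_1 => f (w 0 0)) \o shift z) (h *: 'e_i) - f (z 0 0))) =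
   (fun h : R => h^-1 *: ((f \o shift (z 0 0)) (h *: 1) - f (z 0 0))).
  by apply/funext => h /=; rewrite !mxE (ord1 i) !eqxx.
split; first by rewrite /derivable E.
by rewrite /derive E.
Qed.

Lemma smooth_flat p : smooth_on setT (fun w : 'rV[R]_1 => flat p (w 0 0)).
Proof.
move=> k; elim: k p => [|k IHk] p.
  move=> z _.
  have [/derivable1_diffP/differentiable_continuous c _] := is_derive_flat p (z 0 0).
  exact: cvg_comp (@coord_continuous R 1 1 0 0 z) c.
move=> i; split=> [z _|].
  by case: (is_derive_coord1 i (is_derive_flat p (z 0 0))).
have := Ck_on_add openT (Ck_on_mul openT (Ck_on_cst k setT (- p%:R)) (IHk p.+1)) (IHk p.+2).
apply: Ck_on_eq => [|z _]; first exact: openT.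
rewrite (@derive_val _ _ _ _ _ _ _ (is_derive_coord1 i (is_derive_flat p (z 0 0)))).
by rewrite /cst mulNr.
Qed.

Definition smooth_step (x : R) : R := flat 0 x / (flat 0 x + flat 0 (1 - x)).

Lemma flat_sum_gt0 (x : R) : 0 < flat 0 x + flat 0 (1 - x).
Proof.
have [x0|x0] := ltP 0 x; first by rewrite ltr_pwDl ?flat_gt0 ?flat_ge0.
by rewrite ltr_pwDr ?flat_ge0// flat_gt0//; lra.
Qed.

Lemma smooth_step0 (x : R) : x <= 0 -> smooth_step x = 0.
Proof. by move=> x0; rewrite /smooth_step flat_le0// mul0r. Qed.

Lemma smooth_step1 (x : R) : 1 <= x -> smooth_step x = 1.
Proof.
move=> x1; rewrite /smooth_step [flat 0 (1 - x)]flat_le0 ?subr_le0// addr0.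
by rewrite mulfV// gt_eqF// flat_gt0//; lra.
Qed.

Lemma smooth_step_smooth : smooth_on setT (fun w : 'rV[R]_1 => smooth_step (w 0 0)).
Proof.
have sm1 : smooth_on setT (fun w : 'rV[R]_1 => flat 0 (1 - w 0 0)).
  have := @smooth_on_comp _ _ _ setT setT (fun w : 'rV[R]_1 => const_mx (1 - w 0 0)) openT openT
    (fun _ _ => I) _ _ (smooth_flat 0).
  move=> H; have {}H := H _.
  apply: (@smooth_on_eq _ _ _ ((fun w : 'rV[R]_1 => flat 0 (w 0 0)) \o
    (fun w : 'rV[R]_1 => const_mx (1 - w 0 0)))); first exact: openT.
    by move=> z _; rewrite /= mxE.
  apply: H => j.
  apply: (@smooth_on_eq _ _ _ (fun z => cst 1 z + cst (-1) z * z 0 0)); first exact: openT.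
    by move=> z _; rewrite mxE /= mulN1r.
  apply: smooth_on_add; [exact: openT|exact: smooth_on_cst|].
  by apply: smooth_on_mul; [exact: openT|exact: smooth_on_cst|exact: smooth_on_coord].
apply: smooth_on_mul; [exact: openT|exact: smooth_flat|].
apply: smooth_on_inv; first exact: openT.
  by move=> z _; rewrite gt_eqF// flat_sum_gt0.
by apply: smooth_on_add; [exact: openT|exact: smooth_flat|].
Qed.

Lemma smooth_on_prod n (U : set 'rV[R]_n) (I : Type) (s : seq I)
    (f : I -> 'rV[R]_n -> R) : open U ->
  (forall i, smooth_on U (f i)) -> smooth_on U (fun x => \prod_(i <- s) f i x).
Proof.
move=> oU H; elim: s => [|i s IHs].
  rewrite (_ : (fun _ => _) = cst 1); first exact: smooth_on_cst.
  by apply/funext => x; rewrite big_nil.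
rewrite (_ : (fun _ => _) = fun x => f i x * \prod_(j <- s) f j x).
  exact: smooth_on_mul.
by apply/funext => x; rewrite big_cons.
Qed.

Lemma bump_rV n (c : 'rV[R]_n) (e : R) : 0 < e ->
  exists (b : 'rV[R]_n -> R) (d : R), [/\ 0 < d, smooth_on setT b,
    forall z, `|z - c| < d -> b z = 1 & forall z, e <= `|z - c| -> b z = 0].
Proof.
move=> e0.
(* A polynomial in the coordinate that is at most 0 at distance [e] or more from [c 0 j] and at
   least 1 at distance less than [e / 2]: these are the thresholds of [smooth_step]. The norm is the
   maximum norm, so a product over the coordinates gives the bump. *)
pose q (j : 'I_n) (z : 'rV[R]_n) : R := 2 - 2 / e ^+ 2 * (z 0 j - c 0 j) ^+ 2.
have smq j : smooth_on setT (q j).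
  apply: (@smooth_on_eq _ _ _ (fun z => cst 2 z + cst (- (2 / e ^+ 2)) z *
    ((z 0 j + cst (- c 0 j) z) * (z 0 j + cst (- c 0 j) z)))); first exact: openT.
    by move=> z _; rewrite /q /cst /= expr2 mulNr.
  have smz : smooth_on setT (fun z : 'rV[R]_n => z 0 j + cst (- c 0 j) z).
    by apply: smooth_on_add; [exact: openT|exact: smooth_on_coord|exact: smooth_on_cst].
  apply: smooth_on_add; [exact: openT|exact: smooth_on_cst|].
  apply: smooth_on_mul; [exact: openT|exact: smooth_on_cst|].
  by apply: smooth_on_mul; [exact: openT| |].
exists (fun z => \prod_j smooth_step (q j z)), (e / 2).
have e20 : 0 < e ^+ 2 by rewrite exprn_gt0.
split; first by rewrite divr_gt0.
- apply: smooth_on_prod => [|j]; first exact: openT.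
  apply: (@smooth_on_eq _ _ _ ((fun w : 'rV[R]_1 => smooth_step (w 0 0)) \o
    (fun z => const_mx (q j z)))); first exact: openT.
    by move=> z _; rewrite /= mxE.
  apply: (@smooth_on_comp _ _ _ setT setT); [exact: openT|exact: openT|by []| |].
    move=> i; apply: (@smooth_on_eq _ _ _ (q j)) => //; first exact: openT.
    by move=> z _; rewrite mxE.
  exact: smooth_step_smooth.
- move=> z zc; rewrite big1// => j _; apply: smooth_step1.
  have zj : `|z 0 j - c 0 j| < e / 2.
    by apply: le_lt_trans zc; have := normr_rV_le (z - c) j; rewrite !mxE.
  rewrite /q; suff : 2 / e ^+ 2 * (z 0 j - c 0 j) ^+ 2 <= 1 by lra.
  rewrite mulrAC ler_pdivrMr// mul1r -real_normK ?num_real//.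
  have : `|z 0 j - c 0 j| ^+ 2 <= (e / 2) ^+ 2.
    have e2 : 0 <= e / 2 by rewrite divr_ge0// ltW.
    by rewrite ler_sqr ?nnegrE// ltW.
  by rewrite expr_div_n; move: (_ ^+ 2) e20 => a; lra.
- move=> z ez.
  have [j zj] : exists j, e <= `|z 0 j - c 0 j|.
    apply: contrapT => /forallNP H; move: ez; apply/negP; rewrite -ltNge.
    rewrite [ltLHS]/Num.norm/= mx_normrE bigmax_lt//= => -[a j] _ /=.
    by rewrite (ord1 a) !mxE ltNge; apply/negP; exact: H.
  rewrite (bigD1 j)//= smooth_step0 ?mul0r//.
  rewrite /q; suff : 2 <= 2 / e ^+ 2 * (z 0 j - c 0 j) ^+ 2 by lra.
  rewrite mulrAC ler_pdivlMr// ler_pM2l// -[leRHS]real_normK ?num_real//.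
  by rewrite ler_sqr ?nnegrE// ltW.
Qed.

End Bump.

(** * Smooth functions and derivations on a set with an atlas *)

Section Atlas.
Variables (R : realType) (B : Type) (n : nat) (atlas : set (chart R B n)).
Implicit Types (D W : set B) (f g h F : B -> R) (b : B) (c : chart R B n).

(** Openness as seen by the charts alone. It allows one treatment of manifolds, where it agrees with
    the topology, and of total spaces, where no topology is recorded. *)
Definition aopen D := forall c, atlas c -> open (cphi c @` (cdom c `&` D)).

Record smooth_atlas : Prop := SmoothAtlas {
  chartK : forall c b, atlas c -> cdom c b -> cpsi c (cphi c b) = b;
  cdom_aopen : forall c, atlas c -> aopen (cdom c);
  chart_compat : forall c, atlas c -> forall j,
    smooth_in atlas (cdom c) (fun b => cphi c b 0 j) }.

Hypothesis SA : smooth_atlas.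

Lemma chart_imageT c : atlas c -> open (cphi c @` cdom c).
Proof. by move=> ac; have := cdom_aopen SA ac ac; rewrite setIid. Qed.

Lemma aopenT : aopen setT.
Proof. by move=> c ac; rewrite setIT; exact: chart_imageT. Qed.

Lemma chart_image_sub c D : D `<=` cdom c -> cphi c @` (cdom c `&` D) = cphi c @` D.
Proof.
move=> Dc; congr (_ @` _); apply/seteqP; split=> b; first by case.
by move=> Db; split => //; exact: Dc.
Qed.

Lemma aopen_image c D : atlas c -> aopen D -> D `<=` cdom c -> open (cphi c @` D).
Proof. by move=> ac oD Dc; rewrite -chart_image_sub//; exact: oD. Qed.

Lemma smooth_in_sub D W f : D `<=` W -> smooth_in atlas W f -> smooth_in atlas D f.
Proof.
move=> DW H c ac; apply: smooth_onS (H c ac) => z [b [cb Db] <-].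
by exists b => //; split => //; exact: DW.
Qed.

Lemma smooth_in_local D f :
  (forall b, D b -> exists W g, [/\ aopen W, W b, smooth_in atlas W g &
     forall b', W b' -> f b' = g b']) -> smooth_in atlas D f.
Proof.
move=> H c ac; apply/smooth_on_pointwise => _ [b [cb Db] <-].
have [W [g [oW Wb sg fg]]] := H b Db.
apply: smooth_onS (_ : _ `<=` cphi c @` (cdom c `&` W)) _.
  by move=> _ ->; exists b.
apply: smooth_on_eq (sg c ac); first exact: oW.
by move=> _ [b' [cb' Wb'] <-]; rewrite /= (chartK SA)// fg.
Qed.

Lemma smooth_in_eq D f g : aopen D -> (forall b, D b -> f b = g b) ->
  smooth_in atlas D f -> smooth_in atlas D g.
Proof.
move=> oD fg sf; apply: smooth_in_local => b Db.
by exists D, f; split => // b' /fg.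
Qed.

Lemma smooth_in_cover D W f : D `|` W = setT -> smooth_in atlas D f ->
  smooth_in atlas W f -> smooth atlas f.
Proof.
move=> DW Df Wf c ac; apply/smooth_on_pointwise => _ [b [cb _] <-].
have : (D `|` W) b by rewrite DW.
by case=> Hb; [apply: smooth_onS (Df c ac)|apply: smooth_onS (Wf c ac)];
  move=> _ ->; exists b.
Qed.

Lemma smooth_in_cst D (a : R) : smooth_in atlas D (fun=> a).
Proof. by move=> c ac; exact: smooth_on_cst. Qed.

Lemma smooth_in_add D f g : aopen D -> smooth_in atlas D f -> smooth_in atlas D g ->
  smooth_in atlas D (fun b => f b + g b).
Proof. by move=> oD sf sg c ac; apply: smooth_on_add; [exact: oD|exact: sf|exact: sg]. Qed.

Lemma smooth_in_mul D f g : aopen D -> smooth_in atlas D f -> smooth_in atlas D g ->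
  smooth_in atlas D (fun b => f b * g b).
Proof. by move=> oD sf sg c ac; apply: smooth_on_mul; [exact: oD|exact: sf|exact: sg]. Qed.

Lemma smooth_in_sum D (I : Type) (s : seq I) (f : I -> B -> R) : aopen D ->
  (forall i, smooth_in atlas D (f i)) -> smooth_in atlas D (fun b => \sum_(i <- s) f i b).
Proof.
move=> oD sf c ac; apply: (@smooth_on_sum R n _ _ s (fun i => f i \o cpsi c)).
  exact: oD.
by move=> i; exact: sf.
Qed.

(** The transition maps are smooth, so one chart whose domain contains [D] decides smoothness in all
    of them. *)
Lemma smooth_in_chart c D h : atlas c -> aopen D -> D `<=` cdom c ->
  smooth_on (cphi c @` D) (h \o cpsi c) -> smooth_in atlas D h.
Proof.
move=> ac oD Dc sh c' ac'.
have oI := oD c' ac'.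
apply: (@smooth_on_eq _ _ _ ((h \o cpsi c) \o (cphi c \o cpsi c'))) => //.
  by move=> _ [b [cb Db] <-]; rewrite /= (chartK SA)// (chartK SA)//; exact: Dc.
apply: smooth_on_comp (sh) => //.
- by rewrite -chart_image_sub//; exact: oD.
- by move=> _ [b [cb Db] <-]; rewrite /= (chartK SA)//; exists b.
- move=> j; apply: smooth_onS (chart_compat SA ac j ac') => z [b [cb Db] <-].
  by exists b => //; split => //; exact: Dc.
Qed.

Lemma smooth_in_comp_chart c D (G : 'rV[R]_n -> R) : atlas c -> aopen D -> D `<=` cdom c ->
  smooth_on (cphi c @` D) G -> smooth_in atlas D (fun b => G (cphi c b)).
Proof.
move=> ac oD Dc sG; apply: (smooth_in_chart ac oD Dc).
apply: (smooth_on_eq (f := G)) sG; first exact: aopen_image.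
by move=> _ [x Dx <-]; rewrite /= (chartK SA ac (Dc _ Dx)).
Qed.

Lemma smooth_in_image c D F : atlas c -> D `<=` cdom c -> smooth_in atlas D F ->
  smooth_on (cphi c @` D) (F \o cpsi c).
Proof. by move=> ac Dc sF; rewrite -chart_image_sub//; exact: sF. Qed.

Lemma smooth_in_coord c D j : atlas c -> D `<=` cdom c ->
  smooth_in atlas D (fun b => cphi c b 0 j).
Proof. by move=> ac Dc; apply: smooth_in_sub (chart_compat SA ac j). Qed.

Lemma smooth_in_partial c D F i : atlas c -> aopen D -> D `<=` cdom c ->
  smooth_in atlas D F ->
  smooth_in atlas D (fun b => 'D_'e_i (F \o cpsi c) (cphi c b)).
Proof.
move=> ac oD Dc sF.
exact: (smooth_in_comp_chart ac oD Dc (smooth_on_derive i (smooth_in_image ac Dc sF))).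
Qed.

Definition extend0 D h : B -> R := fun b => if `[< D b >] then h b else 0.

Lemma extend0_in D h b : D b -> extend0 D h b = h b.
Proof. by move=> Db; rewrite /extend0 asboolT. Qed.

Lemma extend0_out D h b : ~ D b -> extend0 D h b = 0.
Proof. by move=> Db; rewrite /extend0 asboolF. Qed.

(** The set [K] plays the part of a closed support: its complement is open and [K] lies in [D], so a
    function smooth on [D], once multiplied by [chi], extends smoothly by zero. On [D0] the
    multiplication changes nothing. *)
Definition is_cutoff D D0 (chi : B -> R) :=
  [/\ smooth atlas chi, aopen D0, forall b, D0 b -> chi b = 1 &
    exists K, [/\ K `<=` D, aopen (~` K) & forall b, ~ K b -> chi b = 0]].

Lemma smooth_extend0 D K h : aopen D -> aopen (~` K) -> K `<=` D ->
  smooth_in atlas D h -> (forall b, D b -> ~ K b -> h b = 0) ->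
  smooth atlas (extend0 D h).
Proof.
move=> oD oK KD sh h0; apply: (@smooth_in_cover D (~` K)).
- apply/seteqP; split=> // b _.
  by have [/KD|] := pselect (K b); [left|right].
- by apply: smooth_in_eq sh => // b Db; rewrite extend0_in.
- apply: (smooth_in_eq oK _ (@smooth_in_cst (~` K) 0)) => b Kb.
  have [Db|Db] := pselect (D b); first by rewrite extend0_in// h0.
  by rewrite extend0_out.
Qed.

Lemma smooth_cutoff D D0 chi h : aopen D -> is_cutoff D D0 chi ->
  smooth_in atlas D h -> smooth atlas (extend0 D (fun b => chi b * h b)).
Proof.
move=> oD [schi _ _ [K [KD oK chi0]]] sh.
apply: (smooth_extend0 oD oK KD); last by move=> b _ /chi0 ->; rewrite mul0r.
by apply: smooth_in_mul => //; apply: smooth_in_sub schi.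
Qed.

Lemma cutoff_sub D D0 chi : is_cutoff D D0 chi -> D0 `<=` D.
Proof.
move=> [_ _ chi1 [K [KD _ chi0]]] b D0b; apply: KD; apply: contrapT => /chi0.
by rewrite chi1// => /eqP; rewrite oner_eq0.
Qed.

Lemma cutoff_out D D0 chi b : is_cutoff D D0 chi -> ~ D b -> chi b = 0.
Proof. by move=> [_ _ _ [K [KD _ chi0]]] Db; apply: chi0 => /KD. Qed.

Lemma smooth_cst (a : R) : smooth atlas (fun=> a).
Proof. exact: smooth_in_cst. Qed.

Lemma smooth_add f g : smooth atlas f -> smooth atlas g -> smooth atlas (fun b => f b + g b).
Proof. by move=> sf sg; apply: smooth_in_add => //; exact: aopenT. Qed.

Lemma smooth_mul f g : smooth atlas f -> smooth atlas g -> smooth atlas (fun b => f b * g b).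
Proof. by move=> sf sg; apply: smooth_in_mul => //; exact: aopenT. Qed.

Lemma smooth_sub f g : smooth atlas f -> smooth atlas g -> smooth atlas (fun b => f b - g b).
Proof.
move=> sf sg; rewrite (_ : (fun _ => _) = fun b => f b + (-1) * g b).
  by apply: smooth_add => //; apply: smooth_mul => //; exact: smooth_cst.
by apply/funext => b; rewrite mulN1r.
Qed.

Lemma smooth_sum (I : Type) (s : seq I) (f : I -> B -> R) :
  (forall i, smooth atlas (f i)) -> smooth atlas (fun b => \sum_(i <- s) f i b).
Proof. by move=> sf; apply: smooth_in_sum => //; exact: aopenT. Qed.

Section Tangent.
Variables (b : B) (v : (B -> R) -> R).
Hypothesis tv : tangent (smooth atlas) b v.

Lemma tangent_add f g : smooth atlas f -> smooth atlas g ->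
  v (fun x => f x + g x) = v f + v g.
Proof.
move=> sf sg; have [_ lin _] := tv; rewrite -[v f]mul1r -lin//; congr v.
by apply/funext => x; rewrite mul1r.
Qed.

Lemma tangent0 : v (fun=> 0) = 0.
Proof.
have := tangent_add (smooth_cst 0) (smooth_cst 0).
have -> : (fun _ : B => 0 + 0) = (fun=> 0 : R) by apply/funext => x; rewrite addr0.
by move/eqP; rewrite -{1}[v _]addr0 => /eqP/addrI <-.
Qed.

Lemma tangent_scale (k : R) f : smooth atlas f -> v (fun x => k * f x) = k * v f.
Proof.
move=> sf; have [_ lin _] := tv.
rewrite -[RHS]addr0 -tangent0 -lin//; last exact: smooth_cst.
by congr v; apply/funext => x; rewrite addr0.
Qed.

Lemma tangent_sub f g : smooth atlas f -> smooth atlas g ->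
  v (fun x => f x - g x) = v f - v g.
Proof.
move=> sf sg; rewrite -[in RHS]mulN1r -tangent_scale// -tangent_add//.
  by congr v; apply/funext => x; rewrite mulN1r.
by apply: smooth_mul => //; exact: smooth_cst.
Qed.

Lemma tangent_sum (I : Type) (s : seq I) (f : I -> B -> R) : (forall i, smooth atlas (f i)) ->
  v (fun x => \sum_(i <- s) f i x) = \sum_(i <- s) v (f i).
Proof.
move=> sf; elim: s => [|i s IHs].
  by rewrite big_nil -[RHS]tangent0; congr v; apply/funext => x; rewrite big_nil.
rewrite big_cons -IHs -tangent_add//; last exact: smooth_sum.
by congr v; apply/funext => x; rewrite big_cons.
Qed.

Lemma tangent_mul f g : smooth atlas f -> smooth atlas g ->
  v (fun x => f x * g x) = v f * g b + f b * v g.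
Proof. by move: tv => [_ _]; exact. Qed.

Lemma tangent_cst (a : R) : v (fun=> a) = 0.
Proof.
have v1 : v (fun=> 1) = 0.
  have := tangent_mul (smooth_cst 1) (smooth_cst 1).
  have -> : (fun _ : B => 1 * 1) = (fun=> 1 : R) by apply/funext => x; rewrite mul1r.
  by rewrite mulr1 mul1r => /eqP; rewrite -{1}[v _]addr0 => /eqP/addrI <-.
rewrite -[RHS](mulr0 a) -v1 -tangent_scale; last exact: smooth_cst.
by congr v; apply/funext => x; rewrite mulr1.
Qed.

Lemma tangent_mul0 f g : smooth atlas f -> smooth atlas g -> f b = 0 -> g b = 0 ->
  v (fun x => f x * g x) = 0.
Proof. by move=> sf sg f0 g0; rewrite tangent_mul// f0 g0 mulr0 mul0r addr0. Qed.

(* Hadamard's lemma exhibits F - F b near b as a sum of products of smooth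
   functions whose first factors are the centered coordinates. *)
Lemma tangent_coords c D D0 chi : atlas c -> aopen D -> D `<=` cdom c ->
  is_cutoff D D0 chi -> D0 b ->
  (forall t z, 0 <= t <= 1 -> (cphi c @` D) z ->
    (cphi c @` D) (stretch predT (cphi c b) t z)) ->
  exists w : 'I_n -> R, forall F, smooth atlas F ->
    v F = \sum_i w i * 'D_'e_i (F \o cpsi c) (cphi c b).
Proof.
move=> ac oD Dc cut D0b star; set z0 := cphi c b.
have Db : D b by exact: cutoff_sub cut _ D0b.
have [schi _ chi1 _] := cut.
pose X i := extend0 D (fun x => chi x * (cphi c x 0 i - z0 0 i)).
have sX i : smooth atlas (X i).
  apply: (smooth_cutoff oD cut).
  apply: (@smooth_in_eq _ (fun x => cphi c x 0 i + (fun=> - z0 0 i) x)) => //.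
  apply: smooth_in_add => //; last exact: smooth_in_cst.
  exact: smooth_in_coord.
exists (fun i => v (X i)) => F sF.
have oU : open (cphi c @` D) by exact: aopen_image.
have sFc : smooth_on (cphi c @` D) (F \o cpsi c).
  by apply: smooth_in_image => //; apply: smooth_in_sub sF.
pose G i z := stretch_integral predT z0 0 ('D_'e_i (F \o cpsi c)) z.
have sG i : smooth_on (cphi c @` D) (G i).
  apply: smooth_stretch_integral => //; exact: smooth_on_derive.
pose Y i := extend0 D (fun x => chi x * G i (cphi c x)).
have sY i : smooth atlas (Y i).
  exact: (smooth_cutoff oD cut (smooth_in_comp_chart ac oD Dc (sG i))).
have str0 t : stretch predT z0 t z0 = z0.
  by apply/rowP => j; rewrite mxE /= subrr mulr0 addr0.
have Yb i : Y i b = 'D_'e_i (F \o cpsi c) z0.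
  rewrite /Y extend0_in// chi1// mul1r /G /stretch_integral -/z0.
  have -> : (fun t : R => t ^+ 0 * 'D_'e_i (F \o cpsi c) (stretch predT z0 t z0)) =
     (fun=> 'D_'e_i (F \o cpsi c) z0).
    by apply/funext => t; rewrite expr0 mul1r str0.
  exact: integral01_cst.
have Xb i : X i b = 0 by rewrite /X extend0_in// subrr mulr0.
(* Each of [X i] and [Y i] needs its own factor [chi] to be globally smooth, whence the square. In
   the remainder both factors vanish at [b], so a derivation at [b] kills it. *)
have E : (fun x => F x - F b) =
  (fun x => (1 - chi x * chi x) * (F x - F b) + \sum_i X i x * Y i x).
  apply/funext => x; have [Dx|Dx] := pselect (D x); last first.
    rewrite (cutoff_out cut Dx) mul0r subr0 mul1r big1 ?addr0// => i _.
    by rewrite /X extend0_out// mul0r.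
  rewrite (eq_bigr (fun i => chi x * chi x * (offset predT z0 (cphi c x) 0 i * G i (cphi c x)))).
    rewrite -big_distrr /= -(hadamard oU star sFc); last by exists x.
    have -> : stretch predT z0 0 (cphi c x) = z0.
      by apply/rowP => j; rewrite mxE /= mul0r addr0.
    rewrite /= (chartK SA ac (Dc _ Dx)) (chartK SA ac (Dc _ Db)).
    by rewrite mulrBl mul1r subrK.
  by move=> i _; rewrite /X /Y !extend0_in// mulrACA mxE.
have sF0 : smooth atlas (fun x => F x - F b) by apply: smooth_sub => //; exact: smooth_cst.
have sc : smooth atlas (fun x => 1 - chi x * chi x).
  by apply: smooth_sub; [exact: smooth_cst|exact: smooth_mul].
have -> : v F = v (fun x => F x - F b).
  by rewrite tangent_sub ?tangent_cst ?subr0//; exact: smooth_cst.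
rewrite E tangent_add; [|exact: smooth_mul|by apply: smooth_sum => i; exact: smooth_mul].
rewrite tangent_mul0 ?subrr ?chi1 ?mulr1 ?subrr// add0r tangent_sum => [|i]; last exact: smooth_mul.
by apply: eq_bigr => i _; rewrite tangent_mul// Xb mul0r addr0 Yb.
Qed.

Lemma partial_coord c W (eta : B -> R) i j : atlas c -> cdom c b -> aopen W -> W b ->
  W `<=` cdom c -> (forall x, W x -> eta x = cphi c x 0 i) ->
  'D_'e_j (eta \o cpsi c) (cphi c b) = (i == j)%:R.
Proof.
move=> ac cb oW Wb Wc H.
have -> : 'D_'e_j (eta \o cpsi c) (cphi c b) = 'D_'e_j (fun z : 'rV[R]_n => z 0 i) (cphi c b).
  apply: near_eq_derive; have : nbhs (cphi c b) (cphi c @` W).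
    by apply: open_nbhs_nbhs; split; [exact: aopen_image|exists b].
  apply: filterS => _ [x Wx <-] /=.
  by rewrite (chartK SA ac (Wc _ Wx)) H.
rewrite (@derive_val _ _ _ _ _ _ _ (derivable_coordP i (cphi c b) 'e_j)).
by rewrite mxE eqxx.
Qed.

(** Applying the formula of [tangent_coords] to [eta i] identifies its i-th weight with [v (eta i)].
    The components thus come from any smooth extensions of the coordinates, fixed independently of
    the point [b]. *)
Lemma tangentE c D D0 chi W (eta : 'I_n -> B -> R) : atlas c -> aopen D -> D `<=` cdom c ->
  is_cutoff D D0 chi -> D0 b ->
  (forall t z, 0 <= t <= 1 -> (cphi c @` D) z ->
    (cphi c @` D) (stretch predT (cphi c b) t z)) ->
  aopen W -> W b -> W `<=` cdom c -> (forall i, smooth atlas (eta i)) ->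
  (forall i x, W x -> eta i x = cphi c x 0 i) ->
  forall F, smooth atlas F ->
    v F = \sum_i v (eta i) * 'D_'e_i (F \o cpsi c) (cphi c b).
Proof.
move=> ac oD Dc cut D0b star oW Wb Wc seta etaE.
have [w Hw] := tangent_coords ac oD Dc cut D0b star.
have wE i : v (eta i) = w i.
  rewrite Hw// (bigD1 i)//= big1 => [|j ji].
    by rewrite (partial_coord i ac (Wc _ Wb) oW Wb Wc (etaE i)) eqxx mulr1 addr0.
  by rewrite (partial_coord j ac (Wc _ Wb) oW Wb Wc (etaE i)) eq_sym (negPf ji) mulr0.
by move=> F sF; rewrite Hw//; apply: eq_bigr => i _; rewrite wE.
Qed.

End Tangent.

End Atlas.

(** * Cutoffs and tangent vectors on a manifold *)

Section ManifoldAtlas.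
Variables (R : realType) (m : nat) (M : manifold R m).
Implicit Types (W : set M) (x : M).
Local Notation AM := (matlas M).

Lemma open_chart_image W c : AM c -> open W -> open (cphi c @` (cdom c `&` W)).
Proof.
move=> ac oW; have [oc oi cK cphi_c cpsi_c] := manifold_chart ac.
rewrite openE => _ [x [cx Wx] <-].
have n1 : nbhs (cphi c x) (cphi c @` cdom c) by apply: open_nbhs_nbhs; split => //; exists x.
have n2 : nbhs (cphi c x) (cpsi c @^-1` W).
  have := cpsi_c (cphi c x); rewrite /prop_for /continuous_at cK//; apply; first by exists x.
  exact: open_nbhs_nbhs.
move: n1 n2; apply: filterS2 => _ [y cy <-]; rewrite /= cK// => Wy.
by exists y.
Qed.

Lemma manifold_smooth_atlas : smooth_atlas AM.
Proof.
split.
- by move=> c b ac; have [_ _ cK _ _] := manifold_chart ac; exact: cK.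
- move=> c ac c' ac'; apply: open_chart_image => //.
  by have [] := manifold_chart ac.
- by move=> c ac j; exact: manifold_compat.
Qed.

Lemma aopenP W : aopen AM W <-> open W.
Proof.
split=> [aW|oW c ac]; last exact: open_chart_image.
rewrite openE => x Wx; have [c ac cx] := manifold_cover x.
have [oc oi cK cphi_c _] := manifold_chart ac.
have n1 : nbhs x (cdom c) by exact: open_nbhs_nbhs.
have n2 : nbhs x (cphi c @^-1` (cphi c @` (cdom c `&` W))).
  apply: (cphi_c x cx); apply: open_nbhs_nbhs; split; first exact: aW.
  by exists x.
move: n1 n2; apply: filterS2 => y cy [y' [cy' Wy'] E].
by rewrite -(cK y cy) -E cK.
Qed.

Lemma manifold_chart_ball W c x : AM c -> cdom c x -> open W -> W x ->
  exists2 e : R, 0 < e & forall z, `|z - cphi c x| < e -> (cphi c @` (cdom c `&` W)) z.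
Proof.
move=> ac cx oW Wx.
have /nbhs_ballP[e e0 He] : nbhs (cphi c x) (cphi c @` (cdom c `&` W)).
  by apply: open_nbhs_nbhs; split; [exact: open_chart_image|exists x].
exists e => // z zx; apply: He.
by rewrite -ball_normE /ball_ /= distrC.
Qed.

(** The bump is carried by a closed ball of half the available radius in a chart. The image [K] of
    this ball is compact, hence closed because the manifold is Hausdorff, and this makes the
    extension by zero smooth. *)
Lemma manifold_cutoff W x : open W -> W x ->
  exists D0 chi, [/\ open D0, D0 x & is_cutoff AM W D0 chi].
Proof.
move=> oW Wx; have [c ac cx] := manifold_cover x.
have [oc oi cK cphi_c cpsi_c] := manifold_chart ac.
have [e e0 He] := manifold_chart_ball ac cx oW Wx.
have e2 : 0 < e / 2 by rewrite divr_gt0.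
have [b [d [d0 sb b1 b0]]] := bump_rV (cphi c x) e2.
pose W' := cdom c `&` W.
have oW' : open W' by exact: openI.
pose CB := [set z : 'rV[R]_m | `|z - cphi c x| <= e / 2].
pose K := cpsi c @` CB.
have CBsub z : CB z -> (cphi c @` W') z.
  by move=> /= zx; apply: He; apply: le_lt_trans zx _; lra.
have KW' : K `<=` W'.
  by move=> _ [z /CBsub[y W'y <-] <-]; rewrite cK//; case: W'y.
have CBE : CB = closed_ball (cphi c x) (e / 2).
  by rewrite closed_ballE// /closed_ball_; apply/seteqP; split=> z /=; rewrite distrC.
have cCB : compact CB.
  apply: bounded_closed_compact; last by rewrite CBE; exact: closed_ball_closed.
  exists (`|cphi c x| + e / 2); split; first exact: num_real.
  move=> t tt z zx /=; apply: ltW; apply: le_lt_trans tt.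
  rewrite -[z](subrK (cphi c x)); apply: le_trans (ler_normD _ _) _.
  by rewrite addrC lerD2l.
have cK' : closed K.
  apply: compact_closed; first exact: manifold_hausdorff.
  apply: continuous_compact => //; apply: continuous_in_subspaceT => z.
  rewrite inE => /CBsub[y [cy _] <-].
  by apply: cpsi_c; exists y.
have aW' : aopen AM W' by exact/aopenP.
have aK : aopen AM (~` K) by apply/aopenP; rewrite openC.
have SA := manifold_smooth_atlas.
pose D0 := W' `&` cphi c @^-1` [set z | `|z - cphi c x| < d].
exists D0, (extend0 W' (fun y => b (cphi c y))).
have oD0 : open D0.
  rewrite openE => y [[cy Wy] yd].
  have n1 : nbhs y W' by exact: open_nbhs_nbhs.
  have n2 : nbhs y (cphi c @^-1` [set z | `|z - cphi c x| < d]).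
    apply: (cphi_c y cy); apply: open_nbhs_nbhs; split => //.
    rewrite (_ : [set _ | _] = ball (cphi c x) d); first exact: ball_open.
    by rewrite -ball_normE; apply/seteqP; split=> z /=; rewrite distrC.
  by move: n1 n2; apply: filterS2.
split=> //; first by split=> //; rewrite /= subrr normr0.
split.
- apply: (smooth_extend0 SA aW' aK KW').
    apply: (smooth_in_comp_chart SA ac aW'); first by move=> y [].
    by apply: smooth_onS sb.
  move=> y [cy Wy] Ky; apply: b0; rewrite leNgt; apply/negP => ye; apply: Ky.
  by exists (cphi c y); [exact: ltW|exact: cK].
- exact/aopenP.
- by move=> y [W'y yd]; rewrite extend0_in// b1.
- exists K; split=> // [y /KW'[] //|y Ky].
  have [W'y|W'y] := pselect (W' y); last by rewrite extend0_out.
  rewrite extend0_in// b0// leNgt; apply/negP => ye; apply: Ky.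
  by case: W'y => cy _; exists (cphi c y); [exact: ltW|exact: cK].
Qed.

(** Hadamard's lemma requires a star-shaped chart image; a ball about the image of [x] is one. *)
Lemma manifold_star W c x : AM c -> cdom c x -> open W -> W x ->
  exists2 e : R, 0 < e & exists D, [/\ open D, D x, D `<=` cdom c `&` W &
    cphi c @` D = [set z | `|z - cphi c x| < e]].
Proof.
move=> ac cx oW Wx; have [oc oi cK cphi_c cpsi_c] := manifold_chart ac.
have [e e0 He] := manifold_chart_ball ac cx oW Wx.
exists e => //; exists (cdom c `&` W `&` cphi c @^-1` [set z | `|z - cphi c x| < e]).
split.
- rewrite openE => y [[cy Wy] yd].
  have n1 : nbhs y (cdom c `&` W) by apply: open_nbhs_nbhs; split => //; exact: openI.
  have n2 : nbhs y (cphi c @^-1` [set z | `|z - cphi c x| < e]).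
    apply: (cphi_c y cy); apply: open_nbhs_nbhs; split => //.
    rewrite (_ : [set _ | _] = ball (cphi c x) e); first exact: ball_open.
    by rewrite -ball_normE; apply/seteqP; split=> z /=; rewrite distrC.
  by move: n1 n2; apply: filterS2.
- by split=> //; rewrite /= subrr normr0.
- by move=> y [].
- apply/seteqP; split=> [_ [y [_ ye] <-] //|z ze].
  by have [y [cy Wy] E] := He z ze; exists y; rewrite /preimage /= ?E.
Qed.

Lemma stretch_ball n (z0 z : 'rV[R]_n) (e t : R) : 0 <= t <= 1 -> `|z - z0| < e ->
  `|stretch predT z0 t z - z0| < e.
Proof.
move=> /andP[t0 t1] ze; apply: le_lt_trans ze.
rewrite (_ : _ - z0 = t *: (z - z0)); last first.
  by apply/rowP => j; rewrite !mxE /= addrC addKr.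
by rewrite normrZ ger0_norm// ler_piMl.
Qed.

Lemma manifold_tangentE c x W (xi : 'I_m -> M -> R) v : AM c -> cdom c x -> open W -> W x ->
  (forall i, smooth AM (xi i)) ->
  (forall i y, cdom c y -> W y -> xi i y = cphi c y 0 i) ->
  tangent (smooth AM) x v -> forall f, smooth AM f ->
    v f = \sum_i v (xi i) * 'D_'e_i (f \o cpsi c) (cphi c x).
Proof.
move=> ac cx oW Wx sxi xiE tv.
have [e e0 [D [oD Dx DW De]]] := manifold_star ac cx oW Wx.
have [D0 [chi [oD0 D0x cut]]] := manifold_cutoff oD Dx.
apply: (tangentE manifold_smooth_atlas tv ac _ _ cut D0x _ (_ : aopen AM D)) => //.
- exact/aopenP.
- by move=> y /DW[].
- by rewrite De => t z; exact: stretch_ball.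
- exact/aopenP.
- by move=> y /DW[].
- by move=> i y /DW[cy Wy]; exact: xiE.
Qed.

End ManifoldAtlas.

(** * The total space of a vector bundle *)

Section TotalSpace.
Variables (R : realType) (m r : nat) (M : manifold R m) (E : vectorBundle M r).
Local Notation AM := (matlas M).
Local Notation AE := (total_atlas E).
Local Notation TE := (total_space E).
Implicit Types (W : set M) (x : M) (t : trivialization E r) (a : TE).

Definition total_point x (u : E x) : TE := existT (fun x => E x : Type) x u.

Lemma total_pointE a : total_point (projT2 a) = a.
Proof. by case: a. Qed.

Lemma tcoord_linear t x : btriv t -> tdom t x -> forall k (u v : E x),
  tcoord t (k *: u + v) = k *: tcoord t u + tcoord t v.
Proof. by move=> bt tx; have [_ /(_ x tx)[]] := bundle_triv bt. Qed.

Lemma tcoordK t x (u : E x) : btriv t -> tdom t x -> tvec t x (tcoord t u) = u.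
Proof. by move=> bt tx; have [_ /(_ x tx)[_ + _]] := bundle_triv bt; exact. Qed.

Lemma tvecK t x y : btriv t -> tdom t x -> tcoord t (tvec t x y) = y.
Proof. by move=> bt tx; have [_ /(_ x tx)[_ _]] := bundle_triv bt; exact. Qed.

Lemma tdom_open t : btriv t -> open (tdom t).
Proof. by move=> bt; have [] := bundle_triv bt. Qed.

Lemma tcoord_inj t x (u v : E x) : btriv t -> tdom t x -> tcoord t u = tcoord t v -> u = v.
Proof. by move=> bt tx uv; rewrite -(tcoordK u bt tx) uv tcoordK. Qed.

Lemma tcoord0 t x : btriv t -> tdom t x -> tcoord t (0 : E x) = 0.
Proof.
move=> bt tx; have := tcoord_linear bt tx 1 0 0.
rewrite scaler0 addr0 scale1r => /eqP.
by rewrite -{1}[tcoord t 0]addr0 => /eqP/addrI <-.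
Qed.

Lemma tcoordD t x (u v : E x) : btriv t -> tdom t x ->
  tcoord t (u + v) = tcoord t u + tcoord t v.
Proof. by move=> bt tx; rewrite -[u in LHS]scale1r tcoord_linear// scale1r. Qed.

Lemma tcoordZ t x k (u : E x) : btriv t -> tdom t x ->
  tcoord t (k *: u) = k *: tcoord t u.
Proof. by move=> bt tx; rewrite -[k *: u]addr0 tcoord_linear// tcoord0// addr0. Qed.

Lemma tcoord_sum t x (I : Type) (s : seq I) (u : I -> E x) : btriv t -> tdom t x ->
  tcoord t (\sum_(i <- s) u i) = \sum_(i <- s) tcoord t (u i).
Proof.
move=> bt tx; elim: s => [|i s IHs]; first by rewrite !big_nil tcoord0.
by rewrite !big_cons tcoordD// IHs.
Qed.

Lemma tvec_sum t x (y : 'rV[R]_r) : btriv t -> tdom t x ->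
  tvec t x y = \sum_i y 0 i *: tvec t x 'e_i.
Proof.
move=> bt tx; apply: (tcoord_inj bt tx); rewrite tvecK// tcoord_sum//.
rewrite [LHS]row_sum_delta; apply: eq_bigr => i _.
by rewrite tcoordZ// tvecK.
Qed.

Lemma tvec_line t x (y b : 'rV[R]_r) (s : R) : btriv t -> tdom t x ->
  tvec t x (y + s *: b) = tvec t x y + s *: tvec t x b.
Proof.
move=> bt tx; apply: (tcoord_inj bt tx).
by rewrite tcoordD// tcoordZ// !tvecK.
Qed.

(** Over a set pulled back from the base the fiber coordinates are unrestricted, so the image is a
    cylinder. Openness and smoothness of pulled-back data therefore reduce to the base through
    [lsubmx]. *)
Lemma total_image c t W : AM c -> btriv t ->
  cphi (total_chart c t) @` (cdom (total_chart c t) `&` [set a | W (bproj a)]) =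
  [set z | (cphi c @` (cdom c `&` (tdom t `&` W))) (lsubmx z)].
Proof.
move=> ac bt; apply/seteqP; split=> [_ [a [[ca ta] Wa] <-]|z [x [cx [tx Wx]] xz]].
  by rewrite /= row_mxKl; exists (bproj a).
exists (total_point (tvec t x (rsubmx z))); first by [].
by rewrite /= tvecK// xz hsubmxK.
Qed.

Lemma total_image_self c t : AM c -> btriv t ->
  cphi (total_chart c t) @` cdom (total_chart c t) =
  [set z | (cphi c @` (cdom c `&` tdom t)) (lsubmx z)].
Proof.
move=> ac bt; have := total_image setT ac bt; rewrite setIT => <-.
by congr (_ @` _); apply/seteqP; split=> a; [move=> ?; split|case].
Qed.

Lemma lsubmx_continuous p q : continuous (fun z : 'rV[R]_(p + q) => lsubmx z : 'rV[R]_p).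
Proof. by move=> z; apply: differentiable_continuous; exact: differentiable_lsubmx. Qed.

Lemma open_lsubmx p q (V : set 'rV[R]_p) : open V ->
  open [set z : 'rV[R]_(p + q) | V (lsubmx z)].
Proof. by move=> oV; apply: (open_comp _ oV) => z _; exact: lsubmx_continuous. Qed.

Lemma smooth_on_lsubmx p q (V : set 'rV[R]_p) f : open V -> smooth_on V f ->
  smooth_on [set z : 'rV[R]_(p + q) | V (lsubmx z)] (fun z => f (lsubmx z)).
Proof.
move=> oV sf; apply: (@smooth_on_comp _ _ _ _ V _ _ oV _ _ f sf) => //.
  exact: open_lsubmx.
move=> j; apply: (@smooth_on_eq _ _ _ (fun z => z 0 (lshift q j))).
- exact: open_lsubmx.
- by move=> z _; rewrite mxE.
- exact: smooth_on_coord.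
Qed.

Lemma pull_aopen W : open W -> aopen AE [set a | W (bproj a)].
Proof.
move=> oW d [c [t [ac bt ->]]]; rewrite total_image//; apply: open_lsubmx.
by apply: open_chart_image => //; apply: openI => //; exact: tdom_open.
Qed.

Lemma smooth_in_pull W f : open W -> smooth_in AM W f ->
  smooth_in AE [set a | W (bproj a)] (fun a => f (bproj a)).
Proof.
move=> oW sf d [c [t [ac bt ->]]]; rewrite total_image//.
have o1 : open (cphi c @` (cdom c `&` (tdom t `&` W))).
  by apply: open_chart_image => //; apply: openI => //; exact: tdom_open.
have s1 : smooth_on (cphi c @` (cdom c `&` (tdom t `&` W))) (f \o cpsi c).
  by apply: smooth_onS (sf c ac) => z [x [cx [tx Wx]] <-]; exists x.
exact: (smooth_on_lsubmx r o1 s1).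
Qed.

Lemma smooth_pull f : smooth AM f -> smooth AE (fun a => f (bproj a)).
Proof. by move=> sf; apply: (@smooth_in_pull setT); [exact: openT|]. Qed.

(** In another trivialization the coordinate is linear in the fiber variables, with the coefficients
    that [bundle_compat] declares smooth in the base variables. *)
Lemma smooth_in_fiber_coord t j : btriv t ->
  smooth_in AE [set a | tdom t (bproj a)] (fun a => tcoord t (projT2 a) 0 j).
Proof.
move=> bt d [c [t' [ac bt' ->]]].
have ot := tdom_open bt; have ot' := tdom_open bt'.
rewrite total_image//; set U := cphi c @` _.
have oU : open U by apply: open_chart_image => //; exact: openI.
pose k i (x : M) := tcoord t (tvec t' x 'e_i) 0 j.
have sk i : smooth_on U (k i \o cpsi c).
  exact: smooth_onS (@subset_refl _ _) (bundle_compat bt' bt i j ac).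
have oU' := @open_lsubmx m r U oU.
apply: (@smooth_on_eq _ _ _ (fun z => \sum_i z 0 (rshift m i) * (k i \o cpsi c) (lsubmx z))) => //.
  move=> z [x [cx [t'x tx]] xz] /=.
  have [_ _ cK _ _] := manifold_chart ac.
  rewrite /k -xz cK// (tvec_sum (rsubmx z) bt' t'x) tcoord_sum// summxE.
  by apply: eq_bigr => i _; rewrite tcoordZ// !mxE.
apply: smooth_on_sum => // i; apply: smooth_on_mul => //.
  exact: smooth_on_coord.
exact: smooth_on_lsubmx.
Qed.

Lemma total_smooth_atlas : smooth_atlas AE.
Proof.
have cE d c t : d = total_chart c t -> cdom d = [set a | (cdom c `&` tdom t) (bproj a)].
  by move=> ->.
split.
- move=> d a [c [t [ac bt ->]]] [ca ta].
  have [_ _ cK _ _] := manifold_chart ac.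
  rewrite /= row_mxKl row_mxKr cK// tcoordK//.
  by case: a {ca ta}.
- move=> d [c [t [ac bt dE]]]; rewrite (cE _ _ _ dE); apply: pull_aopen.
  apply: openI; last exact: tdom_open.
  by have [] := manifold_chart ac.
- move=> d [c [t [ac bt ->]]] j.
  have oc : open (cdom c) by have [] := manifold_chart ac.
  case: (splitP j) => k jk.
    have jE : j = lshift r k by apply: val_inj.
    have -> : (fun a : TE => cphi (total_chart c t) a 0 j) = (fun a => cphi c (bproj a) 0 k).
      by apply/funext => a; rewrite /= jE row_mxEl.
    apply: (@smooth_in_sub _ _ _ _ _ [set a | cdom c (bproj a)]); first by move=> a [].
    exact: (smooth_in_pull oc (manifold_compat ac k)).
  have jE : j = rshift m k by apply: val_inj.
  have -> : (fun a : TE => cphi (total_chart c t) a 0 j) = (fun a => tcoord t (projT2 a) 0 k).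
    by apply/funext => a; rewrite /= jE row_mxEr.
  apply: (@smooth_in_sub _ _ _ _ _ [set a | tdom t (bproj a)]); first by move=> a [].
  exact: smooth_in_fiber_coord.
Qed.

Lemma pull_cutoff W D0 chi : is_cutoff AM W D0 chi ->
  is_cutoff AE [set a | W (bproj a)] [set a | D0 (bproj a)] (fun a => chi (bproj a)).
Proof.
move=> [sc aD0 c1 [K [KW aK c0]]]; split.
- exact: smooth_pull.
- by apply: pull_aopen; exact/aopenP.
- by move=> a /c1.
- exists [set a | K (bproj a)]; split.
  + by move=> a /KW.
  + by apply: (@pull_aopen (~` K)); exact/aopenP.
  + by move=> a /c0.
Qed.

Definition fiber_fun (F : TE -> R) x t (y : 'rV[R]_r) : R := F (total_point (tvec t x y)).

Lemma fiber_funE F c t x y : AM c -> cdom c x ->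
  fiber_fun F x t y = (F \o cpsi (total_chart c t)) (row_mx (cphi c x) y).
Proof.
move=> ac cx; have [_ _ cK _ _] := manifold_chart ac.
by rewrite /fiber_fun /= row_mxKl row_mxKr cK.
Qed.

Lemma total_atlasP c t : AM c -> btriv t -> AE (total_chart c t).
Proof. by move=> ac bt; exists c, t. Qed.

Lemma row_mx_image c t x y : AM c -> btriv t -> cdom c x -> tdom t x ->
  (cphi (total_chart c t) @` cdom (total_chart c t)) (row_mx (cphi c x) y).
Proof.
move=> ac bt cx tx; rewrite total_image_self//= row_mxKl.
by exists x.
Qed.

Lemma smooth_fiber_fun F x t : smooth AE F -> btriv t -> tdom t x ->
  smooth_on setT (fiber_fun F x t).
Proof.
move=> sF bt tx; have [c ac cx] := manifold_cover x.
have -> : fiber_fun F x t = (F \o cpsi (total_chart c t)) \o (fun y => row_mx (cphi c x) y).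
  by apply/funext => y; rewrite (fiber_funE F t y ac cx).
have ad := total_atlasP ac bt.
have oI := chart_imageT total_smooth_atlas ad.
apply: (smooth_on_comp openT oI) => [y _|j|].
- exact: row_mx_image.
- case: (splitP j) => k jk.
    have -> : j = lshift r k by apply: val_inj.
    apply: (@smooth_on_eq _ _ _ (cst (cphi c x 0 k))); [exact: openT| |exact: smooth_on_cst].
    by move=> y _; rewrite row_mxEl.
  have -> : j = rshift m k by apply: val_inj.
  apply: (@smooth_on_eq _ _ _ (fun y => y 0 k)); [exact: openT| |exact: smooth_on_coord].
  by move=> y _; rewrite row_mxEr.
- by have := sF _ ad; rewrite setIT.
Qed.

Lemma eq_derive_rate p q (f : 'rV[R]_p -> R) (g : 'rV[R]_q -> R)
    (x v : 'rV[R]_p) (y w : 'rV[R]_q) :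
  (forall h : R, f (h *: v + x) - f x = g (h *: w + y) - g y) ->
  'D_v f x = 'D_w g y.
Proof.
move=> fg.
have rE : (fun h : R => h^-1 *: ((f \o shift x) (h *: v) - f x)) =
    (fun h : R => h^-1 *: ((g \o shift y) (h *: w) - g y)).
  by apply/funext => h; rewrite /= fg.
by rewrite /derive rE.
Qed.

Lemma derive_fiber_fun F c t x y (v : 'rV[R]_r) : AM c -> cdom c x ->
  'D_v (fiber_fun F x t) y =
  'D_(row_mx 0 v) (F \o cpsi (total_chart c t)) (row_mx (cphi c x) y).
Proof.
move=> ac cx; apply: eq_derive_rate => h.
rewrite !(fiber_funE F t _ ac cx).
by rewrite scale_row_mx add_row_mx scaler0 add0r.
Qed.

Lemma delta_rshift (j : 'I_r) : 'e_(rshift m j) = row_mx 0 'e_j :> 'rV[R]_(m + r).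
Proof.
apply/rowP => i; case: (splitP i) => k ik.
  have -> : i = lshift r k by apply: val_inj.
  by rewrite row_mxEl !mxE eqxx eq_lrshift.
have -> : i = rshift m k by apply: val_inj.
by rewrite row_mxEr !mxE eqxx eq_rshift.
Qed.

Lemma delta_lshift (j : 'I_m) : 'e_(lshift r j) = row_mx 'e_j 0 :> 'rV[R]_(m + r).
Proof.
apply/rowP => i; case: (splitP i) => k ik.
  have -> : i = lshift r k by apply: val_inj.
  by rewrite row_mxEl !mxE eqxx eq_lshift.
have -> : i = rshift m k by apply: val_inj.
by rewrite row_mxEr !mxE eqxx eq_rlshift.
Qed.

Lemma partial_fiber_fun F c t x y (j : 'I_r) : AM c -> cdom c x ->
  'D_'e_j (fiber_fun F x t) y =
  'D_'e_(rshift m j) (F \o cpsi (total_chart c t)) (row_mx (cphi c x) y).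
Proof. by move=> ac cx; rewrite (derive_fiber_fun F t y _ ac cx) delta_rshift. Qed.

Lemma partial_pull (f : M -> R) c t x y (j : 'I_m) : AM c -> cdom c x ->
  'D_'e_(lshift r j) ((fun a : TE => f (bproj a)) \o cpsi (total_chart c t)) (row_mx (cphi c x) y) =
  'D_'e_j (f \o cpsi c) (cphi c x).
Proof.
move=> ac cx; apply: eq_derive_rate => h.
by rewrite delta_lshift /= scale_row_mx add_row_mx !row_mxKl.
Qed.

Lemma vliftE a (b : E (bproj a)) t F : smooth AE F -> btriv t -> tdom t (bproj a) ->
  vlift b F = 'D_(tcoord t b) (fiber_fun F (bproj a) t) (tcoord t (projT2 a)).
Proof.
move=> sF bt ta; rewrite /vlift asboolT// derive1E.
set f := fiber_fun _ _ _; set y := tcoord t _.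
have -> : (fun s : R => F (existT (fun x => E x : Type) (bproj a) (projT2 a + s *: b))) =
    (fun s => f (y + s *: tcoord t b)).
  apply/funext => s; rewrite /f /fiber_fun tvec_line// /y !tcoordK//.
have dy : derivable f (y + (0 : R) *: tcoord t b) (tcoord t b).
  apply: diff_derivable; apply: (smooth_on_differentiable openT) => //.
  exact: smooth_fiber_fun.
by rewrite (@derive_val _ _ _ _ _ _ _ (is_derive_line dy)) scale0r addr0.
Qed.

Lemma vlift_sum a (b : E (bproj a)) t F : smooth AE F -> btriv t -> tdom t (bproj a) ->
  vlift b F = \sum_j tcoord t b 0 j *
    'D_'e_j (fiber_fun F (bproj a) t) (tcoord t (projT2 a)).
Proof.
move=> sF bt ta; rewrite (vliftE b sF bt ta) derive_sum_coord//.
by apply: (smooth_on_differentiable openT) => //; exact: smooth_fiber_fun.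
Qed.

Lemma vlift_nonsmooth a (b : E (bproj a)) F : ~ smooth AE F -> vlift b F = 0.
Proof. by move=> sF; rewrite /vlift asboolF. Qed.

(** A derivative in direction [b] is linear in [b] because smooth functions are differentiable along
    the fiber; on the other functions both sides are 0 by convention. *)
Lemma vlift_linear a k (u v : E (bproj a)) : vlift (k *: u + v) = k *: vlift u + vlift v.
Proof.
have [t bt ta] := bundle_cover E (bproj a).
suff H F : vlift (k *: u + v) F = k * vlift u F + vlift v F by apply/funext => F; exact: H.
have [sF|sF] := pselect (smooth AE F); last by rewrite !vlift_nonsmooth// mulr0 addr0.
rewrite !(vlift_sum _ sF bt ta) tcoord_linear// mulr_sumr -big_split /=.
by apply: eq_bigr => j _; rewrite !mxE mulrDl mulrA.
Qed.

Lemma vlift0 a : vlift (0 : E (bproj a)) = 0.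
Proof.
have := vlift_linear 1 (0 : E (bproj a)) 0; rewrite scaler0 addr0 scale1r.
by move/eqP; rewrite -{1}[vlift _]addr0 => /eqP/addrI <-.
Qed.

Lemma vlift_pull a (b : E (bproj a)) f : vlift b (fun a => f (bproj a)) = 0.
Proof.
have [sF|sF] := pselect (smooth AE (fun a : TE => f (bproj a))); last exact: vlift_nonsmooth.
rewrite /vlift asboolT//= derive1E.
by rewrite (_ : (fun _ => _) = cst (f (bproj a))) ?derive_cst.
Qed.

Lemma vlift_tangent a (b : E (bproj a)) : tangent (smooth AE) a (vlift b).
Proof.
have [t bt ta] := bundle_cover E (bproj a).
have SA := total_smooth_atlas.
have aE F : fiber_fun F (bproj a) t (tcoord t (projT2 a)) = F a.
  by rewrite /fiber_fun tcoordK// total_pointE.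
have dF F j : smooth AE F ->
    derivable (fiber_fun F (bproj a) t) (tcoord t (projT2 a)) 'e_j.
  by move=> sF; apply: smooth_on_derivable (smooth_fiber_fun sF bt ta) _.
split=> [F|k F G sF sG|F G sF sG]; first exact: vlift_nonsmooth.
  have skF : smooth AE (fun a => k * F a) by apply: smooth_mul => //; exact: smooth_cst.
  rewrite (vlift_sum b (smooth_add SA skF sG) bt ta).
  rewrite (vlift_sum b sF bt ta) (vlift_sum b sG bt ta) mulr_sumr -big_split /=.
  apply: eq_bigr => j _.
  have -> : fiber_fun (fun a => k * F a + G a) (bproj a) t =
     k *: fiber_fun F (bproj a) t + fiber_fun G (bproj a) t by [].
  rewrite deriveD; [|by apply: derivableZ; exact: dF|exact: dF].
  by rewrite deriveZ; [rewrite mulrDr mulrCA|exact: dF].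
rewrite (vlift_sum b (smooth_mul SA sF sG) bt ta).
rewrite (vlift_sum b sF bt ta) (vlift_sum b sG bt ta) mulr_sumr mulr_suml -big_split /=.
apply: eq_bigr => j _.
have -> : fiber_fun (fun a => F a * G a) (bproj a) t =
   fiber_fun F (bproj a) t * fiber_fun G (bproj a) t by [].
rewrite deriveM; [|exact: dF|exact: dF].
by rewrite !aE mulrDr addrC mulrCA; congr (_ + _); rewrite [_ *: _]mulrC mulrA.
Qed.

Lemma smooth_vlift (b : forall a : TE, E (bproj a)) F :
  (forall t, btriv t -> forall i,
    smooth_in AE [set a | tdom t (bproj a)] (fun a => tcoord t (b a) 0 i)) ->
  smooth AE F -> smooth AE (fun a => vlift (b a) F).
Proof.
move=> sb sF; apply: smooth_in_local => [|a _]; first exact: total_smooth_atlas.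
have SA := total_smooth_atlas.
have [t bt ta] := bundle_cover E (bproj a); have [c ac cx] := manifold_cover (bproj a).
have ad := total_atlasP ac bt.
have oW : aopen AE (cdom (total_chart c t)) by exact: cdom_aopen.
pose P j a := 'D_'e_(rshift m j) (F \o cpsi (total_chart c t)) (cphi (total_chart c t) a).
exists (cdom (total_chart c t)), (fun a => \sum_j tcoord t (b a) 0 j * P j a).
split=> //.
  apply: smooth_in_sum => // j; apply: smooth_in_mul => //.
    apply: (@smooth_in_sub _ _ _ _ _ [set a | tdom t (bproj a)]); first by move=> ? [].
    exact: sb.
  apply: smooth_in_partial => //.
  exact: smooth_in_sub sF.
move=> a' [ca' ta']; rewrite (vlift_sum _ sF bt ta').
by apply: eq_bigr => j _; rewrite (partial_fiber_fun F t _ j ac ca').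
Qed.

End TotalSpace.

(** * Tangent vectors of the total space in coordinates *)

Section TotalTangent.
Variables (R : realType) (m r : nat) (M : manifold R m) (E : vectorBundle M r).
Local Notation AM := (matlas M).
Local Notation AE := (total_atlas E).
Local Notation TE := (total_space E).

(** The neighbourhood consists of the whole fibers over a coordinate ball of the base. Its chart
    image is a ball times the full fiber space, which is star-shaped about the image of [a] wherever
    [a] lies in its fiber. *)
Lemma total_tangentE c t (W : set M) (a : TE) (xi : 'I_m -> TE -> R) (eta : 'I_r -> TE -> R) v :
  AM c -> btriv t -> open W -> W (bproj a) -> W `<=` cdom c `&` tdom t ->
  (forall i, smooth AE (xi i)) -> (forall j, smooth AE (eta j)) ->
  (forall i a', W (bproj a') -> xi i a' = cphi c (bproj a') 0 i) ->
  (forall j a', W (bproj a') -> eta j a' = tcoord t (projT2 a') 0 j) ->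
  tangent (smooth AE) a v -> forall F, smooth AE F ->
  v F = \sum_i v (xi i) * 'D_'e_(lshift r i) (F \o cpsi (total_chart c t)) (cphi (total_chart c t) a)
    + \sum_j v (eta j) * 'D_'e_(rshift m j) (F \o cpsi (total_chart c t)) (cphi (total_chart c t) a).
Proof.
move=> ac bt oW Wa Wct sxi seta xiE etaE tv F sF.
have [ca ta] := Wct _ Wa.
have [e e0 [D [oD Da DW De]]] := manifold_star ac ca oW Wa.
have [D0 [chi [oD0 D0a cut]]] := manifold_cutoff oD Da.
have ad := total_atlasP ac bt; set d := total_chart c t in ad *.
pose D' := [set a : TE | D (bproj a)].
have D'd : D' `<=` cdom d by move=> a' /DW[_ /Wct].
have D'e : cphi d @` D' = [set z | `|lsubmx z - cphi c (bproj a)| < e].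
  apply/seteqP; split=> [_ [a' D'a' <-]|z /= ze].
    rewrite /= row_mxKl.
    have : (cphi c @` D) (cphi c (bproj a')) by exists (bproj a').
    by rewrite De.
  have : (cphi c @` D) (lsubmx z) by rewrite De.
  move=> [x Dx xz]; have [_ /Wct[_ tx]] := DW x Dx.
  exists (total_point (tvec t x (rsubmx z))) => //.
  by rewrite /= tvecK// xz hsubmxK.
pose zeta (i : 'I_(m + r)) := match fintype.split i with inl k => xi k | inr k => eta k end.
have zl i : zeta (lshift r i) = xi i.
  by rewrite /zeta; have := unsplitK (inl i : 'I_m + 'I_r) => /= ->.
have zr i : zeta (rshift m i) = eta i.
  by rewrite /zeta; have := unsplitK (inr i : 'I_m + 'I_r) => /= ->.
have SA := total_smooth_atlas E.
have oW' := pull_aopen (E := E) oW.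
have := @tangentE _ _ _ _ SA a v tv d D' _ _ [set a | W (bproj a)] zeta ad
  (pull_aopen (E := E) oD) D'd (pull_cutoff E cut) D0a _ oW' Wa _ _ _ F sF.
rewrite big_split_ord => ->.
- by congr (_ + _); apply: eq_bigr => i _; rewrite ?zl ?zr.
- rewrite D'e => s z s01 /= ze.
  have -> : lsubmx (stretch predT (cphi d a) s z) = stretch predT (cphi c (bproj a)) s (lsubmx z).
    by apply/rowP => j; rewrite mxE [LHS]mxE [RHS]mxE /d /= row_mxEl [lsubmx z 0 j]mxE.
  exact: stretch_ball.
- by move=> a' /Wct[].
- by move=> i; rewrite /zeta; case: (fintype.split i).
- move=> i a' Wa'; case: (splitP i) => k ik.
    have -> : i = lshift r k by apply: val_inj.
    by rewrite zl xiE//= row_mxEl.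
  have -> : i = rshift m k by apply: val_inj.
  by rewrite zr etaE//= row_mxEr.
Qed.

End TotalTangent.

(** * The prolongation and its local frames *)

Section Prolongation.
Variables (R : realType) (m r : nat) (M : manifold R m) (A : lieAlgebroid M r).
Local Notation AM := (matlas M).
Local Notation AE := (total_atlas A).
Local Notation TA := (total_space A).
Local Notation CA := (smooth AE).

Lemma ambientD1 (a : TA) (u v : ambient a) : (u + v).1 = u.1 + v.1. Proof. by []. Qed.
Lemma ambientZ1 (a : TA) k (u : ambient a) : (k *: u).1 = k *: u.1. Proof. by []. Qed.
Lemma ambientD2 (a : TA) (u v : ambient a) F : (u + v).2 F = u.2 F + v.2 F. Proof. by []. Qed.
Lemma ambientZ2 (a : TA) k (u : ambient a) F : (k *: u).2 F = k * u.2 F. Proof. by []. Qed.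
Lemma ambient01 (a : TA) : (0 : ambient a).1 = 0. Proof. by []. Qed.
Lemma ambient02 (a : TA) F : (0 : ambient a).2 F = 0. Proof. by []. Qed.

Lemma ambient_sum1 (a : TA) (I : Type) (s : seq I) (u : I -> ambient a) :
  (\sum_(i <- s) u i).1 = \sum_(i <- s) (u i).1.
Proof.
by elim: s => [|i s IHs]; [rewrite !big_nil|rewrite !big_cons ambientD1 IHs].
Qed.

Lemma ambient_sum2 (a : TA) (I : Type) (s : seq I) (u : I -> ambient a) F :
  (\sum_(i <- s) u i).2 F = \sum_(i <- s) (u i).2 F.
Proof.
by elim: s => [|i s IHs]; [rewrite !big_nil|rewrite !big_cons ambientD2 IHs].
Qed.

Lemma ambient_ext (a : TA) (u v : ambient a) : u.1 = v.1 -> (forall F, u.2 F = v.2 F) -> u = v.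
Proof. by case: u v => [u1 u2] [v1 v2] /= -> uv; congr pair; apply/funext. Qed.

Lemma lanchor0 x f : lanchor (0 : A x) f = 0.
Proof.
have := anchor_linear 1 (0 : A x) 0 f; rewrite scaler0 addr0 mul1r.
by move/eqP; rewrite -{1}[lanchor _ _]addr0 => /eqP/addrI <-.
Qed.

Lemma lanchorZ x k (b : A x) f : lanchor (k *: b) f = k * lanchor b f.
Proof. by rewrite -[k *: b]addr0 anchor_linear lanchor0 addr0. Qed.

Lemma lanchor_sum x (I : Type) (s : seq I) (k : I -> R) (b : I -> A x) f :
  lanchor (\sum_(i <- s) k i *: b i) f = \sum_(i <- s) k i * lanchor (b i) f.
Proof.
elim: s => [|i s IHs]; first by rewrite !big_nil lanchor0.
by rewrite !big_cons anchor_linear IHs.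
Qed.

Lemma functional_linE (B : Type) k (u v : (B -> R) -> R) f :
  (k *: u + v) f = k * u f + v f.
Proof. by []. Qed.

Lemma tangent_lin (B : Type) (C : set (B -> R)) b k (u v : (B -> R) -> R) :
  tangent C b u -> tangent C b v -> tangent C b (k *: u + v).
Proof.
move=> [u1 u2 u3] [v1 v2 v3]; split=> [f Cf|l f g Cf Cg|f g Cf Cg].
- by rewrite functional_linE u1// v1// mulr0 addr0.
- by rewrite !functional_linE u2// v2//; ring.
- by rewrite !functional_linE u3// v3//; ring.
Qed.

Lemma tangent_zero (B : Type) (C : set (B -> R)) b : tangent C b (0 : (B -> R) -> R).
Proof.
by split=> *; rewrite /= ?[LHS]/(0 : R) ?[in RHS]/(0 : R) ?mulr0 ?mul0r ?addr0.
Qed.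

Lemma prolong_lin (a : TA) k (u v : ambient a) : prolong u -> prolong v -> prolong (k *: u + v).
Proof.
move=> [u1 u2] [v1 v2]; split=> [|f sf]; first exact: tangent_lin.
by rewrite ambientD2 ambientZ2 -u2// -v2// ambientD1 ambientZ1 anchor_linear.
Qed.

Lemma prolong0 (a : TA) : prolong (0 : ambient a).
Proof.
split=> [|f sf]; first exact: tangent_zero.
by rewrite ambient02 ambient01 lanchor0.
Qed.

Lemma prolongD (a : TA) (u v : ambient a) : prolong u -> prolong v -> prolong (u + v).
Proof. by move=> pu pv; rewrite -[u]scale1r; exact: prolong_lin. Qed.

Lemma prolongZ (a : TA) k (u : ambient a) : prolong u -> prolong (k *: u).
Proof. by move=> pu; rewrite -[k *: u]addr0; apply: prolong_lin => //; exact: prolong0. Qed.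

Lemma prolong_sum (a : TA) (I : Type) (s : seq I) (u : I -> ambient a) :
  (forall i, prolong (u i)) -> prolong (\sum_(i <- s) u i).
Proof.
move=> pu; elim: s => [|i s IHs]; first by rewrite big_nil; exact: prolong0.
by rewrite big_cons; exact: prolongD.
Qed.

Lemma psection_lin (F : TA -> R) (Z1 Z2 : forall a, ambient a) : CA F ->
  psection Z1 -> psection Z2 -> psection (fun a => F a *: Z1 a + Z2 a).
Proof.
move=> sF [p1 c1 s1] [p2 c2 s2]; have SA := total_smooth_atlas A; split=> [a|t bt i|G sG].
- exact: prolong_lin.
- have oW := pull_aopen (E := A) (tdom_open bt).
  apply: (@smooth_in_eq _ _ _ _ SA _ (fun a => F a * tcoord t (Z1 a).1 0 i + tcoord t (Z2 a).1 0 i)) => //.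
    by move=> a ta; rewrite ambientD1 ambientZ1 tcoord_linear// !mxE.
  apply: smooth_in_add => //; last exact: c2.
  apply: smooth_in_mul => //; last exact: c1.
  exact: smooth_in_sub sF.
- apply: (smooth_add SA); last exact: s2.
  by apply: (smooth_mul SA) => //; exact: s1.
Qed.

Lemma psection0 : psection (fun a : TA => 0 : ambient a).
Proof.
split=> [a|t bt i|F sF]; first exact: prolong0; last exact: smooth_cst.
have SA := total_smooth_atlas A.
have oW := pull_aopen (E := A) (tdom_open bt).
apply: (@smooth_in_eq _ _ _ _ SA _ (fun=> 0)) => //; last exact: smooth_in_cst.
by move=> a ta; rewrite ambient01 tcoord0// mxE.
Qed.

Lemma psectionZ (F : TA -> R) (Z : forall a, ambient a) : CA F ->
  psection Z -> psection (fun a => F a *: Z a).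
Proof.
move=> sF pZ; have := psection_lin sF pZ psection0.
rewrite (_ : (fun a => F a *: Z a + 0) = (fun a => F a *: Z a)) //.
by apply: functional_extensionality_dep => a; rewrite addr0.
Qed.

Lemma psectionD (Z1 Z2 : forall a, ambient a) :
  psection Z1 -> psection Z2 -> psection (A := A) (fun a => Z1 a + Z2 a).
Proof.
move=> p1 p2; have := psection_lin (@smooth_cst _ _ _ AE 1) p1 p2.
rewrite (_ : (fun a => 1 *: Z1 a + Z2 a) = (fun a => Z1 a + Z2 a)) //.
by apply: functional_extensionality_dep => a; rewrite scale1r.
Qed.


Lemma psection_sum (I : Type) (s : seq I) (Z : I -> forall a : TA, ambient a) :
  (forall i, psection (Z i)) -> psection (A := A) (fun a => \sum_(i <- s) Z i a).
Proof.
move=> pZ; elim: s => [|i s IHs].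
  rewrite (_ : (fun a => _) = (fun a : TA => 0 : ambient a)); first exact: psection0.
  by apply: functional_extensionality_dep => a; rewrite big_nil.
rewrite (_ : (fun a => _) = (fun a => Z i a + \sum_(j <- s) Z j a)); first exact: psectionD.
by apply: functional_extensionality_dep => a; rewrite big_cons.
Qed.

Lemma vert_endo_linear (a : TA) k (u v : ambient a) :
  vert_endo (k *: u + v) = k *: vert_endo u + vert_endo v.
Proof.
apply: ambient_ext => [|F]; first by rewrite ambientD1 ambientZ1 /= scaler0 addr0.
exact: (congr1 (fun f => f F) (vlift_linear k u.1 v.1)).
Qed.

Lemma vert_endo_sum (a : TA) (I : Type) (s : seq I) (k : I -> R) (u : I -> ambient a) :
  vert_endo (\sum_(i <- s) k i *: u i) = \sum_(i <- s) k i *: vert_endo (u i).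
Proof.
elim: s => [|i s IHs]; last by rewrite !big_cons vert_endo_linear IHs.
by rewrite !big_nil /vert_endo ambient01 vlift0.
Qed.

Lemma prolong_vert_endo (a : TA) (u : ambient a) : prolong (vert_endo u).
Proof.
split=> [|f sf]; first exact: vlift_tangent.
by rewrite /= lanchor0 vlift_pull.
Qed.

Lemma psection_vlift (b : forall a : TA, A (bproj a)) :
  (forall t, btriv t -> forall i,
    smooth_in AE [set a | tdom t (bproj a)] (fun a => tcoord t (b a) 0 i)) ->
  psection (A := A) (fun a => (0, vlift (b a))).
Proof.
have SA := total_smooth_atlas A.
move=> sb; split=> [a|t' bt' i|F sF].
- exact: (prolong_vert_endo ((b a, 0) : ambient a)).
- apply: (smooth_in_eq SA _ (_ : forall a, _ -> (fun=> 0) a = _) (@smooth_in_cst _ _ _ _ _ 0)).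
    exact: pull_aopen (tdom_open bt').
  by move=> a ta; rewrite /= tcoord0// mxE.
- exact: smooth_vlift.
Qed.

Lemma psection_vert_endo (Z : forall a : TA, ambient a) :
  psection Z -> psection (fun a => vert_endo (Z a)).
Proof. by move=> [_ sZ _]; apply: (psection_vlift (b := fun a => (Z a).1)). Qed.

Lemma psection_vert_endo_section (s : forall x, A x) : smooth_section s ->
  psection (A := A) (fun a => (0, vlift (s (bproj a)))).
Proof.
move=> ss; apply: (psection_vlift (b := fun a => s (bproj a))) => t bt' i.
exact: (smooth_in_pull (tdom_open bt') (ss t bt' i)).
Qed.

(** * A local frame of the prolongation, cut off to global sections *)

Section LocalFrame.
Variables (c : chart R M m) (t : trivialization A r).
Variables (D1 D2 : set M) (chi1 chi2 : M -> R).
Hypotheses (ac : AM c) (bt : btriv t) (oD1 : open D1) (oD2 : open D2).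
Let W := cdom c `&` tdom t.
Hypotheses (cut1 : is_cutoff AM W D1 chi1) (cut2 : is_cutoff AM D1 D2 chi2).
Local Notation d := (total_chart c t).

Let SA : smooth_atlas AE := total_smooth_atlas A.
Let SM : smooth_atlas AM := manifold_smooth_atlas M.

Let oW : open W.
Proof. by apply: openI; [have [] := manifold_chart ac|exact: tdom_open]. Qed.

Let D1W : D1 `<=` W. Proof. exact: cutoff_sub cut1. Qed.

Definition base_coord (i : 'I_m) : M -> R :=
  extend0 W (fun x => chi1 x * cphi c x 0 i).

Definition fiber_coord (j : 'I_r) : TA -> R :=
  extend0 [set a | W (bproj a)] (fun a => chi1 (bproj a) * tcoord t (projT2 a) 0 j).

(** Two nested cutoffs are used: [chi1] globalizes the coordinates and leaves them exact on [D1],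
    while [chi2] vanishes outside [D1]. Wherever this section is nonzero, [base_coord] and
    [fiber_coord] are therefore the actual coordinates. *)
Definition frame_section (l : 'I_r) (x : M) : A x :=
  if `[< W x >] then chi2 x *: tvec t x 'e_l else 0.

(** The lift of the anchor of [b] by the flat connection of the trivialization: it has the base
    components of [lanchor b] and no fiber components. The value 0 on nonsmooth functions is the
    convention of [tangent]. *)
Definition horizontal_lift (a : TA) (b : A (bproj a)) : (TA -> R) -> R := fun F =>
  if `[< CA F >] then \sum_i lanchor b (base_coord i) *
    'D_'e_(lshift r i) (F \o cpsi d) (cphi d a) else 0.

Definition frame_lift (l : 'I_r) (a : TA) : ambient a :=
  (frame_section l (bproj a), horizontal_lift (frame_section l (bproj a))).

Lemma smooth_base_coord i : smooth AM (base_coord i).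
Proof.
apply: (smooth_cutoff SM _ cut1); first exact/aopenP.
by apply: (smooth_in_coord SM) => // x [].
Qed.

Lemma base_coordE i x : D1 x -> base_coord i x = cphi c x 0 i.
Proof.
move=> D1x; rewrite /base_coord extend0_in; last exact: D1W.
by have [_ _ -> // _] := cut1; rewrite mul1r.
Qed.

Lemma smooth_fiber_coord j : CA (fiber_coord j).
Proof.
apply: (smooth_cutoff SA _ (pull_cutoff A cut1)); first exact: pull_aopen.
by apply: smooth_in_sub (smooth_in_fiber_coord j bt) => a [].
Qed.

Lemma fiber_coordE j a : D1 (bproj a) -> fiber_coord j a = tcoord t (projT2 a) 0 j.
Proof.
move=> D1a; rewrite /fiber_coord extend0_in; last exact: D1W.
by have [_ _ -> // _] := cut1; rewrite mul1r.
Qed.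

Lemma frame_section_in l x : W x -> frame_section l x = chi2 x *: tvec t x 'e_l.
Proof. by move=> Wx; rewrite /frame_section asboolT. Qed.

Lemma frame_section_out l x : ~ D1 x -> frame_section l x = 0.
Proof.
move=> D1x; rewrite /frame_section; case: asboolP => // Wx.
by rewrite (cutoff_out cut2 D1x) scale0r.
Qed.

Lemma smooth_frame_section l : smooth_section (frame_section l).
Proof.
move=> t' bt' i; have [sc2 _ c21 [K [KD1 aK c20]]] := cut2.
have ot' := tdom_open bt'; have ot := tdom_open bt.
apply: (smooth_in_local SM) => x t'x; have [Wx|Wx] := pselect (W x).
  exists (tdom t' `&` W), (fun x => chi2 x * tcoord t' (tvec t x 'e_l) 0 i).
  have oI : aopen AM (tdom t' `&` W) by apply/aopenP; exact: openI.
  split=> //.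
    apply: smooth_in_mul => //; first exact: smooth_in_sub sc2.
    by apply: smooth_in_sub (bundle_compat bt bt' l i) => y [? []].
  by move=> y [t'y Wy]; rewrite frame_section_in// tcoordZ// mxE.
exists (tdom t' `&` ~` K), (fun=> 0); split.
- by apply/aopenP; apply: openI => //; exact/aopenP.
- by split=> // Kx; apply: Wx; exact/D1W/KD1.
- exact: smooth_in_cst.
- move=> y [t'y Ky]; rewrite /frame_section; case: asboolP => Wy.
    by rewrite c20// scale0r tcoord0// mxE.
  by rewrite tcoord0// mxE.
Qed.

Lemma chart_derivable F a j : CA F -> W (bproj a) ->
  derivable (F \o cpsi d) (cphi d a) 'e_j.
Proof.
move=> sF Wa; have ad := total_atlasP ac bt.
have := sF _ ad; rewrite setIT => sFd.
by apply: smooth_on_derivable sFd _; exists a.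
Qed.

Lemma derive_lin n (f g : 'rV[R]_n -> R) k (x v : 'rV[R]_n) :
  derivable f x v -> derivable g x v ->
  'D_v (fun z => k * f z + g z) x = k * 'D_v f x + 'D_v g x.
Proof.
move=> df dg.
have dkf : derivable (k *: f) x v by exact: derivableZ.
by have := deriveD dkf dg; rewrite deriveZ.
Qed.

Lemma derive_mul n (f g : 'rV[R]_n -> R) (x v : 'rV[R]_n) :
  derivable f x v -> derivable g x v ->
  'D_v (fun z => f z * g z) x = 'D_v f x * g x + f x * 'D_v g x.
Proof.
move=> df dg; have := deriveM df dg => ->.
by rewrite addrC [_ *: 'D_v f x]mulrC.
Qed.

Lemma horizontal_lift_tangent a (b : A (bproj a)) : W (bproj a) ->
  tangent CA a (horizontal_lift b).
Proof.
move=> Wa; have aE (F : TA -> R) : (F \o cpsi d) (cphi d a) = F a.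
  by rewrite [LHS]/comp (chartK SA (total_atlasP ac bt)).
rewrite /horizontal_lift; split=> [F sF|k F G sF sG|F G sF sG]; first by rewrite asboolF.
- have skF : CA (fun a => k * F a) by apply: smooth_mul => //; exact: smooth_cst.
  rewrite !asboolT//; last exact: (smooth_add SA).
  rewrite mulr_sumr -big_split /=; apply: eq_bigr => i _.
  have dF := @chart_derivable F a (lshift r i) sF Wa.
  have dG := @chart_derivable G a (lshift r i) sG Wa.
  have H := derive_lin k dF dG; rewrite [X in _ * X = _]H.
  by move: (derive _ _ _) (derive _ _ _) (lanchor _ _) => p q s; ring.
- rewrite !asboolT//; last exact: (smooth_mul SA).
  rewrite mulr_sumr mulr_suml -big_split /=; apply: eq_bigr => i _.
  have dF := @chart_derivable F a (lshift r i) sF Wa.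
  have dG := @chart_derivable G a (lshift r i) sG Wa.
  have H := derive_mul dF dG; rewrite [X in _ * X = _]H !aE.
  by move: (derive _ _ _) (derive _ _ _) (lanchor _ _) => p q s; ring.
Qed.

Lemma horizontal_liftE a (b : A (bproj a)) F : CA F -> horizontal_lift b F =
  \sum_i lanchor b (base_coord i) * 'D_'e_(lshift r i) (F \o cpsi d) (cphi d a).
Proof. by move=> sF; rewrite /horizontal_lift asboolT. Qed.

Lemma horizontal_lift0 a : horizontal_lift (0 : A (bproj a)) = 0.
Proof.
apply/funext => F; rewrite /horizontal_lift; case: asboolP => // _.
by rewrite big1// => i _; rewrite lanchor0 mul0r.
Qed.

Lemma psection_frame_lift l : psection (frame_lift l).
Proof.
have ss := smooth_frame_section l.
split=> [a|t' bt' i|F sF].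
- split=> [|f sf] /=; have [D1a|D1a] := pselect (D1 (bproj a)).
  + by apply: horizontal_lift_tangent; exact: D1W.
  + by rewrite frame_section_out// horizontal_lift0; exact: tangent_zero.
  + have [ca ta] := D1W D1a.
    rewrite horizontal_liftE; last exact: smooth_pull.
    have tv := @anchor_tangent _ _ _ _ A (bproj a) (frame_section l (bproj a)).
    rewrite (manifold_tangentE ac ca oD1 D1a smooth_base_coord _ tv sf) => [|i y _ D1y].
      by apply: eq_bigr => i _; rewrite (@partial_pull _ _ _ _ A f c t _ _ _ ac ca).
    exact: base_coordE.
  + by rewrite frame_section_out// horizontal_lift0 lanchor0.
- exact: (smooth_in_pull (tdom_open bt') (ss t' bt' i)).
- have [sc2 _ c21 [K [KD1 aK c20]]] := cut2.
  pose h a := \sum_i lanchor (frame_section l (bproj a)) (base_coord i) *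
    'D_'e_(lshift r i) (F \o cpsi d) (cphi d a).
  have aD1 : aopen AE [set a : TA | D1 (bproj a)] by exact: pull_aopen.
  have D1d : [set a : TA | D1 (bproj a)] `<=` cdom d by move=> a /D1W.
  rewrite (_ : (fun a => _) = extend0 [set a : TA | D1 (bproj a)] h).
    have aK' : aopen AE (~` [set a : TA | K (bproj a)]).
      by apply: (@pull_aopen _ _ _ _ A (~` K)); exact/aopenP.
    apply: (smooth_extend0 SA aD1 aK').
    + by move=> a /KD1.
    + apply: smooth_in_sum => // i; apply: smooth_in_mul => //.
        exact: smooth_in_sub (smooth_pull (E := A) (anchor_smooth ss (smooth_base_coord i))).
      apply: (smooth_in_partial SA _ (total_atlasP ac bt)) => //.
      exact: smooth_in_sub sF.
    + move=> a D1a Ka; rewrite /h big1// => i _.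
      by rewrite frame_section_in ?c20 ?scale0r ?lanchor0 ?mul0r//; exact: D1W.
  apply/funext => a /=; have [D1a|D1a] := pselect (D1 (bproj a)).
    by rewrite extend0_in// horizontal_liftE.
  by rewrite extend0_out// frame_section_out// horizontal_lift0.
Qed.

(** Membership in the prolongation forces the base components of [w.2] to be those of the anchor of
    [w.1], which the lifts already supply. Only the fiber components remain, and they are vertical
    lifts. The factor [chi2] is the one built into the frame. *)
Lemma frame_decomposition a (w : ambient a) : prolong w -> D1 (bproj a) ->
  chi2 (bproj a) *: w = \sum_l tcoord t w.1 0 l *: frame_lift l a +
    \sum_j w.2 (fiber_coord j) *: vert_endo (frame_lift j a).
Proof.
move=> [tw pw] D1a; have Wa := D1W D1a; have [ca ta] := Wa.
apply: ambient_ext => [|F].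
  rewrite ambientD1 !ambient_sum1 ambientZ1 [X in _ + X]big1 ?addr0 => [|j _]; last first.
    by rewrite ambientZ1 scaler0.
  rewrite -[in LHS](tcoordK w.1 bt ta) tvec_sum// scaler_sumr.
  apply: eq_bigr => l _; rewrite ambientZ1 /= frame_section_in//.
  by rewrite !scalerA mulrC.
rewrite ambientD2 !ambient_sum2 ambientZ2.
have [sF|sF] := pselect (CA F); last first.
  have [w0 _ _] := tw; rewrite w0// mulr0 !big1 ?addr0// => j _; rewrite ambientZ2 /=.
    by rewrite vlift_nonsmooth// mulr0.
  by rewrite /horizontal_lift asboolF// mulr0.
rewrite (total_tangentE (xi := fun i a => base_coord i (bproj a)) (eta := fiber_coord) ac bt oD1 D1a D1W _ _ _ _ tw sF); first last.
- by move=> j a'; exact: fiber_coordE.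
- by move=> i a'; exact: base_coordE.
- exact: smooth_fiber_coord.
- by move=> i; apply: smooth_pull; exact: smooth_base_coord.
rewrite mulrDr; congr (_ + _).
  rewrite mulr_sumr (eq_bigr (fun l => \sum_i tcoord t w.1 0 l *
      (chi2 (bproj a) * (lanchor (tvec t (bproj a) 'e_l) (base_coord i) *
        'D_'e_(lshift r i) (F \o cpsi d) (cphi d a))))) => [|l _]; last first.
    rewrite ambientZ2; have -> : (frame_lift l a).2 F = horizontal_lift (frame_section l (bproj a)) F by [].
    rewrite horizontal_liftE// mulr_sumr; apply: eq_bigr => i _.
    by rewrite frame_section_in// lanchorZ -mulrA.
  rewrite exchange_big /=; apply: eq_bigr => i _.
  rewrite -pw; last exact: smooth_base_coord.
  rewrite -[in LHS](tcoordK w.1 bt ta) tvec_sum// lanchor_sum mulr_suml mulr_sumr.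
  by apply: eq_bigr => l _; ring.
rewrite mulr_sumr; apply: eq_bigr => j _; rewrite ambientZ2 /=.
rewrite frame_section_in// (vlift_sum _ sF bt ta) tcoordZ// tvecK//.
rewrite (bigD1 j)//= big1 => [|i ij]; last first.
  by rewrite !mxE (negPf ij) andbF mulr0 mul0r.
rewrite !mxE !eqxx mulr1 addr0 (partial_fiber_fun F t _ j ac ca).
by rewrite mulrCA.
Qed.

Definition frame_coef (Z : forall a, ambient a) (l : 'I_r) : TA -> R :=
  extend0 [set a | W (bproj a)] (fun a => chi1 (bproj a) * tcoord t (Z a).1 0 l).

Lemma smooth_frame_coef Z l : psection Z -> CA (frame_coef Z l).
Proof.
move=> [_ sZ _]; apply: (smooth_cutoff SA _ (pull_cutoff A cut1)); first exact: pull_aopen.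
by apply: smooth_in_sub (sZ t bt l) => a [].
Qed.

(** The identity holds at every point because both sides vanish outside [D1]; cutting the
    coefficients off by [chi1] makes them smooth without affecting it. *)
Lemma frame_section_decomposition (Z : forall a, ambient a) a : psection Z ->
  chi2 (bproj a) *: Z a = \sum_l frame_coef Z l a *: frame_lift l a +
    \sum_j (Z a).2 (fiber_coord j) *: vert_endo (frame_lift j a).
Proof.
move=> pZ; have [D1a|D1a] := pselect (D1 (bproj a)).
  have [pa _ _] := pZ; apply: etrans (frame_decomposition (pa a) D1a) _; congr (_ + _).
  apply: eq_bigr => l _; congr (_ *: _).
  rewrite /frame_coef extend0_in; last exact: D1W.
  by have [_ _ -> // _] := cut1; rewrite mul1r.
have E0 l : frame_lift l a = 0.
  apply: ambient_ext => [|F]; first by rewrite /= frame_section_out.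
  by rewrite /= frame_section_out// horizontal_lift0.
rewrite (cutoff_out cut2 D1a) scale0r !big1 ?addr0// => l _; rewrite E0.
  by rewrite /vert_endo ambient01 vlift0; exact: scaler0.
exact: scaler0.
Qed.

Lemma frame_coef0 (Z : forall a, ambient a) l a : Z a = 0 -> frame_coef Z l a = 0.
Proof.
move=> Za; rewrite /frame_coef; have [[ca ta]|Wa] := pselect (W (bproj a)).
  by rewrite extend0_in// Za ambient01 tcoord0// mxE mulr0.
by rewrite extend0_out.
Qed.

End LocalFrame.

End Prolongation.

(** * Extension of vectors to sections, and tensoriality *)

Section Sections.
Variables (R : realType) (m r : nat) (M : manifold R m) (A : lieAlgebroid M r).
Local Notation AM := (matlas M).
Local Notation AE := (total_atlas A).
Local Notation TA := (total_space A).
Local Notation CA := (smooth AE).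
Implicit Types (Z : forall a : TA, ambient a).

(** The third clause expands vectors near [x0]. The fourth expands sections everywhere, with smooth
    coefficients, at the price of a factor [chi]; an operator on sections can only be applied to an
    identity of this global kind. *)
Lemma local_frame t (x0 : M) : btriv t -> tdom t x0 ->
  exists (chi : M -> R) (s : 'I_r -> forall x, A x) (E : 'I_r -> forall a : TA, ambient a)
    (mu : 'I_r -> TA -> R) (D : set M),
  [/\ [/\ open D, D x0, D `<=` tdom t, smooth AM chi & forall x, D x -> chi x = 1],
      [/\ forall l, smooth_section (s l), forall l, psection (E l),
          forall l, psection (fun a => vert_endo (E l a)),
          forall l a, (E l a).1 = s l (bproj a) &
          forall l x, D x -> s l x = tvec t x 'e_l],
      forall a (w : ambient a), prolong w -> D (bproj a) ->
        w = \sum_l tcoord t w.1 0 l *: E l a + \sum_j w.2 (mu j) *: vert_endo (E j a) &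
      forall Z, psection Z -> exists lam : 'I_r -> TA -> R,
        [/\ forall l, CA (lam l), forall l, CA (fun a => (Z a).2 (mu l)),
            forall l a, Z a = 0 -> lam l a = 0 &
            forall a, chi (bproj a) *: Z a = \sum_l lam l a *: E l a +
              \sum_j (Z a).2 (mu j) *: vert_endo (E j a)]].
Proof.
move=> bt tx0; have [c ac cx0] := manifold_cover x0.
have oW : open (cdom c `&` tdom t).
  by apply: openI; [have [] := manifold_chart ac|exact: tdom_open].
have [D1 [chi1 [oD1 D1x cut1]]] := manifold_cutoff oW (conj cx0 tx0).
have [D2 [chi2 [oD2 D2x cut2]]] := manifold_cutoff oD1 D1x.
have D21 := cutoff_sub cut2; have D1W := cutoff_sub cut1.
have [sc2 _ c21 _] := cut2.
exists chi2, (frame_section c t chi2), (frame_lift c t chi1 chi2), (fiber_coord c t chi1), D2.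
split.
- by split=> // x /D21/D1W[].
- split.
  + by move=> l; apply: (smooth_frame_section ac bt cut1 cut2).
  + by move=> l; exact: (psection_frame_lift ac bt oD1 cut1 cut2).
  + move=> l; have ss : smooth_section (frame_section c t chi2 l).
      by apply: (smooth_frame_section ac bt cut1 cut2).
    exact: (psection_vert_endo_section ss).
  + by [].
  + move=> l x D2x'; rewrite frame_section_in ?c21 ?scale1r//.
    exact/D1W/D21.
- move=> a w pw D2a; rewrite -[LHS]scale1r -(c21 _ D2a).
  exact: (frame_decomposition chi2 ac bt oD1 cut1 pw (D21 _ D2a)).
- move=> Z pZ; exists (frame_coef c t chi1 Z); split.
  + by move=> l; exact: (smooth_frame_coef ac bt cut1).
  + move=> l; have [_ _ sZ] := pZ; apply: sZ.
    exact: (smooth_fiber_coord ac bt cut1).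
  + by move=> l a; exact: frame_coef0.
  + by move=> a; exact: (frame_section_decomposition ac bt oD1 cut1 cut2).
Qed.

Lemma smooth_section_sum (I : Type) (e : seq I) (k : I -> R) (s : I -> forall x, A x) :
  (forall i, smooth_section (s i)) -> smooth_section (fun x => \sum_(i <- e) k i *: s i x).
Proof.
move=> ss t bt j; have SM := manifold_smooth_atlas M.
have ot : aopen AM (tdom t) by apply/aopenP; exact: tdom_open.
apply: (@smooth_in_eq _ _ _ _ SM _ (fun x => \sum_(i <- e) k i * tcoord t (s i x) 0 j)) => //.
  move=> x tx; rewrite tcoord_sum// summxE; apply: eq_bigr => i _.
  by rewrite tcoordZ// mxE.
apply: smooth_in_sum => // i; apply: smooth_in_mul => //; first exact: smooth_in_cst.
exact: ss.
Qed.

Lemma psection_sum_cst (I : Type) (e : seq I) (k : I -> R) (Z : I -> forall a : TA, ambient a) :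
  (forall i, psection (Z i)) -> psection (A := A) (fun a => \sum_(i <- e) k i *: Z i a).
Proof.
move=> pZ; apply: (@psection_sum _ _ _ _ A I e (fun i a => k i *: Z i a)) => i.
by apply: (@psectionZ _ _ _ _ A (fun=> k i)) => //; exact: smooth_cst.
Qed.

(** Combine the frame with the constant coefficients of [w]: the frame is projectable and constant
    coefficients keep the result so, which makes the explicit bracket formula available. *)
Lemma psection_through (a : TA) (w : ambient a) : prolong w ->
  exists Z (s : forall x, A x), [/\ psection Z, smooth_section s,
    forall a', (Z a').1 = s (bproj a') & Z a = w].
Proof.
move=> pw; have [t bt ta] := bundle_cover A (bproj a).
have [chi [s [E [mu [D [[oD Da Dt _ _] [ss pE pJ E1 _] dec _]]]]]] := local_frame bt ta.
exists (fun a' => \sum_l tcoord t w.1 0 l *: E l a' + \sum_j w.2 (mu j) *: vert_endo (E j a')).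
exists (fun x => \sum_l tcoord t w.1 0 l *: s l x); split.
- by apply: psectionD; apply: psection_sum_cst.
- exact: smooth_section_sum.
- move=> a'; rewrite ambientD1 !ambient_sum1 [X in _ + X]big1 ?addr0 => [|j _]; last first.
    by rewrite ambientZ1 scaler0.
  by apply: eq_bigr => l _; rewrite ambientZ1 E1.
- by rewrite -dec.
Qed.

Lemma prolong_lift (a : TA) (b : A (bproj a)) : exists2 w : ambient a, prolong w & w.1 = b.
Proof.
have [t bt ta] := bundle_cover A (bproj a).
have [chi [s [E [mu [D [[oD Da Dt _ _] [ss pE pJ E1 sE] dec _]]]]]] := local_frame bt ta.
exists (\sum_l tcoord t b 0 l *: E l a).
  by apply: prolong_sum => l; apply: prolongZ; have [] := pE l.
rewrite ambient_sum1 -[RHS](tcoordK b bt ta) tvec_sum//.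
by apply: eq_bigr => l _; rewrite ambientZ1 E1 sE.
Qed.

(** With [w.1 = 0] only the vertical half of the frame expansion survives, and that half is an image
    of [vert_endo]. *)
Lemma vert_vert_endo (a : TA) (w : ambient a) : vert w ->
  exists2 w' : ambient a, prolong w' & w = vert_endo w'.
Proof.
move=> [pw w0]; have [t bt ta] := bundle_cover A (bproj a).
have [chi [s [E [mu [D [[oD Da Dt _ _] [ss pE pJ E1 sE] dec _]]]]]] := local_frame bt ta.
exists (\sum_j w.2 (mu j) *: E j a).
  by apply: prolong_sum => l; apply: prolongZ; have [] := pE l.
rewrite vert_endo_sum [LHS](dec _ _ pw Da) [X in X + _]big1 ?add0r// => l _.
by rewrite w0 tcoord0// mxE scale0r.
Qed.

Lemma tensor_sum (T : (forall a : TA, ambient a) -> R) (a : TA) (I : Type) (e : seq I)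
    (F : I -> TA -> R) (Z : I -> forall a : TA, ambient a) :
  (forall F Z1 Z2, CA F -> psection Z1 -> psection Z2 ->
    T (fun a => F a *: Z1 a + Z2 a) = F a * T Z1 + T Z2) ->
  (forall i, CA (F i)) -> (forall i, psection (Z i)) ->
  T (fun a => \sum_(i <- e) F i a *: Z i a) = \sum_(i <- e) F i a * T (Z i).
Proof.
move=> lin sF pZ; elim: e => [|i e IHe].
  rewrite big_nil; set Z0 := fun _ => _.
  have Z0E : Z0 = (fun a => 0) by apply: functional_extensionality_dep => b; rewrite /Z0 big_nil.
  have := lin (fun=> 1) _ _ (@smooth_cst _ _ _ AE 1) (psection0 A) (psection0 A).
  rewrite (_ : (fun a => 1 *: 0 + 0) = (fun a : TA => 0 : ambient a)); last first.
    by apply: functional_extensionality_dep => b; rewrite scaler0 addr0.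
  by rewrite Z0E mul1r => /eqP; rewrite -{1}[T _]addr0 => /eqP/addrI <-.
rewrite big_cons -IHe -lin//.
  by congr T; apply: functional_extensionality_dep => b; rewrite big_cons.
apply: psection_sum => j; exact: psectionZ.
Qed.

(** Write [Z] as [(1 - chi) Z + chi Z]. The first coefficient vanishes at [a]; the second summand is
    a combination of frame sections whose coefficients vanish at [a] because [Z] does. *)
Lemma tensor_vanish (T : (forall a : TA, ambient a) -> R) (a : TA) :
  (forall F Z1 Z2, CA F -> psection Z1 -> psection Z2 ->
    T (fun a => F a *: Z1 a + Z2 a) = F a * T Z1 + T Z2) ->
  forall Z, psection Z -> Z a = 0 -> T Z = 0.
Proof.
move=> lin Z pZ Za; have [t bt ta] := bundle_cover A (bproj a).
have [chi [s [E [mu [D [[oD Da Dt sc c1] [ss pE pJ E1 _] _ dec]]]]]] := local_frame bt ta.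
have [lam [slam smu lam0 dZ]] := dec Z pZ.
have SA := total_smooth_atlas A.
have -> : Z = (fun b => (1 - chi (bproj b)) *: Z b +
    (1 *: (\sum_l lam l b *: E l b) + \sum_j (Z b).2 (mu j) *: vert_endo (E j b))).
  apply: functional_extensionality_dep => b.
  by rewrite scale1r -dZ scalerBl scale1r subrK.
have p1 : psection (A := A) (fun b => \sum_l lam l b *: E l b).
  by apply: (@psection_sum _ _ _ _ A _ _ (fun l b => lam l b *: E l b)) => l; exact: psectionZ.
have p2 : psection (A := A) (fun b => \sum_j (Z b).2 (mu j) *: vert_endo (E j b)).
  by apply: (@psection_sum _ _ _ _ A _ _ (fun j b => (Z b).2 (mu j) *: vert_endo (E j b))) => l; exact: psectionZ.
rewrite (lin (fun b => 1 - chi (bproj b)))//; first last.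
- by apply: (psection_lin (F := fun=> 1)) => //; exact: smooth_cst.
- by apply: smooth_sub => //; [exact: smooth_cst|exact: smooth_pull].
rewrite c1// subrr mul0r add0r (lin (fun=> 1))//; last exact: smooth_cst.
rewrite (tensor_sum _ lin slam pE) (tensor_sum _ lin smu pJ).
rewrite !big1 ?mulr0 ?addr0// => l _; first by rewrite Za ambient02 mul0r.
by rewrite lam0// mul0r.
Qed.

Lemma tensor_pointwise (T : (forall a : TA, ambient a) -> R) (a : TA) :
  (forall F Z1 Z2, CA F -> psection Z1 -> psection Z2 ->
    T (fun a => F a *: Z1 a + Z2 a) = F a * T Z1 + T Z2) ->
  forall Z1 Z2, psection Z1 -> psection Z2 -> Z1 a = Z2 a -> T Z1 = T Z2.
Proof.
move=> lin Z1 Z2 p1 p2 Z12.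
have p3 : psection (A := A) (fun b => -1 *: Z2 b + Z1 b).
  by apply: (psection_lin (F := fun=> -1)) => //; exact: smooth_cst.
have : T (fun b => -1 *: Z2 b + Z1 b) = 0.
  by apply: (tensor_vanish lin p3); rewrite Z12 scaleN1r addNr.
rewrite (lin (fun=> -1))//; last exact: smooth_cst.
by rewrite mulN1r addrC => /eqP; rewrite subr_eq0 => /eqP.
Qed.

End Sections.

(** * The differential on the prolongation *)

Section LieRinehart.
Variables (R : realType) (m r : nat) (M : manifold R m) (A : lieAlgebroid M r).
Local Notation AM := (matlas M).
Local Notation AE := (total_atlas A).
Local Notation TA := (total_space A).
Local Notation CA := (smooth AE).
Implicit Types (Z : forall a : TA, ambient a) (F : TA -> R).
Variable br : (forall a : TA, ambient a) -> (forall a : TA, ambient a) -> forall a : TA, ambient a.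
Hypothesis hbr : is_prolongation_bracket br.

Let hlie : is_lie_bracket CA (@psection _ _ _ _ A) (@panchor _ _ _ _ A) br := hbr.1.
Let SA : smooth_atlas AE := total_smooth_atlas A.

Lemma psection_tangent Z a : psection Z -> tangent CA a (Z a).2.
Proof. by move=> [/(_ a)[]]. Qed.

Lemma psection_smooth Z F : psection Z -> CA F -> CA (fun a => (Z a).2 F).
Proof. by move=> [_ _]; exact. Qed.

Lemma br_psection Z1 Z2 : psection Z1 -> psection Z2 -> psection (br Z1 Z2).
Proof. exact: (lie_closed hlie). Qed.

Lemma br_antisym Z1 Z2 : psection Z1 -> psection Z2 -> br Z1 Z2 = (fun a => - br Z2 Z1 a).
Proof. by move=> p1 p2; apply: functional_extensionality_dep => a; exact: (lie_anti hlie). Qed.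

Lemma br_linr k Z Z1 Z2 a : psection Z -> psection Z1 -> psection Z2 ->
  br Z (fun b => k *: Z1 b + Z2 b) a = k *: br Z Z1 a + br Z Z2 a.
Proof.
move=> pZ p1 p2.
have p12 : psection (A := A) (fun b => k *: Z1 b + Z2 b).
  by apply: (psection_lin (F := fun=> k)) => //; exact: smooth_cst.
rewrite (br_antisym pZ p12) (br_antisym pZ p1) (br_antisym pZ p2).
by rewrite (lie_linear hlie k p1 p2 pZ) opprD scalerN.
Qed.

Lemma br_addr Z Z1 Z2 a : psection Z -> psection Z1 -> psection Z2 ->
  br Z (fun b => Z1 b + Z2 b) a = br Z Z1 a + br Z Z2 a.
Proof.
move=> pZ p1 p2; rewrite -[br Z Z1 a]scale1r -br_linr//; congr (br Z _ a).
by apply: functional_extensionality_dep => b; rewrite scale1r.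
Qed.

Lemma br0r Z a : psection Z -> br Z (fun=> 0) a = 0.
Proof.
move=> pZ; have := br_addr a pZ (psection0 A) (psection0 A).
rewrite (_ : (fun b : TA => 0 + 0) = (fun b : TA => 0 : ambient b)); last first.
  by apply: functional_extensionality_dep => b; rewrite addr0.
by move/eqP; rewrite -{1}[br _ _ a]addr0 => /eqP/addrI <-.
Qed.

Lemma br_oppr Z Z1 a : psection Z -> psection Z1 -> br Z (fun b => - Z1 b) a = - br Z Z1 a.
Proof.
move=> pZ p1; rewrite -scaleN1r -[RHS]addr0 -(br0r a pZ) -br_linr//; last exact: psection0.
congr (br Z _ a); apply: functional_extensionality_dep => b.
by rewrite scaleN1r addr0.
Qed.

Lemma br_leibnizr F Z Z1 : psection Z -> psection Z1 -> CA F ->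
  br Z (fun b => F b *: Z1 b) = (fun b => F b *: br Z Z1 b + (Z b).2 F *: Z1 b).
Proof.
move=> pZ p1 sF; apply: functional_extensionality_dep => a.
exact: (lie_leibniz hlie pZ p1 sF).
Qed.

Lemma br_linl F Z Z1 Z2 a : CA F -> psection Z -> psection Z1 -> psection Z2 ->
  br (fun b => F b *: Z1 b + Z2 b) Z a =
  F a *: br Z1 Z a - (Z a).2 F *: Z1 a + br Z2 Z a.
Proof.
move=> sF pZ p1 p2; have pF1 := psectionZ sF p1.
rewrite (br_antisym (psectionD pF1 p2) pZ) (br_addr a pZ pF1 p2) (br_leibnizr pZ p1 sF).
by rewrite (br_antisym p1 pZ) (br_antisym p2 pZ) !opprD scalerN.
Qed.

(** The bookkeeping for the Jacobi identity of [Z1], [Z2] and [F Z3] expanded by the Leibniz rule.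
    Here [P], [Q], [S] are the iterated brackets, [u] and [v] the brackets of [Z2] and [Z1] with
    [Z3], and [z] is [Z3]; the first-order terms cancel and the defect of the anchor remains. *)
Lemma cancel_jacobi (V : lmodType R) (P Q S u v z : V) (F al be ga de ep : R) : P - Q - S = 0 ->
  F *: P + al *: u + (be *: v + ga *: z) -
  (F *: Q + be *: v + (al *: u + de *: z)) - (F *: S + ep *: z) = (ga - de - ep) *: z.
Proof.
move=> /eqP; rewrite subr_eq0 subr_eq => /eqP ->; rewrite !scalerBl scalerDr.
move: (F *: Q) (F *: S) (al *: u) (be *: v) (ga *: z) (de *: z) (ep *: z) => X Y a b c d e.
rewrite !opprD !addrA [Y + X]addrC.
(* The permutation places four terms next to their opposites and the three multiples of [z] last. *)
rewrite (ACl (1*6*2*10*3*8*4*7*5*9*11))%AC /=.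
by rewrite subrr add0r subrr add0r subrr add0r subrr add0r.
Qed.

Lemma br_jacobi Z1 Z2 Z3 a : psection Z1 -> psection Z2 -> psection Z3 ->
  br Z1 (br Z2 Z3) a - br Z2 (br Z1 Z3) a - br (br Z1 Z2) Z3 a = 0.
Proof.
move=> p1 p2 p3; rewrite -[RHS](lie_jacobi hlie p1 p2 p3 a).
rewrite (br_antisym p3 p1) br_oppr//; last exact: br_psection.
rewrite (br_antisym (br_psection p1 p2) p3) opprK.
by [].
Qed.

Lemma anchor_br_mul Z1 Z2 Z3 F a : psection Z1 -> psection Z2 -> psection Z3 -> CA F ->
  ((Z1 a).2 (fun b => (Z2 b).2 F) - (Z2 a).2 (fun b => (Z1 b).2 F) - (br Z1 Z2 a).2 F) *: Z3 a = 0.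
Proof.
move=> p1 p2 p3 sF.
have p12 := br_psection p1 p2; have p13 := br_psection p1 p3; have p23 := br_psection p2 p3.
have pF3 := psectionZ sF p3.
have := br_jacobi a p1 p2 pF3.
have s1 := psection_smooth p1 sF; have s2 := psection_smooth p2 sF.
rewrite (br_leibnizr p2 p3 sF) (br_leibnizr p1 p3 sF) (br_leibnizr p12 p3 sF).
rewrite (br_addr a p1 (psectionZ sF p23) (psectionZ s2 p3)).
rewrite (br_addr a p2 (psectionZ sF p13) (psectionZ s1 p3)).
rewrite (br_leibnizr p1 p23 sF) (br_leibnizr p1 p3 s2).
rewrite (br_leibnizr p2 p13 sF) (br_leibnizr p2 p3 s1).
by rewrite cancel_jacobi//; exact: br_jacobi.
Qed.

(* By the Jacobi identity the defect of the anchor as a bracket morphism kills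
   every section; if Z1, Z2 and their bracket all vanish at a, so does the defect. *)
Lemma anchor_br Z1 Z2 F a : psection Z1 -> psection Z2 -> CA F ->
  (br Z1 Z2 a).2 F = (Z1 a).2 (fun b => (Z2 b).2 F) - (Z2 a).2 (fun b => (Z1 b).2 F).
Proof.
move=> p1 p2 sF; have p12 := br_psection p1 p2.
apply/esym/eqP; rewrite -subr_eq0; apply/eqP.
set k := (X in X = 0); have kill Z3 : psection Z3 -> k *: Z3 a = 0.
  by move=> p3; exact: anchor_br_mul.
have [//|k0] := eqVneq k 0; exfalso.
have Z0 Z3 : psection Z3 -> Z3 a = 0.
  by move=> /kill/eqP; rewrite scaler_eq0 (negPf k0) => /eqP.
by move/eqP: k0; apply; rewrite /k (Z0 _ p1) (Z0 _ p2) (Z0 _ p12) !ambient02 !subr0.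
Qed.

Definition form1 (th : forall a : TA, ambient a -> R) :=
  (forall a k u v, @prolong _ _ _ _ A a u -> prolong v -> th a (k *: u + v) = k * th a u + th a v) /\
  (forall Z, psection Z -> CA (fun a => th a (Z a))).

Section Form1.
Variable th : forall a : TA, ambient a -> R.
Hypothesis hth : form1 th.

Let prs Z a : psection Z -> prolong (Z a). Proof. by case. Qed.

Lemma form1_0 a : th (0 : ambient a) = 0.
Proof.
have [lin _] := hth; have := lin a 1 0 0 (@prolong0 _ _ _ _ A a) (@prolong0 _ _ _ _ A a).
rewrite scaler0 addr0 mul1r => /eqP.
by rewrite -{1}[th 0]addr0 => /eqP/addrI <-.
Qed.

Lemma form1Z a k (u : ambient a) : prolong u -> th (k *: u) = k * th u.
Proof.
move=> pu; have [lin _] := hth; rewrite -[k *: u]addr0 lin//; last exact: prolong0.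
by rewrite form1_0 addr0.
Qed.

Lemma form1D a (u v : ambient a) : prolong u -> prolong v -> th (u + v) = th u + th v.
Proof.
by move=> pu pv; have [lin _] := hth; rewrite -[u in LHS]scale1r lin// mul1r.
Qed.

Lemma form1N a (u : ambient a) : prolong u -> th (- u) = - th u.
Proof. by move=> pu; rewrite -scaleN1r form1Z// mulN1r. Qed.

Lemma prolongN (a : TA) (u : ambient a) : prolong u -> prolong (- u).
Proof. by move=> pu; rewrite -scaleN1r; exact: prolongZ. Qed.

Local Notation d1 := (liealg_d1 (@panchor _ _ _ _ A) br th).

Lemma d1_smooth Z1 Z2 : psection Z1 -> psection Z2 -> CA (d1 Z1 Z2).
Proof.
move=> p1 p2; have [_ sth] := hth; rewrite /liealg_d1 /panchor.
apply: (smooth_sub SA); last exact/sth/br_psection.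
apply: (smooth_sub SA); first by apply: psection_smooth => //; exact: sth.
by apply: psection_smooth => //; exact: sth.
Qed.

Lemma d1_antisym Z1 Z2 a : psection Z1 -> psection Z2 -> d1 Z1 Z2 a = - d1 Z2 Z1 a.
Proof.
move=> p1 p2; rewrite /liealg_d1 (br_antisym p1 p2) form1N; last exact/prs/br_psection.
by rewrite !opprB opprK addrC addrA addrAC.
Qed.

(** The derivative of [F] along [Z2] appears twice, from the anchor term and from the Leibniz rule
    of the bracket, with opposite signs. *)
Lemma d1_linl F Z1 Z1' Z2 a : CA F -> psection Z1 -> psection Z1' -> psection Z2 ->
  d1 (fun b => F b *: Z1 b + Z1' b) Z2 a = F a * d1 Z1 Z2 a + d1 Z1' Z2 a.
Proof.
move=> sF p1 p1' p2; have [lin sth] := hth; have tv := psection_tangent a p2.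
rewrite /liealg_d1 /panchor ambientD2 ambientZ2.
have -> : (fun b => th (F b *: Z1 b + Z1' b)) = (fun b => F b * th (Z1 b) + th (Z1' b)).
  by apply/funext => b; apply: lin; exact: prs.
have s1 := sth _ p1; have s1' := sth _ p1'.
rewrite (tangent_add tv (smooth_mul SA sF s1) s1') (tangent_mul tv sF s1).
have q1 := prs a p1; have q12 := prs a (br_psection p1 p2).
have q1' := prs a (br_psection p1' p2).
rewrite (br_linl a sF p2 p1 p1') -scaleNr.
rewrite (form1D (prolongD (prolongZ _ q12) (prolongZ _ q1)) q1').
rewrite (form1D (prolongZ _ q12) (prolongZ _ q1)) (form1Z _ q12) (form1Z _ q1).
move: (th (Z1 a)) (th (br Z1 Z2 a)) (th (br Z1' Z2 a)) ((Z1 a).2 _) ((Z1' a).2 _).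
move: ((Z2 a).2 F) ((Z2 a).2 _) ((Z2 a).2 _) => *; ring.
Qed.

Lemma d1_linr F Z1 Z2 Z2' a : CA F -> psection Z1 -> psection Z2 -> psection Z2' ->
  d1 Z1 (fun b => F b *: Z2 b + Z2' b) a = F a * d1 Z1 Z2 a + d1 Z1 Z2' a.
Proof.
move=> sF p1 p2 p2'; rewrite d1_antisym//; last exact: psection_lin.
by rewrite d1_linl// (d1_antisym a p1 p2) (d1_antisym a p1 p2') opprD mulrN.
Qed.

Lemma d1_pointwise Z1 Z1' Z2 Z2' a : psection Z1 -> psection Z1' -> psection Z2 -> psection Z2' ->
  Z1 a = Z1' a -> Z2 a = Z2' a -> d1 Z1 Z2 a = d1 Z1' Z2' a.
Proof.
move=> p1 p1' p2 p2' e1 e2.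
transitivity (d1 Z1' Z2 a).
  apply: (@tensor_pointwise _ _ _ _ A (fun Z => d1 Z Z2 a) a) => // F X Y sF pX pY.
  exact: d1_linl.
apply: (@tensor_pointwise _ _ _ _ A (fun Z => d1 Z1' Z a) a) => // F X Y sF pX pY.
exact: d1_linr.
Qed.

Lemma d2_d1 Z1 Z2 Z3 a (om : forall a : TA, ambient a -> ambient a -> R) :
  (forall Z1 Z2, psection Z1 -> psection Z2 -> forall a, om a (Z1 a) (Z2 a) = d1 Z1 Z2 a) ->
  psection Z1 -> psection Z2 -> psection Z3 ->
  liealg_d2 (@panchor _ _ _ _ A) br om Z1 Z2 Z3 a = 0.
Proof.
move=> omE p1 p2 p3; have [lin sth] := hth.
have p12 := br_psection p1 p2; have p13 := br_psection p1 p3; have p23 := br_psection p2 p3.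
have E X Y : psection X -> psection Y -> (fun b => om b (X b) (Y b)) = d1 X Y.
  by move=> pX pY; apply/funext => b; exact: omE.
have D X Y Z : psection X -> psection Y -> psection Z -> (Z a).2 (d1 X Y) =
    (Z a).2 (fun b => (X b).2 (fun b => th (Y b))) -
    (Z a).2 (fun b => (Y b).2 (fun b => th (X b))) - (Z a).2 (fun b => th (br X Y b)).
  move=> pX pY pZ; have tv := psection_tangent a pZ.
  have sXY := psection_smooth pX (sth _ pY); have sYX := psection_smooth pY (sth _ pX).
  have sB := sth _ (br_psection pX pY).
  have H := tangent_sub SA tv (smooth_sub SA sXY sYX) sB.
  exact: (etrans H (congr1 (fun x => x - _) (tangent_sub SA tv sXY sYX))).
rewrite /liealg_d2 /panchor !E// !omE// !D//.
rewrite /liealg_d1 /panchor (anchor_br a p1 p2 (sth _ p3)) (anchor_br a p1 p3 (sth _ p2)).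
rewrite (anchor_br a p2 p3 (sth _ p1)).
(* Once [anchor_br] has disposed of the derivatives along brackets, what is left is [th] of the
   Jacobi expression. *)
have J : th (br (br Z1 Z2) Z3 a) - th (br (br Z1 Z3) Z2 a) + th (br (br Z2 Z3) Z1 a) = 0.
  have q1 := prs a (br_psection p12 p3); have q2 := prs a (br_psection p13 p2).
  have q3 := prs a (br_psection p23 p1).
  have e : br (br Z1 Z2) Z3 a - br (br Z1 Z3) Z2 a + br (br Z2 Z3) Z1 a = 0.
    rewrite (br_antisym p13 p2) (br_antisym p23 p1) opprK.
    apply: oppr_inj; rewrite oppr0 -[RHS](br_jacobi a p1 p2 p3) !opprD opprK.
    by rewrite [LHS]addrC addrA addrAC.
  rewrite -(form1N q2) -(form1D q1 (prolongN q2)) -(form1D (prolongD q1 (prolongN q2)) q3) e.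
  exact: form1_0.
move: J; move: (th (br (br Z1 Z2) Z3 a)) (th (br (br Z1 Z3) Z2 a)) (th (br (br Z2 Z3) Z1 a)) => j1 j2 j3 J.
have -> : j1 = j2 - j3 by move/eqP: J; rewrite -addrA addr_eq0 opprD opprK => /eqP ->; rewrite addrC.
ring.
Qed.

End Form1.

End LieRinehart.

(** * Cartan sections *)

Section Cartan.
Variables (R : realType) (m r : nat) (M : manifold R m) (A : lieAlgebroid M r).
Local Notation AM := (matlas M).
Local Notation AE := (total_atlas A).
Local Notation TA := (total_space A).
Local Notation CA := (smooth AE).
Implicit Types (Z : forall a : TA, ambient a) (L F : TA -> R).
Variable br : (forall a : TA, ambient a) -> (forall a : TA, ambient a) -> forall a : TA, ambient a.
Hypothesis hbr : is_prolongation_bracket br.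

Lemma is_derive_sum_cst n (I : Type) (s : seq I) (k : I -> R) (f : I -> 'rV[R]_n -> R)
    (x v : 'rV[R]_n) : (forall i, derivable (f i) x v) ->
  is_derive x v (fun z : 'rV[R]_n => \sum_(i <- s) k i * f i z) (\sum_(i <- s) k i * 'D_v (f i) x).
Proof.
move=> df; elim: s => [|i s IHs].
  rewrite big_nil (_ : (fun _ => _) = cst 0); first exact: is_derive_cst.
  by apply/funext => z; rewrite big_nil.
rewrite big_cons.
have dfi : is_derive x v (f i) ('D_v (f i) x) by exact/derivableP/df.
have := is_deriveD (is_deriveZ (k i) dfi) IHs.
rewrite (_ : (_ + _)%R = (fun z : 'rV[R]_n => \sum_(j <- i :: s) k j * f j z)) //.
by apply/funext => z; rewrite big_cons.
Qed.

Lemma cartan1E L a (w : ambient a) : cartan1 L w = vlift w.1 L.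
Proof. by rewrite /cartan1 /vert_endo_form1 opprK. Qed.

Lemma form1_cartan1 L : CA L -> @form1 _ _ _ _ A (cartan1 L).
Proof.
move=> sL; split=> [a k u v pu pv|Z pZ].
  by rewrite !cartan1E ambientD1 ambientZ1 vlift_linear.
rewrite (_ : (fun a => _) = (fun a => vlift (Z a).1 L)).
  by apply: smooth_vlift => //; have [] := pZ.
by apply/funext => a; rewrite cartan1E.
Qed.

(** It turns the differential, an operation on sections, into a function of vectors; by
    [d1_pointwise] the chosen extension does not affect the value. Off the prolongation the zero
    section is a harmless default. *)
Definition prolong_extension (a : TA) (w : ambient a) : forall a : TA, ambient a :=
  match pselect (exists2 Z, psection Z & Z a = w) with
  | left e => projT1 (cid2 e)
  | right _ => fun=> 0
  end.

Lemma prolong_extension_psection (a : TA) (w : ambient a) : psection (prolong_extension w).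
Proof.
rewrite /prolong_extension; case: pselect => [e|_]; last exact: psection0.
by case: cid2.
Qed.

Lemma prolong_extensionE (a : TA) (w : ambient a) : prolong w -> prolong_extension w a = w.
Proof.
move=> pw; rewrite /prolong_extension; case: pselect => [e|[]]; first by case: cid2.
by have [Z [s [pZ _ _ Za]]] := psection_through pw; exists Z.
Qed.

Definition d1_form (th : forall a : TA, ambient a -> R) (a : TA) (w1 w2 : ambient a) : R :=
  liealg_d1 (@panchor _ _ _ _ A) br th (prolong_extension w1) (prolong_extension w2) a.

Lemma d1_formE th Z1 Z2 a : form1 th -> psection Z1 -> psection Z2 ->
  d1_form th (Z1 a) (Z2 a) = liealg_d1 (@panchor _ _ _ _ A) br th Z1 Z2 a.
Proof.
move=> hth p1 p2; apply: d1_pointwise => //; try exact: prolong_extension_psection.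
  by rewrite prolong_extensionE//; have [] := p1.
by rewrite prolong_extensionE//; have [] := p2.
Qed.

Lemma is_d1_form th : form1 th -> is_d1 br th (d1_form th).
Proof.
move=> hth; split=> [|Z1 Z2 p1 p2 a]; last exact: d1_formE.
have ext := prolong_extension_psection.
split=> [a k u v w pu pv pw|a u v pu pv|Z1 Z2 p1 p2].
- have pc : psection (A := A) (fun b => k *: prolong_extension u b + prolong_extension v b).
    by apply: (psection_lin (F := fun=> k)) => //; exact: smooth_cst.
  have H := d1_linl hbr hth a (@smooth_cst _ _ _ AE k) (ext _ u) (ext _ v) (ext _ w).
  rewrite {2 3}/d1_form -[RHS]H -(d1_formE a hth pc (ext _ w)).
  by rewrite !prolong_extensionE.
- exact: d1_antisym.
- rewrite (_ : (fun a => _) = liealg_d1 (@panchor _ _ _ _ A) br th Z1 Z2).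
    exact: d1_smooth.
  by apply/funext => a; exact: d1_formE.
Qed.

Lemma smooth_section0 : smooth_section (fun x => 0 : A x).
Proof.
have SM := manifold_smooth_atlas M; move=> t bt i.
have ot : aopen AM (tdom t) by apply/aopenP; exact: tdom_open.
apply: (@smooth_in_eq _ _ _ _ SM _ (fun=> 0)) => //; last exact: smooth_in_cst.
by move=> x tx; rewrite tcoord0// mxE.
Qed.

Lemma lbracket0l (s : forall x, A x) x : smooth_section s -> lbracket (fun=> 0) s x = 0.
Proof.
move=> ss; have s0 := smooth_section0.
have := lie_linear (lie_bracket A) 1 s0 s0 ss x.
rewrite (_ : (fun b => 1 *: 0 + 0) = (fun b => 0 : A b)); last first.
  by apply: functional_extensionality_dep => b; rewrite scaler0 addr0.
by rewrite scale1r => /eqP; rewrite -{1}[lbracket _ _ _]addr0 => /eqP/addrI <-.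
Qed.

(** The section [s] lives on the base, so its coordinates are constant along the fiber and are not
    differentiated by the outer lift; only second derivatives of [F] appear. *)
Lemma vlift_vlift a (b : A (bproj a)) (s : forall x, A x) F t : smooth_section s -> CA F ->
  btriv t -> tdom t (bproj a) ->
  vlift b (fun a' => vlift (s (bproj a')) F) =
  \sum_k tcoord t b 0 k * \sum_l tcoord t (s (bproj a)) 0 l *
    fiber_hessian F (bproj a) t (tcoord t (projT2 a)) k l.
Proof.
move=> ss sF bt ta; pose G (a' : TA) := vlift (s (bproj a')) F.
have sG : CA G.
  apply: smooth_vlift => // t' bt' i.
  exact: (smooth_in_pull (tdom_open bt') (ss t' bt' i)).
apply: etrans (vlift_sum b sG bt ta) _; apply: eq_bigr => k _; congr (_ * _).
have sD l : smooth_on setT ('D_'e_l (fiber_fun F (bproj a) t)).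
  exact: smooth_on_derive (smooth_fiber_fun sF bt ta).
have -> : fiber_fun G (bproj a) t = fun z : 'rV[R]_r =>
    \sum_l tcoord t (s (bproj a)) 0 l * 'D_'e_l (fiber_fun F (bproj a) t) z.
  apply/funext => z; pose a' := total_point (tvec t (bproj a) z).
  apply: etrans (vlift_sum (a := a') (s (bproj a)) sF bt ta) _.
  by apply: eq_bigr => l _; rewrite tvecK.
rewrite (_ : \sum_l _ = \sum_l tcoord t (s (bproj a)) 0 l *
    'D_'e_k ('D_'e_l (fiber_fun F (bproj a) t)) (tcoord t (projT2 a))).
  apply: (@derive_val _ _ _ _ _ _ _ (is_derive_sum_cst _ _ _)) => l.
  exact: smooth_on_derivable (sD l) I.
by apply: eq_bigr => l _; rewrite mxE.
Qed.

Lemma fiber_hessian_sym L t x y i j : CA L -> btriv t -> tdom t x ->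
  fiber_hessian (E := A) L x t y i j = fiber_hessian L x t y j i.
Proof.
move=> sL bt tx; rewrite !mxE.
exact: (derive_comm _ _ openT (smooth_fiber_fun sL bt tx)).
Qed.

Lemma fiber_hessian_form_sym F x t y (u v : 'rV[R]_r) : CA F -> btriv t -> tdom t x ->
  \sum_k u 0 k * \sum_l v 0 l * fiber_hessian F x t y k l =
  \sum_k v 0 k * \sum_l u 0 l * fiber_hessian F x t y k l.
Proof.
move=> sF bt tx; under eq_bigr do rewrite mulr_sumr.
under [RHS]eq_bigr do rewrite mulr_sumr.
rewrite exchange_big /=; apply: eq_bigr => k _; apply: eq_bigr => l _.
by rewrite mulrCA fiber_hessian_sym.
Qed.

(* The bracket of two projectable sections, the first one vertical, is vertical,
   so only one term of the differential of cartan1 L survives. *)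
Lemma cartan2_vert_endo L om a (w1 w2 : ambient a) t : CA L -> is_cartan2 br L om ->
  prolong w1 -> prolong w2 -> btriv t -> tdom t (bproj a) ->
  om a (vert_endo w1) w2 = \sum_k tcoord t w1.1 0 k * \sum_l tcoord t w2.1 0 l *
    fiber_hessian L (bproj a) t (tcoord t (projT2 a)) k l.
Proof.
move=> sL [_ omE] pw1 pw2 bt ta.
have [Z1 [s1 [pZ1 ss1 Z1s Z1a]]] := psection_through pw1.
have [Z2 [s2 [pZ2 ss2 Z2s Z2a]]] := psection_through pw2.
have pJ := psection_vert_endo pZ1.
have s2E : s2 (bproj a) = w2.1 by rewrite -Z2s Z2a.
have := omE _ _ pJ pZ2 a; rewrite Z1a Z2a => ->.
rewrite /liealg_d1 /panchor (hbr.2 _ _ (fun=> 0) s2 pJ pZ2 smooth_section0 ss2) //.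
have v0 : vlift (0 : A (bproj a)) L = 0 by rewrite vlift0.
rewrite cartan1E /= lbracket0l// v0.
rewrite (_ : (fun b => cartan1 L (vert_endo (Z1 b))) = fun=> 0); last first.
  by apply/funext => b; rewrite cartan1E /= vlift0.
rewrite (tangent_cst (psection_tangent a pZ2)) !subr0 Z1a.
rewrite -s2E -(vlift_vlift w1.1 ss2 sL bt ta); congr (vlift _ _).
by apply/funext => b; rewrite cartan1E Z2s.
Qed.

Lemma horizontal_vert_endo (Th : forall a : TA, ambient a -> ambient a -> R) a
    (w w' : ambient a) : horizontal Th -> prolong w -> prolong w' ->
  Th a (vert_endo w) w' = 0.
Proof.
move=> hTh pw pw'; have [Z [s [pZ ss Zs <-]]] := psection_through pw.
have pJ := psection_vert_endo pZ.
by apply: (hTh _ pJ) => // b; split => //; have [] := pJ.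
Qed.

Lemma vert_endo_form2_cartan2 L om Th Om : CA L -> is_cartan2 br L om ->
  form2 Th -> horizontal Th ->
  form2_eq Om (fun a w1 w2 => Th a w1 w2 + om a w1 w2) ->
  form2_eq (vert_endo_form2 Om) (fun (a : TA) (w1 w2 : ambient a) => 0).
Proof.
move=> sL hom [_ Tha _] hTh OmE a w1 w2 pw1 pw2.
have [[_ oma _] _] := hom.
have [t bt ta] := bundle_cover A (bproj a).
have pJ1 := prolong_vert_endo w1; have pJ2 := prolong_vert_endo w2.
rewrite /vert_endo_form2 !OmE// (Tha _ w1)// (oma _ w1)//.
rewrite (horizontal_vert_endo hTh pw1 pw2) (horizontal_vert_endo hTh pw2 pw1) oppr0 !add0r opprK.
rewrite (cartan2_vert_endo sL hom pw1 pw2 bt ta) (cartan2_vert_endo sL hom pw2 pw1 bt ta).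
by rewrite fiber_hessian_form_sym// addNr.
Qed.

End Cartan.

(** * The potential of the fiberwise form *)

Section FiberPoincare.
Variables (R : realType) (m r : nat) (M : manifold R m) (E : vectorBundle M r).
Local Notation AM := (matlas M).
Local Notation AE := (total_atlas E).
Local Notation TE := (total_space E).
Implicit Types (t : trivialization E r) (c : chart R M m) (q : 'I_r -> TE -> R).

Definition scale_point (s : R) (a : TE) : TE := total_point (s *: projT2 a).

(** The integral, along the ray from the origin of the fiber to [a], of the fiberwise 1-form whose
    components in [t] are [q k]. *)
Definition radial_primitive t q (a : TE) : R :=
  integral01 (fun s => \sum_k tcoord t (projT2 a) 0 k * q k (scale_point s a)).

Let fiber_index : pred 'I_(m + r) := fun i => (m <= i)%N.

Let U c t := cphi (total_chart c t) @` cdom (total_chart c t).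

Let stretch_lsubmx s z : lsubmx (stretch fiber_index 0 s z) = lsubmx z :> 'rV[R]_m.
Proof. by apply/rowP => j; rewrite !mxE /fiber_index /= leqNgt ltn_ord. Qed.

Let stretch_rsubmx s z : rsubmx (stretch fiber_index 0 s z) = s *: rsubmx z :> 'rV[R]_r.
Proof. by apply/rowP => j; rewrite !mxE /fiber_index /= leq_addr subr0 add0r. Qed.

Let U_stretch c t (s : R) z : AM c -> btriv t -> 0 <= s <= 1 -> U c t z ->
  U c t (stretch fiber_index 0 s z).
Proof. by move=> ac bt _; rewrite /U !total_image_self//= stretch_lsubmx. Qed.

Let U_open c t : AM c -> btriv t -> open (U c t).
Proof. by move=> ac bt; exact: (chart_imageT (total_smooth_atlas E) (total_atlasP ac bt)). Qed.

Let U_tdom c t z : AM c -> btriv t -> U c t z -> tdom t (cpsi c (lsubmx z)).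
Proof.
move=> ac bt; rewrite /U total_image_self// => -[x [cx tx] <-].
by have [_ _ cK _ _] := manifold_chart ac; rewrite cK.
Qed.

Let scale_cpsi c t s z : AM c -> btriv t -> U c t z ->
  scale_point s (cpsi (total_chart c t) z) =
  cpsi (total_chart c t) (stretch fiber_index 0 s z).
Proof.
move=> ac bt Uz; have tx := U_tdom ac bt Uz.
rewrite /scale_point /= stretch_rsubmx stretch_lsubmx; congr total_point.
by have := tvec_line 0 (rsubmx z) s bt tx; rewrite !add0r (_ : tvec t _ 0 = 0) ?add0r//;
  apply: (tcoord_inj bt tx); rewrite tvecK// tcoord0.
Qed.

(** The base components are filled with 0: the contraction leaves the base coordinates fixed, so
    they carry no offset in the primitive. *)
Let coord_family c t q (i : 'I_(m + r)) (z : 'rV[R]_(m + r)) : R :=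
  match fintype.split i with
  | inl _ => 0
  | inr k => q k (cpsi (total_chart c t) z)
  end.

Let coord_familyE c t q k : coord_family c t q (rshift m k) = q k \o cpsi (total_chart c t).
Proof.
apply/funext => z; rewrite /coord_family; case: fintype.splitP => j /= E1.
  by have := ltn_ord j; rewrite -E1 ltnNge leq_addr.
by congr (q _ _); apply: val_inj; move/addnI: E1.
Qed.

Definition smooth_family t q :=
  forall k, smooth_in AE [set a | tdom t (bproj a)] (q k).

Let smooth_coord_family c t q i : AM c -> btriv t -> smooth_family t q ->
  smooth_on (U c t) (coord_family c t q i).
Proof.
move=> ac bt sq; rewrite -(splitK i); case: (fintype.split i) => k /=.
  apply: (@smooth_on_eq _ _ _ (cst 0)) (smooth_on_cst _ _); first exact: U_open.
  move=> z _; rewrite /coord_family; case: fintype.splitP => j //= E1.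
  by have := ltn_ord k; rewrite E1 ltnNge leq_addr.
rewrite coord_familyE; apply: smooth_onS (sq k _ (total_atlasP ac bt)).
by move=> z [a [ca ta] <-]; exists a.
Qed.

Lemma continuous01_scale t q a k : btriv t -> tdom t (bproj a) -> smooth_family t q ->
  continuous01 (fun s => q k (scale_point s a)).
Proof.
move=> bt ta sq; have [c ac cx] := manifold_cover (bproj a).
have ad := total_atlasP ac bt; pose z := cphi (total_chart c t) a.
have Uz : U c t z by exists a.
have aE : cpsi (total_chart c t) z = a by exact: (chartK (total_smooth_atlas E) ad).
have -> : (fun s => q k (scale_point s a)) =
    fun s => coord_family c t q (rshift m k) (stretch fiber_index 0 s z).
  by apply/funext => s; rewrite coord_familyE /comp -scale_cpsi// aE.
apply: (continuous01_stretch (U := U c t)) => // [x s|x]; first exact: U_stretch.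
exact/smooth_on_continuous/smooth_coord_family.
Qed.

(** The bridge to the calculus on row vectors: it gives smoothness jointly in the base and fiber
    variables, not merely on each fiber. *)
Let radial_primitive_chart c t q z : AM c -> btriv t -> smooth_family t q -> U c t z ->
  (radial_primitive t q \o cpsi (total_chart c t)) z =
  fiber_primitive fiber_index 0 (coord_family c t q) z.
Proof.
move=> ac bt sq Uz; have tx := U_tdom ac bt Uz.
rewrite (fiber_primitiveE (U := U c t)) => [|s z' |i|//]; [|exact: U_stretch|exact: smooth_coord_family].
apply: eq_integral01 => s _; rewrite big_split_ord /= [X in _ = X + _]big1 ?add0r => [|i _].
  apply: eq_bigr => k _; rewrite tvecK// coord_familyE; congr (_ * _).
    by rewrite !mxE /fiber_index /= leq_addr subr0.
  exact: (congr1 (q k) (scale_cpsi s ac bt Uz)).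
by rewrite mxE /fiber_index /= leqNgt ltn_ord mul0r.
Qed.

Lemma smooth_radial_primitive t q : btriv t -> smooth_family t q ->
  smooth_in AE [set a | tdom t (bproj a)] (radial_primitive t q).
Proof.
move=> bt sq; have SA := total_smooth_atlas E.
apply: (smooth_in_local SA) => a ta; have [c ac cx] := manifold_cover (bproj a).
have ad := total_atlasP ac bt.
exists (cdom (total_chart c t)), (radial_primitive t q); split=> //; first exact: cdom_aopen.
apply: (smooth_in_chart SA ad) => //; first exact: cdom_aopen.
have oU := U_open ac bt.
apply: (smooth_on_eq (f := fiber_primitive fiber_index 0 (coord_family c t q)) oU).
  by move=> z Uz; rewrite radial_primitive_chart.
apply: smooth_fiber_primitive => // [s z|i]; first exact: U_stretch.
exact: smooth_coord_family.
Qed.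

Lemma derive_radial_primitive t q x y l : btriv t -> tdom t x -> smooth_family t q ->
  (forall k x y, tdom t x ->
    'D_'e_l (fiber_fun (q k) x t) y = 'D_'e_k (fiber_fun (q l) x t) y) ->
  'D_'e_l (fiber_fun (radial_primitive t q) x t) y = fiber_fun (q l) x t y.
Proof.
move=> bt tx sq sym; have [c ac cx] := manifold_cover x.
have oU := U_open ac bt; have Uz := row_mx_image y ac bt cx tx.
rewrite (partial_fiber_fun _ _ _ _ ac cx) (fiber_funE _ _ _ ac cx).
transitivity ('D_'e_(rshift m l) (fiber_primitive fiber_index 0 (coord_family c t q))
    (row_mx (cphi c x) y)).
  apply: near_eq_derive; near=> z; apply: radial_primitive_chart => //.
  by near: z; exact: open_nbhs_nbhs.
rewrite (derive_fiber_primitive (U := U c t)) //.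
- by rewrite coord_familyE.
- by move=> s z; exact: U_stretch.
- by move=> i; exact: smooth_coord_family.
- by rewrite /fiber_index /= leq_addr.
move=> i z; rewrite -(splitK i); case: (fintype.split i) => k /=.
  by rewrite /fiber_index /= leqNgt ltn_ord.
move=> _; rewrite /U total_image_self// => -[x' [cx' tx'] xz].
rewrite !coord_familyE -(hsubmxK z) -xz -!(partial_fiber_fun _ _ _ _ ac cx').
exact: sym.
Unshelve. all: by end_near. Qed.

End FiberPoincare.

(** * The Lagrangian attached to a symplectic section killed by [J] *)

Section Potential.
Variables (R : realType) (m r : nat) (M : manifold R m) (A : lieAlgebroid M r).
Local Notation AM := (matlas M).
Local Notation AE := (total_atlas A).
Local Notation TA := (total_space A).
Local Notation CA := (smooth AE).
Implicit Types (Z : forall a : TA, ambient a) (L F : TA -> R) (t : trivialization A r).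
Variable br : (forall a : TA, ambient a) -> (forall a : TA, ambient a) -> forall a : TA, ambient a.
Hypothesis hbr : is_prolongation_bracket br.
Variable Omega : forall a : TA, ambient a -> ambient a -> R.
Hypotheses (hOmega : symplectic br Omega) (hvert : vanishes_on_vert Omega).
Hypothesis hJ : form2_eq (vert_endo_form2 Omega) (fun (a : TA) (w1 w2 : ambient a) => 0).

(** Test the vertical lift on the functions [fiber_coord]: their cutoff depends on the base point
    alone, so on the fiber through [a] they are exactly the linear coordinates. *)
Lemma vlift_inj (a : TA) (b : A (bproj a)) : vlift b = 0 -> b = 0.
Proof.
move=> b0; have [t bt ta] := bundle_cover A (bproj a).
have [c ac ca] := manifold_cover (bproj a).
have oW : open (cdom c `&` tdom t).
  by apply: openI; [have [] := manifold_chart ac|exact: tdom_open].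
have [D [chi [oD Da cut]]] := manifold_cutoff oW (conj ca ta).
apply: (tcoord_inj bt ta); rewrite tcoord0//; apply/rowP => j; rewrite [RHS]mxE.
have sF : CA (fiber_coord c t chi j) by exact: (smooth_fiber_coord ac bt cut).
have := congr1 (fun v => v (fiber_coord c t chi j)) b0.
rewrite (vlift_sum b sF bt ta).
have -> : fiber_fun (fiber_coord c t chi j) (bproj a) t = (fun y : 'rV[R]_r => y 0 j).
  by apply/funext => y; rewrite /fiber_fun (fiber_coordE (D1 := D))//= tvecK.
rewrite (bigD1 j)//= (derive_val (is_derive := derivable_coordP j _ _)) big1 => [|k kj].
  by rewrite !mxE !eqxx mulr1 addr0.
by rewrite (derive_val (is_derive := derivable_coordP j _ _)) !mxE eq_sym (negPf kj) andbF mulr0.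
Qed.

Let form2_Omega : form2 Omega. Proof. by have [] := hOmega. Qed.

Lemma form2_linr (om : forall a : TA, ambient a -> ambient a -> R) a k (u v w : ambient a) :
  form2 om -> prolong u -> prolong v -> prolong w ->
  om a w (k *: u + v) = k * om a w u + om a w v.
Proof.
move=> [lin anti _] pu pv pw; have puv := prolong_lin k pu pv.
rewrite (anti _ _ _ pw puv) lin// (anti _ _ _ pw pu) (anti _ _ _ pw pv).
by rewrite opprD mulrN.
Qed.

Definition some_lift (a : TA) (b : A (bproj a)) : ambient a := projT1 (cid2 (prolong_lift b)).

Lemma some_lift_prolong (a : TA) (b : A (bproj a)) : prolong (some_lift b).
Proof. by rewrite /some_lift; case: cid2. Qed.

Lemma some_lift1 (a : TA) (b : A (bproj a)) : (some_lift b).1 = b.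
Proof. by rewrite /some_lift; case: cid2. Qed.

Lemma vert_endo_fst (a : TA) (u v : ambient a) : u.1 = v.1 -> vert_endo u = vert_endo v.
Proof. by rewrite /vert_endo => ->. Qed.

Lemma vert_vert (a : TA) (u : ambient a) : vert (vert_endo u).
Proof. by split => //; exact: prolong_vert_endo. Qed.

Definition fiber_metric (a : TA) (b b' : A (bproj a)) : R :=
  Omega (vert_endo (some_lift b)) (some_lift b').

Lemma fiber_metricE (a : TA) (w1 w2 : ambient a) : prolong w2 ->
  Omega (vert_endo w1) w2 = fiber_metric w1.1 w2.1.
Proof.
move=> pw2; have pl := some_lift_prolong w2.1.
rewrite /fiber_metric (@vert_endo_fst a (some_lift w1.1) w1) ?some_lift1//.
apply/eqP; rewrite -subr_eq0 addrC -mulN1r; apply/eqP.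
rewrite -form2_linr//; last exact: prolong_vert_endo.
apply: hvert; first exact: vert_vert.
split; first exact: prolong_lin.
by rewrite ambientD1 ambientZ1 some_lift1 scaleN1r addNr.
Qed.

Lemma fiber_metric_linl (a : TA) k (b b' c : A (bproj a)) :
  fiber_metric (k *: b + b') c = k * fiber_metric b c + fiber_metric b' c.
Proof.
have [lin _ _] := form2_Omega; rewrite /fiber_metric -lin; last first.
- exact: some_lift_prolong.
- exact: prolong_vert_endo.
- exact: prolong_vert_endo.
rewrite -vert_endo_linear; congr Omega; apply: vert_endo_fst.
by rewrite ambientD1 ambientZ1 !some_lift1.
Qed.

Lemma fiber_metric_sym (a : TA) (b b' : A (bproj a)) : fiber_metric b b' = fiber_metric b' b.
Proof.
have [_ anti _] := form2_Omega.
have pb := some_lift_prolong b; have pb' := some_lift_prolong b'.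
have := hJ pb pb'; rewrite /vert_endo_form2 (anti _ _ _ pb (prolong_vert_endo _)) opprK.
by move/eqP; rewrite addrC subr_eq0 => /eqP.
Qed.

Lemma fiber_metric_suml (a : TA) (I : Type) (e : seq I) (k : I -> R) (b : I -> A (bproj a)) c :
  fiber_metric (\sum_(i <- e) k i *: b i) c = \sum_(i <- e) k i * fiber_metric (b i) c.
Proof.
elim: e => [|i e IHe]; last by rewrite !big_cons fiber_metric_linl IHe.
rewrite !big_nil; have := fiber_metric_linl 1 (0 : A (bproj a)) 0 c.
by rewrite scaler0 addr0 mul1r => /eqP; rewrite -{1}[fiber_metric _ _]addr0 => /eqP/addrI <-.
Qed.

Definition metric_coef t (k l : 'I_r) (a : TA) : R :=
  fiber_metric (tvec t (bproj a) 'e_k) (tvec t (bproj a) 'e_l).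

Lemma metric_coef_sym t k l : metric_coef t k l = metric_coef t l k.
Proof. by apply/funext => a; exact: fiber_metric_sym. Qed.

Lemma fiber_metric_sum t (a : TA) (b c : A (bproj a)) : btriv t -> tdom t (bproj a) ->
  fiber_metric b c =
  \sum_k tcoord t b 0 k * \sum_l tcoord t c 0 l * metric_coef t k l a.
Proof.
move=> bt ta; rewrite -[in LHS](tcoordK b bt ta) tvec_sum// fiber_metric_suml.
apply: eq_bigr => k _; congr (_ * _); rewrite fiber_metric_sym.
rewrite -[in LHS](tcoordK c bt ta) tvec_sum// fiber_metric_suml.
by apply: eq_bigr => l _; rewrite fiber_metric_sym.
Qed.

(** The lifts chosen in [fiber_metric] need not vary smoothly; since the value does not depend on
    them, a smooth local frame may replace them near each point. *)
Lemma smooth_metric_coef t k : btriv t -> smooth_family t (metric_coef t k).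
Proof.
move=> bt l; have SA := total_smooth_atlas A.
apply: (smooth_in_local SA) => a ta.
have [chi [s [E [mu [D [[oD Da Dt _ _] [_ pE pJ E1 sE] _ _]]]]]] := local_frame bt ta.
exists [set a | D (bproj a)], (fun b => Omega (vert_endo (E k b)) (E l b)); split=> //.
- exact: pull_aopen.
- have [_ _ sO] := form2_Omega; apply: smooth_in_sub (sO _ _ (pJ k) (pE l)).
  by [].
- move=> b Db; rewrite fiber_metricE; last by have [] := pE l.
  by rewrite !E1 !sE.
Qed.

(** Vertical lifts of sections of the base have coefficients constant along the fibers, so they
    commute by the symmetry of second derivatives. *)
Lemma br_vert Z1 Z2 (s1 s2 : forall x, A x) a : psection Z1 -> psection Z2 ->
  smooth_section s1 -> smooth_section s2 ->
  (forall a, Z1 a = (0, vlift (s1 (bproj a)))) -> (forall a, Z2 a = (0, vlift (s2 (bproj a)))) ->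
  br Z1 Z2 a = 0.
Proof.
move=> p1 p2 ss1 ss2 e1 e2.
rewrite (hbr.2 _ _ (fun=> 0) (fun=> 0) p1 p2 (@smooth_section0 _ _ _ _ A) (@smooth_section0 _ _ _ _ A)); last 2 first.
- by move=> b; rewrite e1.
- by move=> b; rewrite e2.
apply: ambient_ext => [|G]; first by rewrite /= lbracket0l//; exact: smooth_section0.
rewrite ambient02 /= /vf_bracket e1 e2 /=.
have -> : (fun b => (Z1 b).2 G) = (fun b => vlift (s1 (bproj b)) G).
  by apply/funext => b; rewrite e1.
have -> : (fun b => (Z2 b).2 G) = (fun b => vlift (s2 (bproj b)) G).
  by apply/funext => b; rewrite e2.
(* The vector components are compared on all functions; on a nonsmooth one each vertical lift gives
   the constant 0, which derivations kill. *)
have [sG|sG] := pselect (CA G); last first.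
  have z (s : forall x, A x) : (fun b : TA => vlift (s (bproj b)) G) = fun=> 0.
    by apply/funext => b; exact: vlift_nonsmooth.
  by rewrite !z !(tangent_cst (vlift_tangent _)) subr0.
have [t bt ta] := bundle_cover A (bproj a).
rewrite (vlift_vlift _ ss1 sG bt ta) (vlift_vlift _ ss2 sG bt ta).
by rewrite fiber_hessian_form_sym// subrr.
Qed.

(* Evaluate d Omega = 0 on J E_i, J E_k, E_l for a local frame E. *)
Lemma metric_coef_closed t i k l x y : btriv t -> tdom t x ->
  'D_'e_i (fiber_fun (metric_coef t k l) x t) y = 'D_'e_k (fiber_fun (metric_coef t i l) x t) y.
Proof.
move=> bt tx.
have [chi [s [E [mu [D [[oD Dx Dt _ _] [ss pE pJ E1 sE] _ _]]]]]] := local_frame bt tx.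
pose a := total_point (tvec t x y).
pose G k l (b : TA) := Omega (vert_endo (E k b)) (E l b).
have GE k' l' : fiber_fun (metric_coef t k' l') x t = fiber_fun (G k' l') x t.
  apply/funext => z; rewrite /fiber_fun /G fiber_metricE; last by have [] := pE l'.
  by rewrite !E1 !sE.
have [_ _ sO] := form2_Omega.
have sG k' l' : CA (G k' l') by exact: sO (pJ k') (pE l').
have vE i' k' l' : vlift (s i' x : A (bproj a)) (G k' l') =
    'D_'e_i' (fiber_fun (metric_coef t k' l') x t) y.
  rewrite GE (vlift_sum (a := a) _ (sG k' l') bt tx) /= sE// !tvecK//.
  rewrite (bigD1 i')//= big1 => [|j ji]; last by rewrite !mxE (negPf ji) andbF mul0r.
  by rewrite !mxE !eqxx mul1r addr0.
have vb j : vert (br (fun b => vert_endo (E j b)) (E l) a).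
  split; first by have [] := br_psection hbr (pJ j) (pE l).
  rewrite (hbr.2 _ _ (fun=> 0) (s l) (pJ j) (pE l) (@smooth_section0 _ _ _ _ A) (ss l))//=.
  exact: lbracket0l.
have [_ cl _] := hOmega.
have := cl _ _ _ (pJ i) (pJ k) (pE l) a.
rewrite /liealg_d2 /panchor.
have eJ j b : vert_endo (E j b) = (0, vlift (s j (bproj b))) by rewrite /vert_endo E1.
have bJ : br (fun b => vert_endo (E i b)) (fun b => vert_endo (E k b)) a = 0.
  exact: (br_vert a (pJ i) (pJ k) (ss i) (ss k) (eJ i) (eJ k)).
rewrite bJ.
(* The brackets of a vertical frame section with [E l] are vertical, so [Omega] pairs them to 0 with
   the other vertical frame section. Likewise the derivative along [E l] is that of a zero function.
   Two of the six terms survive. *)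
rewrite (hvert (vb i) (vert_vert _)) (hvert (vb k) (vert_vert _)).
have [lin _ _] := form2_Omega.
have O0 (w : ambient a) : prolong w -> Omega (0 : ambient a) w = 0.
  move=> pw; have := lin a 1 0 0 w (prolong0 _) (prolong0 _) pw.
  by rewrite scaler0 addr0; move: (Omega _ _) => z; lra.
rewrite O0; last by have [] := pE l.
have -> : (fun b => Omega (vert_endo (E i b)) (vert_endo (E k b))) = fun=> 0.
  by apply/funext => b; apply: hvert; exact: vert_vert.
rewrite (tangent_cst (psection_tangent a (pE l))) !subr0 !addr0.
move/eqP; rewrite subr_eq0 => /eqP H.
by move: H; rewrite (eJ i a) (eJ k a) -!vE.
Qed.

(** The fiber derivative of the future Lagrangian at [a] in direction [b], that is its Legendre map.
    It is written without a trivialization so that it is globally defined. *)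
Definition fiber_momentum (a : TA) (b : A (bproj a)) : R :=
  integral01 (fun s => @fiber_metric (scale_point s a) b (projT2 a)).

(* In the fiber coordinates of t, d_l momentum_coef t k = metric_coef t k l and
   d_k metric_potential = momentum_coef t k. *)
Definition metric_potential (a : TA) : R :=
  integral01 (fun s => @fiber_momentum (scale_point s a) (projT2 a)).

Definition momentum_coef t k : TA -> R := radial_primitive t (metric_coef t k).

Lemma fiber_momentum_sum t (a : TA) (b : A (bproj a)) : btriv t -> tdom t (bproj a) ->
  fiber_momentum b = \sum_k tcoord t b 0 k * momentum_coef t k a.
Proof.
move=> bt ta.
have cs k : continuous01 (fun s =>
    \sum_l tcoord t (projT2 a) 0 l * metric_coef t k l (scale_point s a)).
  apply: continuous01_sum => l; apply: continuous01M; first exact: continuous01_cst.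
  exact: continuous01_scale (smooth_metric_coef k bt).
transitivity (integral01 (fun s => \sum_k tcoord t b 0 k *
    \sum_l tcoord t (projT2 a) 0 l * metric_coef t k l (scale_point s a))).
  apply: eq_integral01 => s _.
  exact: (@fiber_metric_sum t (scale_point s a) b (projT2 a) bt ta).
rewrite integral01_sum => [|k]; last by apply: continuous01M => //; exact: continuous01_cst.
by apply: eq_bigr => k _; rewrite integral01Zl.
Qed.

Lemma metric_potentialE t (a : TA) : btriv t -> tdom t (bproj a) ->
  metric_potential a = radial_primitive t (momentum_coef t) a.
Proof.
move=> bt ta; apply: eq_integral01 => s _.
exact: (@fiber_momentum_sum t (scale_point s a) (projT2 a) bt ta).
Qed.

Lemma smooth_momentum_coef t : btriv t -> smooth_family t (momentum_coef t).
Proof. by move=> bt k; apply: smooth_radial_primitive => //; exact: smooth_metric_coef. Qed.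

Lemma smooth_metric_potential : CA metric_potential.
Proof.
have SA := total_smooth_atlas A; apply: (smooth_in_local SA) => a _.
have [t bt ta] := bundle_cover A (bproj a).
exists [set a | tdom t (bproj a)], (radial_primitive t (momentum_coef t)); split=> //.
- exact: pull_aopen (tdom_open bt).
- by apply: smooth_radial_primitive => //; exact: smooth_momentum_coef.
- by move=> b tb; exact: metric_potentialE.
Qed.

Lemma derive_momentum_coef t k l x y : btriv t -> tdom t x ->
  'D_'e_l (fiber_fun (momentum_coef t k) x t) y = fiber_fun (metric_coef t k l) x t y.
Proof.
move=> bt tx; apply: derive_radial_primitive => //; first exact: smooth_metric_coef.
move=> j x' y' tx'; rewrite (metric_coef_sym t k j) (metric_coef_sym t k l).
exact: metric_coef_closed.
Qed.

(** The first integration uses closedness of the coefficients. Its result satisfies the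
    integrability condition for the second because the fiber derivatives of the momenta are the
    symmetric [metric_coef]. *)
Lemma fiber_hessian_metric_potential t x y i j : btriv t -> tdom t x ->
  fiber_hessian metric_potential x t y i j = metric_coef t i j (total_point (tvec t x y)).
Proof.
move=> bt tx; rewrite mxE.
have -> : (fun z => metric_potential (existT (fun x => A x : Type) x (tvec t x z))) =
    fiber_fun (radial_primitive t (momentum_coef t)) x t.
  by apply/funext => z; exact: (metric_potentialE (a := total_point (tvec t x z)) bt tx).
have -> : 'D_'e_j (fiber_fun (radial_primitive t (momentum_coef t)) x t) =
    fiber_fun (momentum_coef t j) x t.
  have sym k x' y' : tdom t x' -> 'D_'e_j (fiber_fun (momentum_coef t k) x' t) y' =
      'D_'e_k (fiber_fun (momentum_coef t j) x' t) y'.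
    move=> tx'; apply: etrans (derive_momentum_coef k j y' bt tx') _.
    by rewrite metric_coef_sym; exact/esym/(derive_momentum_coef j k y' bt tx').
  apply/funext => z.
  exact: (derive_radial_primitive z bt tx (smooth_momentum_coef bt) sym).
by apply: etrans (derive_momentum_coef j i y bt tx) _; rewrite metric_coef_sym.
Qed.

(** A vector [v] in the kernel of the Hessian gives [b] whose image under [vert_endo] pairs to 0
    with everything, so this image vanishes by non-degeneracy; [vlift_inj] then yields [b = 0]. *)
Lemma regular_metric_potential : regular_lagrangian metric_potential.
Proof.
move=> t bt x tx y; rewrite unitmxE unitfE; apply/negP => /det0P[v v0 vH].
pose a := total_point (tvec t x y); pose b : A (bproj a) := tvec t x v.
have gb c : fiber_metric b c = 0.
  rewrite (@fiber_metric_sum t a b c bt tx) [tcoord t b](tvecK v bt tx).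
  under eq_bigr do rewrite mulr_sumr.
  rewrite exchange_big /= big1// => l _.
  have := congr1 (fun w : 'rV_r => w 0 l) vH; rewrite !mxE => H.
  transitivity (tcoord t c 0 l * \sum_k v 0 k * fiber_hessian metric_potential x t y k l).
    rewrite mulr_sumr; apply: eq_bigr => k _.
    by rewrite (fiber_hessian_metric_potential y k l bt tx) mulrCA.
  by rewrite H mulr0.
have [_ _ nd] := hOmega.
have J0 : vert_endo (some_lift b) = 0.
  apply: nd; first exact: prolong_vert_endo.
  by move=> w pw; rewrite fiber_metricE// some_lift1.
have b0 : b = 0.
  apply: vlift_inj; have := congr1 (fun w : ambient a => w.2) J0.
  by rewrite /vert_endo some_lift1.
move/eqP: v0; apply; rewrite -(tvecK v bt tx) [tvec t x v]b0.
exact: tcoord0.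
Qed.

Lemma horizontal_decomposition :
  exists (Theta : forall a : TA, ambient a -> ambient a -> R) (L : TA -> R)
    (omegaL : forall a : TA, ambient a -> ambient a -> R),
    [/\ form2 Theta, horizontal Theta & closed_form2 br Theta] /\
    [/\ CA L, regular_lagrangian L & is_cartan2 br L omegaL] /\
    form2_eq Omega (fun a w1 w2 => Theta a w1 w2 + omegaL a w1 w2).
Proof.
have SA := total_smooth_atlas A.
pose L := metric_potential; have sL : CA L by exact: smooth_metric_potential.
have fL := form1_cartan1 sL.
pose om := d1_form br (@cartan1 _ _ _ _ A L).
have hom : is_cartan2 br L om by exact: is_d1_form.
have [[omlin omanti oms] omE] := hom.
have [Olin Oanti Os] := form2_Omega; have [_ Ocl _] := hOmega.
exists (fun a w1 w2 => Omega w1 w2 - om a w1 w2), L, om; split; last first.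
  split; first by split=> //; exact: regular_metric_potential.
  by move=> a w1 w2 _ _; rewrite subrK.
split.
- split=> [a k u v w pu pv pw|a u v pu pv|Z1 Z2 p1 p2].
  + rewrite Olin// omlin//.
    by move: (Omega u w) (Omega v w) (om a u w) (om a v w) => *; ring.
  + by rewrite (Oanti _ _ _ pu pv) (omanti _ _ _ pu pv) [RHS]opprB opprK addrC.
  + by apply: (smooth_sub SA); [exact: Os|exact: oms].
(* Vertical vectors are images of [vert_endo], and on these both forms have the same coefficients,
   [metric_coef] on one side and the fiberwise Hessian on the other. *)
- move=> Z pZ vZ a w pw; have [w' pw' ->] := vert_vert_endo (vZ a).
  have [t bt ta] := bundle_cover A (bproj a).
  rewrite fiber_metricE// (fiber_metric_sum _ _ bt ta).
  rewrite (cartan2_vert_endo hbr sL hom pw' pw bt ta).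
  apply/eqP; rewrite subr_eq0; apply/eqP; apply: eq_bigr => k _; congr (_ * _).
  apply: eq_bigr => l _; rewrite fiber_hessian_metric_potential// tcoordK//.
  by rewrite total_pointE.
- move=> Z1 Z2 Z3 p1 p2 p3 a.
  have sub X Y Z : psection X -> psection Y -> psection Z ->
      (X a).2 (fun b => Omega (Y b) (Z b) - om b (Y b) (Z b)) =
      (X a).2 (fun b => Omega (Y b) (Z b)) - (X a).2 (fun b => om b (Y b) (Z b)).
    move=> pX pY pZ; apply: (tangent_sub SA (psection_tangent a pX)); first exact: Os.
    exact: oms.
  have comb (x1 x2 x3 x4 x5 x6 y1 y2 y3 y4 y5 y6 : R) :
      x1 - x2 + x3 - x4 + x5 - x6 = 0 -> y1 - y2 + y3 - y4 + y5 - y6 = 0 ->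
      (x1 - y1) - (x2 - y2) + (x3 - y3) - (x4 - y4) + (x5 - y5) - (x6 - y6) = 0.
    by lra.
  have := d2_d1 hbr fL a omE p1 p2 p3; have := Ocl _ _ _ p1 p2 p3 a.
  rewrite /liealg_d2 /panchor !sub// => e1 e2.
  exact: comb e1 e2.
Qed.

End Potential.

Theorem proposition7p3 (R : realType) (m r : nat) (M : manifold R m)
    (A : lieAlgebroid M r)
    (br : (forall a : total_space A, ambient a) ->
       (forall a : total_space A, ambient a) ->
       forall a : total_space A, ambient a)
    (hbr : is_prolongation_bracket br)
    (Omega : forall a : total_space A, ambient a -> ambient a -> R)
    (hOmega : symplectic br Omega) (hvert : vanishes_on_vert Omega) :
  form2_eq (vert_endo_form2 Omega) (fun a w1 w2 => 0) <->
  exists (Theta : forall a : total_space A, ambient a -> ambient a -> R)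
    (L : total_space A -> R)
    (omegaL : forall a : total_space A, ambient a -> ambient a -> R),
    [/\ form2 Theta, horizontal Theta & closed_form2 br Theta] /\
    [/\ smooth (total_atlas A) L, regular_lagrangian L &
        is_cartan2 br L omegaL] /\
    form2_eq Omega (fun a w1 w2 => Theta a w1 w2 + omegaL a w1 w2).
Proof.
split=> [hJ|]; last move=> [ Th [ L [ om [[fT hT _] [[sL _ hom] OE]]]]].
  exact: horizontal_decomposition.
exact: (vert_endo_form2_cartan2 hbr sL hom fT hT OE).
Qed.
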